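(* Let $g(z)=|z|^\alpha$ with $\alpha\in\mathbb{R}$. (H) For each $t>0$, $g^{(t)}\in L^\infty(\mathbb{C})$ if and only if $\alpha\in(-2,0]$. (T) $T_g:F^2(\mathbb{C})\to F^2(\mathbb{C})$ is bounded if and only if $\alpha\in(-2,0]$. (U) $U_g:\mathcal{D}(M_g)\subset L^2(\mu)\to F^2(\mathbb{C})$ is bounded if and only if $\alpha\in(-1,0]$. In particular, for $\alpha\in(-2,-1]$ the operator $T_g$ is bounded but $U_g$ is unbounded.
   Context: $dA$ is planar Lebesgue measure, $d\mu(z)=\pi^{-1}e^{-|z|^2}\,dA(z)$, and $F^2(\mathbb{C})$ is the Bargmann space of entire $f$ with $\|f\|_{F^2}^2=\int_{\mathbb{C}}|f|^2\,d\mu<\infty$. $P:L^2(\mu)\to F^2(\mathbb{C})$ is the orthogonal projection. (For $\alpha<0$ the value $g(0)$ is irrelevant; symbols are considered up to null sets.) Heat transform: $g^{(t)}(x)=\frac{1}{4\pi t}\int_{\mathbb{C}}g(y)e^{-|x-y|^2/(4t)}\,dA(y)$ for $t>0$. Form-defined operator: $\mathcal{D}(\mathfrak{t}_g)=\{f\in F^2(\mathbb{C}):|g|^{1/2}f\in L^2(\mu)\}$ and $\mathfrak{t}_g(f,h)=\int_{\mathbb{C}}gf\overline h\,d\mu$ for $f,h\in\mathcal{D}(\mathfrak{t}_g)$. ''$T_g$ is bounded'' means that $\mathcal{D}(\mathfrak{t}_g)$ is dense in $F^2(\mathbb{C})$ and $|\mathfrak{t}_g(f,h)|\le C\|f\|_{F^2}\|h\|_{F^2}$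 on $\mathcal{D}(\mathfrak{t}_g)\times\mathcal{D}(\mathfrak{t}_g)$ for some $C>0$, so that the form extends to a bounded form on $F^2\times F^2$; $T_g$ is then the unique bounded operator on $F^2(\mathbb{C})$ with $\langle T_gf,h\rangle=\mathfrak{t}_g(f,h)$ (extended form). Natural-domain operator: $\mathcal{D}(M_g)=\{f\in L^2(\mu):gf\in L^2(\mu)\}$, $U_gf=P(gf)$ for $f\in\mathcal{D}(M_g)$; it is bounded if $\|U_gf\|_{F^2}\le C\|f\|_{L^2(\mu)}$ on $\mathcal{D}(M_g)$ for some $C>0$, and unbounded otherwise. *)

(* Defs.v *)
From HB Require Import structures.
From mathcomp Require Import all_boot all_order all_algebra.
From mathcomp Require Import all_classical all_reals all_analysis.
From mathcomp Require Import measurable_realfun.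
From mathcomp Require Export complex.

Set Implicit Arguments.
Unset Strict Implicit.
Unset Printing Implicit Defensive.

Import Order.TTheory GRing.Theory Num.Theory.
Import numFieldTopology.Exports numFieldNormedType.Exports.

Local Open Scope classical_set_scope.
Local Open Scope ring_scope.
Local Open Scope complex_scope.

Local Notation Re := complex.Re.
Local Notation Im := complex.Im.

Section plane.
Variable R : realType.

(* Functions live on R[i]; integration takes place on R * R, which carries the
   product sigma-algebra, through the identification (x, y) |-> x + iy. *)
Definition toC (p : R * R) : R[i] := p.1 +i* p.2.

(* The real-valued modulus; the norm `|z| of R[i] takes its values in R[i]. *)
Definition modC (z : R[i]) : R := Re `|z|.

Definition dA := (@lebesgue_measure R \x @lebesgue_measure R)%E.

Definition gauss_density (z : R[i]) : R := pi^-1 * expR (- modC z ^+ 2).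

Definition gaussian (A : set (R * R)) : \bar R :=
  (\int[dA]_(p in A) (gauss_density (toC p))%:E)%E.

Lemma modCE (z : R[i]) : modC z = Num.sqrt (Re z ^+ 2 + Im z ^+ 2).
Proof. by rewrite /modC normc_def. Qed.

Lemma gauss_density_ge0 z : 0 <= gauss_density z.
Proof. by rewrite mulr_ge0 ?invr_ge0 ?pi_ge0 ?expR_ge0. Qed.

Lemma measurable_gauss_density :
  measurable_fun [set: R * R] (fun p => gauss_density (toC p)).
Proof.
rewrite /gauss_density.
under eq_fun do rewrite modCE sqr_sqrtr ?addr_ge0 ?sqr_ge0//=.
apply: measurable_funM => //; apply: measurableT_comp => //.
apply: measurableT_comp => //.
by apply: measurable_funD; apply: measurable_funX.
Qed.

Let gaussian0 : gaussian set0 = 0%E.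
Proof. by rewrite /gaussian integral_set0. Qed.

Let gaussian_ge0 A : (0 <= gaussian A)%E.
Proof. by apply: integral_ge0 => p _; rewrite lee_fin gauss_density_ge0. Qed.

Let gaussian_sigma_additive : semi_sigma_additive gaussian.
Proof.
move=> /= A mA tA mUA; rewrite /gaussian ge0_integral_bigcup//=.
- apply: is_cvg_ereal_nneg_natsum_cond => n _ _.
  by apply: integral_ge0 => p _; rewrite lee_fin gauss_density_ge0.
- apply/measurable_funTS/measurable_EFinP.
  exact: measurable_gauss_density.
- by move=> p _; rewrite lee_fin gauss_density_ge0.
Qed.

HB.instance Definition _ := isMeasure.Build _ _ _
  gaussian gaussian0 gaussian_ge0 gaussian_sigma_additive.

End plane.

Section bargmann.
Variable R : realType.
Notation C := R[i].
Notation mu := (@gaussian R).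

Definition measurableC (f : C -> C) : Prop :=
  measurable_fun [set: R * R] (fun p => Re (f (toC p))) /\
  measurable_fun [set: R * R] (fun p => Im (f (toC p))).

Definition integralC (f : C -> C) : C :=
  (\int[mu]_p Re (f (toC p)))%R +i* (\int[mu]_p Im (f (toC p)))%R.

Definition L2 : set (C -> C) := [set f | measurableC f /\
  (\int[mu]_p (modC (f (toC p)) ^+ 2)%:E < +oo)%E].

Definition normL2 (f : C -> C) : R :=
  Num.sqrt (\int[mu]_p (modC (f (toC p)) ^+ 2))%R.

Definition innerL2 (f h : C -> C) : C := integralC (fun z => f z * conjc (h z)).

(* R[i] is a normed module over itself, so that [derivable f z 1] is complex
   differentiability at z. *)
Definition entire (f : C -> C) : Prop :=
  forall z : C, derivable (f : C^o -> C^o) z 1.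

Definition F2 : set (C -> C) := [set f | entire f /\ L2 f].

(* P f is the element h of F2 such that f - h is orthogonal to F2. *)
Definition bargmann_proj (f : C -> C) : C -> C :=
  xget (fun=> 0) [set h | F2 h /\
    forall k, F2 k -> innerL2 (fun z => f z - h z) k = 0].

(* Symbols are real-valued. *)
Implicit Type g : C -> R.

(* The integral is extended-real valued: it is +oo when a nonnegative symbol
   is not integrable against the heat kernel. *)
Definition heat_transform g (t : R) (x : C) : \bar R :=
  ((4 * pi * t)^-1%:E *
   \int[@dA R]_p (g (toC p) * expR (- modC (x - toC p) ^+ 2 / (4 * t)))%:E)%E.

Definition Linfty (u : C -> \bar R) : Prop :=
  measurable_fun [set: R * R] (fun p => u (toC p)) /\
  ('N[@dA R]_+oo[u \o @toC R] < +oo)%E.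

Definition form_dom g : set (C -> C) :=
  [set f | F2 f /\ L2 (fun z => (Num.sqrt `|g z|)%:C * f z)].

Definition toeplitz_form g (f h : C -> C) : C :=
  integralC (fun z => (g z)%:C * f z * conjc (h z)).

Definition denseF2 (D : set (C -> C)) : Prop :=
  forall f, F2 f -> forall e : R, 0 < e ->
  exists2 h, D h & normL2 (fun z => f z - h z) < e.

Definition T_bounded g : Prop :=
  denseF2 (form_dom g) /\
  exists2 c : R, 0 < c & forall f h, form_dom g f -> form_dom g h ->
    modC (toeplitz_form g f h) <= c * normL2 f * normL2 h.

Definition mult_dom g : set (C -> C) :=
  [set f | L2 f /\ L2 (fun z => (g z)%:C * f z)].

Definition U_op g (f : C -> C) : C -> C :=
  bargmann_proj (fun z => (g z)%:C * f z).

Definition U_bounded g : Prop :=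
  exists2 c : R, 0 < c & forall f, mult_dom g f ->
    normL2 (U_op g f) <= c * normL2 f.

(* [0 `^ alpha] is 0 for alpha <> 0 and 1 for alpha = 0. *)
Definition power_symbol (alpha : R) (z : C) : R := modC z `^ alpha.

End bargmann.

(* Main.v *)
Require Import Defs.
From mathcomp Require Import all_boot all_order all_algebra.
From mathcomp Require Import all_classical all_reals all_analysis.
From mathcomp Require Import measurable_realfun ring lra.

Set Implicit Arguments.
Unset Strict Implicit.
Unset Printing Implicit Defensive.

Import Order.TTheory GRing.Theory Num.Theory.
Import numFieldTopology.Exports numFieldNormedType.Exports.
Local Open Scope classical_set_scope.
Local Open Scope ring_scope.
Local Open Scope complex_scope.
Local Notation Re := complex.Re.
Local Notation Im := complex.Im.

(** The boundedness of the three objects is decided by the behaviour of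
    [|z|^alpha] at infinity, which excludes [alpha > 0], and at the origin.

    At infinity, for [alpha > 0], the heat transform at [x] is bounded below by
    a multiple of [|x|^alpha] ([heat_transform_lower]).  For the two operators the
    monomials [z^n] are test functions: their mass lies near [|z|^2 = n], so
    multiplication by a positive power of [|z|] increases their norm by an
    unbounded factor ([power_moment_growth]).  For [T_g] one takes [f = h = z^n]; for
    [U_g] one takes [f = |z|^(-alpha) z^n], since then [g f = z^n] is its own
    projection.

    At the origin, [|z|^alpha] is locally integrable for [dA] exactly when
    [alpha > -2] ([power_locally_integrable], [power_not_integrable]), which settles
    the heat transform.  An entire function is bounded on the unit disc by its
    norm ([entire_pointwise_bound]), so for [-2 < alpha <= 0] the weighted norm
    [\int |z|^alpha |f|^2 dmu] is at most a constant times the squared norm of [f]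
    ([weighted_norm_bound]); the Cauchy-Schwarz inequality then bounds the form on
    the whole space.  For [alpha <= -2] the functions of the form domain vanish at
    0, and evaluation at 0 is continuous, so the domain is not dense.

    For [U_g] the multiplication acts on one factor only: with [h = P (g f)] one
    has [|h|^2 = <f, g h>], so that the exponent [2 alpha] must be locally
    integrable, which leads to [alpha > -1].  For [alpha <= -1] let [S] be the sum
    of [(1 - |z|^2)_+^k] over [2 <= k < M + 2] and
    [f = |z|^(-alpha) e^(|z|^2) S].  Then [g f] is a bounded function
    whose projection is, by the mean value property, the constant
    [m = 1/pi \int S dA], which grows like the harmonic series in [M]; since
    [|z|^2 S <= 1], the norm of [f] is at most [sqrt (e m)], hence is much
    smaller than [m].

    The function theory needed is the mean value property, for functions that are
    only assumed complex differentiable, against powers of the truncated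
    paraboloid [T = (1 - rho |z - z0|^2)_+].  The real and imaginary parts [u] and
    [v] of [f] define two closed forms, which have potentials by bisection
    ([goursat], [closed_potential]).  Pairing these with derivatives of [X T^n] and
    [Y T^n], where [X] and [Y] are the coordinates centred at [z0], relates
    consecutive moments [\int T^n u dA] ([cap_weak]), and letting [n] grow gives
    [\int T^n u dA = u(z0) \int T^n dA] ([mean_value]).  The limit of
    [(1 - |z|^2/n)_+^n] yields the mean value property for the Gaussian measure
    ([gaussian_mean_value]). *)

(** * Potentials of closed forms *)

Section primitive.
Context {R : realType}.
Notation leb := (@lebesgue_measure R).

Lemma continuous_primitive (f : R -> R) : continuous f ->
  exists F : R -> R, forall x : R, is_derive x 1 F (f x).
Proof.
move=> cf.
have fi (a b : R) : leb.-integrable `[a, b] (EFin \o f).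
  apply: continuous_compact_integrable; first exact: segment_compact.
  exact: continuous_subspaceT.
pose I a b := (\int[leb]_(t in `[a, b]) f t)%R.
exists (fun x => if 0 <= x then I 0 x else - I x 0) => x.
(* Near x, the two-sided integral from 0 is rewritten as an integral from a
   base point c to the left of both 0 and x. *)
pose c : R := - (`|x| + 1).
have FE (y : R) : c < y -> (if 0 <= y then I 0 y else - I y 0) = I c y - I c 0.
  move=> cy; have c0 : c < 0 by rewrite oppr_lt0 ltr_wpDl.
  have [y0|y0] := leP 0 y.
    rewrite /I (@Rintegral_itvB _ f (BLeft c) (BRight y) 0)//; first last.
    - by rewrite bnd_simp ltW.
    rewrite Rintegral_itv_obnd_cbnd//.
    by apply: integrableS (fi 0 y) => //; exact: subset_itv_oc_cc.
  rewrite -opprB /I (@Rintegral_itvB _ f (BLeft c) (BRight 0) y)//; first last.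
  - by rewrite bnd_simp ltW.
  - by rewrite bnd_simp ltW.
  rewrite Rintegral_itv_obnd_cbnd//.
  by apply: integrableS (fi y 0) => //; exact: subset_itv_oc_cc.
have cx : c < x.
  by rewrite /c ltrNl (@le_lt_trans _ _ `|x|) ?ltrDl// -normrN ler_norm.
have xx1 : x < x + 1 by rewrite ltrDl.
have [dF F'] := @continuous_FTC1_closed _ f c x (x + 1) xx1
  (fi _ _) cx (cf x).
have dIx : is_derive x 1 (fun y => I c y - I c 0) (f x).
  have -> : f x = f x - 0 by rewrite subr0.
  have dI : is_derive x 1 (I c) (f x).
    by rewrite -F' derive1E; exact: derivableP.
  exact: (@is_deriveB _ _ _ (I c) (cst (I c 0)) x 1 (f x) 0).
apply: (near_eq_is_derive _ dIx).
near=> y; rewrite FE//; near: y.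
exact: lt_nbhsr.
Unshelve. all: by end_near. Qed.

End primitive.

Section goursat.
Context {R : realType}.
Implicit Types (a b c d x y : R) (I : R * R) (B : (R * R) * (R * R)).

(** The form [p dx + q dy] is real differentiable at every point and closed:
    the same number [B] is the y-derivative of [p] and the x-derivative of
    [q].  No continuity of the derivatives is required. *)
Definition closed_differentiable (p q : R * R -> R) := forall x y,
  exists A B C : R, forall e : R, 0 < e -> exists2 d : R, 0 < d &
  forall x' y', `|x' - x| < d -> `|y' - y| < d ->
  `|p (x', y') - p (x, y) - (A * (x' - x) + B * (y' - y))|
     <= e * (`|x' - x| + `|y' - y|) /\
  `|q (x', y') - q (x, y) - (B * (x' - x) + C * (y' - y))|
     <= e * (`|x' - x| + `|y' - y|).

(** The right ([true]) or left half of an interval given by its endpoints. *)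
Definition half (i : bool) I : R * R :=
  if i then ((I.1 + I.2) / 2, I.2) else (I.1, (I.1 + I.2) / 2).

Lemma half_width i I : (half i I).2 - (half i I).1 = (I.2 - I.1) / 2.
Proof. by case: i; rewrite /half/=; field. Qed.

Lemma half_nested i I : I.1 <= I.2 ->
  [/\ I.1 <= (half i I).1, (half i I).1 <= (half i I).2 & (half i I).2 <= I.2].
Proof. by case: i; rewrite /half/= => ?; split; lra. Qed.

Lemma nested_intervals (I : nat -> R * R) :
  (forall n, [/\ (I n).1 <= (I n.+1).1, (I n).1 <= (I n).2 &
     (I n.+1).2 <= (I n).2]) ->
  exists x, forall n, (I n).1 <= x <= (I n).2.
Proof.
move=> nI.
have le1 m n : (m <= n)%N -> (I m).1 <= (I n).1.
  move=> /subnK <-; elim: (n - m)%N => // k /le_trans; apply.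
  by rewrite addSn; case: (nI (k + m)%N).
have le2 m n : (m <= n)%N -> (I n).2 <= (I m).2.
  move=> /subnK <-; elim: (n - m)%N => // k; apply: le_trans.
  by rewrite addSn; case: (nI (k + m)%N).
have le12 m n : (I m).1 <= (I n).2.
  have [mn|/ltnW nm] := leqP m n.
    by apply: (le_trans (le1 _ _ mn)); case: (nI n).
  by apply: le_trans (le2 _ _ nm); case: (nI m).
pose S := range (fun n => (I n).1).
have S0 : S !=set0 by exists (I 0%N).1; exists 0%N.
have hS : has_sup S by split => //; exists (I 0%N).2 => _ [m _ <-].
exists (sup S) => n; apply/andP; split.
  by apply: sup_upper_bound => //; exists n.
by apply: sup_le_ub => // _ [m _ <-].
Qed.

Lemma pow2_gt (x : R) : exists n : nat, x < 2 ^+ n.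
Proof.
exists (Num.bound x); have [x0|x0] := leP 0 x; last first.
  by rewrite (lt_le_trans x0)// exprn_ge0.
apply: lt_trans (archi_boundP x0) _.
by rewrite -natrX ltr_nat ltn_expl.
Qed.

Variables (p q P Q : R * R -> R).
Hypothesis pq : closed_differentiable p q.
Hypothesis dP : forall x y, is_derive x 1 (fun t => P (t, y)) (p (x, y)).
Hypothesis dQ : forall x y, is_derive y 1 (fun t => Q (x, t)) (q (x, y)).

(** The integral of [p dx + q dy] around the boundary of a rectangle [B],
    written with [P], an x-primitive of [p] on each horizontal line, and [Q], a
    y-primitive of [q] on each vertical line. *)
Definition circulation B : R := let: ((a, b), (c, d)) := B in
  (P (b, c) - P (a, c)) + (Q (b, d) - Q (b, c))
  - (P (b, d) - P (a, d)) - (Q (a, d) - Q (a, c)).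

Definition quarter (ij : bool * bool) B := (half ij.1 B.1, half ij.2 B.2).

Lemma circulation_quarter B : exists ij,
  `|circulation B| / 4 <= `|circulation (quarter ij B)|.
Proof.
apply: contrapT => /forallNP h.
have {}h i j : `|circulation (quarter (i, j) B)| < `|circulation B| / 4.
  by rewrite ltNge; apply/negP/h.
have E : circulation B = circulation (quarter (false, false) B) +
   circulation (quarter (false, true) B) + circulation (quarter (true, false) B)
   + circulation (quarter (true, true) B).
  by case: B {h} => -[a b] [c d]; rewrite /circulation/=; ring.
have := h false false; have := h false true; have := h true false.
have := h true true => h1 h2 h3 h4.
have : `|circulation B| < `|circulation B|; last by rewrite ltxx.
rewrite {1}E; apply: (le_lt_trans (ler_normD _ _)).
have := ler_normD (circulation (quarter (false, false) B) +
   circulation (quarter (false, true) B)) (circulation (quarter (true, false) B)).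
have := ler_normD (circulation (quarter (false, false) B))
   (circulation (quarter (false, true) B)).
lra.
Qed.

(** A closed affine form has zero circulation, so around a point of
    differentiability only the error term contributes, and it is small with
    respect to the square of the side lengths. *)
Lemma circulation_local x y e : 0 < e -> exists2 r : R, 0 < r &
  forall a b c d, a <= x <= b -> c <= y <= d -> b - a < r -> d - c < r ->
  `|circulation ((a, b), (c, d))| <= e * ((b - a) + (d - c)) ^+ 2.
Proof.
move=> e0; have [A [B [C +]]] := pq x y.
move=> /(_ (e / 2)); rewrite divr_gt0// => /(_ isT)[r r0 h].
exists r => // a b c d /andP[ax xb] /andP[cy yd] abr cdr.
pose L := (b - a) + (d - c); rewrite -/L.
have near_p x' y' : a <= x' <= b -> c <= y' <= d ->
  `|p (x', y') - p (x, y) - (A * (x' - x) + B * (y' - y))| <= e / 2 * L /\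
  `|q (x', y') - q (x, y) - (B * (x' - x) + C * (y' - y))| <= e / 2 * L.
  move=> /andP[ax' x'b] /andP[cy' y'd].
  have hx : `|x' - x| <= b - a by rewrite ler_norml; lra.
  have hy : `|y' - y| <= d - c by rewrite ler_norml; lra.
  have [h1 h2] := h x' y' (le_lt_trans hx abr) (le_lt_trans hy cdr).
  have hL : e / 2 * (`|x' - x| + `|y' - y|) <= e / 2 * L.
    by rewrite ler_pM2l ?divr_gt0// lerD.
  by split; [exact: le_trans h1 hL|exact: le_trans h2 hL].
have ab : a <= b by exact: le_trans ax xb.
have cd : c <= d by exact: le_trans cy yd.
(* The linear corrections of g and k cancel in the circulation, and remove the
   cross derivative B from the derivatives of g and k. *)
pose g t := P (t, c) - P (t, d) + B * (d - c) * t.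
have dg t : is_derive (t : R) 1 g (p (t, c) - p (t, d) + B * (d - c) * 1).
  by apply: is_deriveD; apply: is_deriveZ.
pose k t := Q (b, t) - Q (a, t) - B * (b - a) * t.
have dk t : is_derive (t : R) 1 k (q (b, t) - q (a, t) - B * (b - a) * 1).
  by apply: is_deriveB; apply: is_deriveZ.
have cont (f df : R -> R) (I : R * R) :
    (forall t : R, is_derive t 1 f (df t)) -> {within `[I.1, I.2], continuous f}.
  move=> dd; apply: continuous_subspaceT => t.
  by apply: differentiable_continuous; apply/derivable1_diffP; case: (dd t).
have [s /[!in_itv]/= sab gE] := MVT_segment ab (fun t _ => dg t)
  (cont _ _ (a, b) dg).
have [t /[!in_itv]/= tcd kE] := MVT_segment cd (fun t _ => dk t)
  (cont _ _ (c, d) dk).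
have JE : circulation ((a, b), (c, d)) = (g b - g a) + (k d - k c).
  by rewrite /circulation /g /k; ring.
have gle : `|p (s, c) - p (s, d) + B * (d - c) * 1| <= e * L.
  have [h1 _] := near_p s c sab (introT andP (conj (lexx _) cd)).
  have [h2 _] := near_p s d sab (introT andP (conj cd (lexx _))).
  rewrite (_ : _ + _ = (p (s, c) - p (x, y) - (A * (s - x) + B * (c - y)))
     - (p (s, d) - p (x, y) - (A * (s - x) + B * (d - y)))); last by ring.
  apply: (le_trans (ler_normB _ _)); lra.
have kle : `|q (b, t) - q (a, t) - B * (b - a) * 1| <= e * L.
  have [_ h1] := near_p b t (introT andP (conj ab (lexx _))) tcd.
  have [_ h2] := near_p a t (introT andP (conj (lexx _) ab)) tcd.
  rewrite (_ : _ - _ = (q (b, t) - q (x, y) - (B * (b - x) + C * (t - y)))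
     - (q (a, t) - q (x, y) - (B * (a - x) + C * (t - y)))); last by ring.
  apply: (le_trans (ler_normB _ _)); lra.
change (`|circulation ((a, b), (c, d))| <= e * L ^+ 2).
rewrite JE gE kE; apply: (le_trans (ler_normD _ _)); rewrite !normrM.
rewrite (ger0_norm (_ : 0 <= b - a)) ?subr_ge0//.
rewrite (ger0_norm (_ : 0 <= d - c)) ?subr_ge0//.
rewrite (_ : e * L ^+ 2 = e * L * (b - a) + e * L * (d - c)).
  by rewrite lerD// ler_wpM2r// subr_ge0.
by rewrite /L; ring.
Qed.

(** Bisection: if the circulation around [B] were nonzero, one of the four
    quarters would carry at least a quarter of it, and so on; the limit point of
    the nested rectangles would contradict [circulation_local]. *)
Lemma goursat B : B.1.1 <= B.1.2 -> B.2.1 <= B.2.2 -> circulation B = 0.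
Proof.
move=> B1 B2.
have [f hf] := choice circulation_quarter.
pose step B := quarter (f B) B.
pose S n := iter n step B.
have S12 n : (S n).1.1 <= (S n).1.2 /\ (S n).2.1 <= (S n).2.2.
  elim: n => [//|n [ih1 ih2]]; rewrite /S iterS -/(S n) /step /quarter/=.
  by have [_ ? _] := half_nested (f (S n)).1 ih1;
     have [_ ? _] := half_nested (f (S n)).2 ih2.
have Sw n : ((S n).1.2 - (S n).1.1) + ((S n).2.2 - (S n).2.1) =
    ((B.1.2 - B.1.1) + (B.2.2 - B.2.1)) / 2 ^+ n.
  elim: n => [|n ih]; first by rewrite expr0 divr1.
  rewrite {1 2 3 4}/S iterS -/(S n) /step /quarter/= !half_width -mulrDl ih.
  by rewrite exprSr invfM mulrA.
have SJ n : `|circulation B| <= 4 ^+ n * `|circulation (S n)|.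
  elim: n => [|n ih]; first by rewrite expr0 mul1r.
  apply: (le_trans ih); rewrite exprSr -mulrA ler_wpM2l ?exprn_ge0//.
  by have := hf (S n); rewrite -/(step _) /S iterS; lra.
have [x hx] : exists x, forall n, (S n).1.1 <= x <= (S n).1.2.
  apply: (nested_intervals (I := fun n => (S n).1)) => n.
  have [h1 _] := S12 n; have [? _ ?] := half_nested (f (S n)).1 h1.
  by split => //; rewrite /S iterS.
have [y hy] : exists y, forall n, (S n).2.1 <= y <= (S n).2.2.
  apply: (nested_intervals (I := fun n => (S n).2)) => n.
  have [_ h1] := S12 n; have [? _ ?] := half_nested (f (S n)).2 h1.
  by split => //; rewrite /S iterS.
pose L := ((B.1.2 - B.1.1) + (B.2.2 - B.2.1)).
have L0 : 0 <= L by rewrite addr_ge0// subr_ge0.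
apply/eqP; rewrite -normr_eq0 eq_le normr_ge0 andbT.
apply/ler_addgt0Pl => e e0; rewrite addr0.
have e1 : 0 < e / (L ^+ 2 + 1) by rewrite divr_gt0// ltr_wpDl ?sqr_ge0.
have [r r0 hr] := circulation_local x y e1.
have [n Ln] := pow2_gt (L / r).
have pn : (0 : R) < 2 ^+ n by rewrite exprn_gt0.
have LnS : L / 2 ^+ n < r by rewrite ltr_pdivrMr// mulrC -ltr_pdivrMr.
have := Sw n; rewrite -/L; move: (S12 n) (hx n) (hy n) (SJ n).
move: (S n) => [[a b] [c d]] /= [ab cd] xab ycd JB w.
have {}JB := le_trans JB (ler_wpM2l _ (hr a b c d xab ycd _ _)).
apply: (le_trans (JB _ _ _)); [by rewrite exprn_ge0|lra|lra|].
rewrite w expr_div_n -exprM mulnC exprM (_ : 2 ^+ 2 = 4); last by rewrite -natrX.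
rewrite mulrCA (mulrC (4 ^+ n)) divfK ?expf_neq0//.
rewrite mulrAC ler_pdivrMr ?ltr_wpDl ?sqr_ge0// ler_wpM2l ?(ltW e0)//.
by rewrite lerDl.
Qed.

End goursat.

Section potential.
Context {R : realType}.
Implicit Types (p q V : R * R -> R) (x y : R).

Lemma locally_lipschitz_continuous p :
  (forall x y, exists2 K : R, 0 <= K & exists2 d : R, 0 < d &
    forall x' y', `|x' - x| < d -> `|y' - y| < d ->
    `|p (x', y') - p (x, y)| <= K * (`|x' - x| + `|y' - y|)) -> continuous p.
Proof.
move=> lp [x y]; apply/cvgrPdist_lt => e e0.
have [K K0 [d d0 h]] := lp x y.
pose r := Num.min d (e / (2 * K + 1)).
have K1 : 0 < 2 * K + 1 by lra.
have r0 : 0 < r by rewrite lt_min d0 divr_gt0.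
exists ([set x' | `|x - x'| < r], [set y' | `|y - y'| < r]) => /=.
  by split; [exact: (nbhsx_ballx x r r0)|exact: (nbhsx_ballx y r r0)].
move=> -[x' y'] /= []; rewrite distrC => hx; rewrite distrC => hy.
rewrite distrC; apply: le_lt_trans (h _ _ _ _) _.
- by rewrite (lt_le_trans hx)// ge_min lexx.
- by rewrite (lt_le_trans hy)// ge_min lexx.
have hr : r <= e / (2 * K + 1) by rewrite ge_min lexx orbT.
have : K * (`|x' - x| + `|y' - y|) <= K * (2 * r).
  by rewrite ler_wpM2l//; lra.
move/le_lt_trans; apply.
have : K * (2 * r) <= K * (2 * (e / (2 * K + 1))).
  by rewrite ler_wpM2l// ler_pM2l.
move/le_lt_trans; apply.
rewrite !mulrA ltr_pdivrMr// -mulrA mulrCA mulrA mulrC; nra.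
Qed.

Lemma closed_differentiable_continuous p q : closed_differentiable p q ->
  continuous p /\ continuous q.
Proof.
move=> pq; split; apply: locally_lipschitz_continuous => x y.
all: have [A [B [C /(_ 1 ltr01)[d d0 h]]]] := pq x y.
all: exists (`|A| + `|B| + `|C| + 1); first by rewrite !addr_ge0.
all: exists d => // x' y' hx hy; have [h1 h2] := h x' y' hx hy.
- rewrite -(subrK (A * (x' - x) + B * (y' - y)) (p (x', y') - p (x, y))).
  apply: (le_trans (ler_normD _ _)).
  have := ler_normD (A * (x' - x)) (B * (y' - y)); rewrite !normrM.
  have := normr_ge0 A; have := normr_ge0 B; have := normr_ge0 C.
  by have := normr_ge0 (x' - x); have := normr_ge0 (y' - y); nra.
- rewrite -(subrK (B * (x' - x) + C * (y' - y)) (q (x', y') - q (x, y))).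
  apply: (le_trans (ler_normD _ _)).
  have := ler_normD (B * (x' - x)) (C * (y' - y)); rewrite !normrM.
  have := normr_ge0 A; have := normr_ge0 B; have := normr_ge0 C.
  by have := normr_ge0 (x' - x); have := normr_ge0 (y' - y); nra.
Qed.

Lemma derive1_continuous (f df : R -> R) :
  (forall x : R, is_derive x 1 f (df x)) -> continuous f.
Proof.
move=> dd x; apply: differentiable_continuous.
by apply/derivable1_diffP; case: (dd x).
Qed.

Lemma continuous_fst p y : continuous p -> continuous (fun x => p (x, y)).
Proof.
move=> cp x; apply: (@continuous_comp _ _ _ (fun t => (t, y)) p); last exact: cp.
exact: (@cvg_pair _ _ _ (nbhs x) (nbhs x) (nbhs y) _ _ _ id (cst y) cvg_id (cvg_cst y)).
Qed.

Lemma continuous_snd p x : continuous p -> continuous (fun y => p (x, y)).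
Proof.
move=> cp y; apply: (@continuous_comp _ _ _ (fun t => (x, t)) p); last exact: cp.
exact: (@cvg_pair _ _ _ (nbhs y) (nbhs x) (nbhs y) _ _ _ (cst x) id (cvg_cst x) cvg_id).
Qed.

Lemma is_derive_addcst (f : R -> R) (x df c : R) :
  is_derive x 1 f df -> is_derive x 1 (fun t => f t + c) df.
Proof.
move=> dff; have := @is_deriveD _ _ _ f (cst c) x 1 df 0 dff (is_derive_cst _ _ _).
by rewrite addr0.
Qed.

Lemma closed_potential p q : continuous p -> continuous q ->
  closed_differentiable p q ->
  exists V, (forall x y, is_derive x 1 (fun t => V (t, y)) (p (x, y))) /\
            (forall x y, is_derive y 1 (fun t => V (x, t)) (q (x, y))).
Proof.
move=> cp cq pq.
have [P dP] : exists P, forall x y, is_derive x 1 (fun t => P (t, y)) (p (x, y)).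
  have [P hP] := choice (fun y => continuous_primitive (@continuous_fst p y cp)).
  by exists (fun z => P z.2 z.1) => x y; exact: hP.
have [Q dQ] : exists Q, forall x y, is_derive y 1 (fun t => Q (x, t)) (q (x, y)).
  have [Q hQ] := choice (fun x => continuous_primitive (@continuous_snd q x cq)).
  by exists (fun z => Q z.1 z.2) => x y; exact: hQ.
have J0 a b c d : circulation P Q ((a, b), (c, d)) = 0.
  wlog ab : a b / a <= b => [hw|].
    have [/hw//|/ltW/hw] := leP a b.
    by rewrite /circulation => h; rewrite -oppr0 -[in RHS]h; ring.
  wlog cd : c d / c <= d => [hw|].
    have [/hw//|/ltW/hw] := leP c d.
    by rewrite /circulation => h; rewrite -oppr0 -[in RHS]h; ring.
  exact: (goursat pq dP dQ).
(* Integrate along the x-axis, then vertically. *)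
pose V z := P (z.1, 0) - P (0, 0) + (Q z - Q (z.1, 0)).
exists V; split => x y.
  have -> : (fun t => V (t, y)) =
      (fun t => P (t, y) + (Q (0, y) - Q (0, 0) - P (0, y))).
    apply/funext => t; have := J0 0 t 0 y; rewrite /circulation /V/= => h.
    by apply/eqP; rewrite -subr_eq0 -[X in _ == X]h; apply/eqP; ring.
  exact: is_derive_addcst.
have -> : (fun t => V (x, t)) =
    (fun t => Q (x, t) + (P (x, 0) - P (0, 0) - Q (x, 0))).
  by apply/funext => t; rewrite /V/=; ring.
exact: is_derive_addcst.
Qed.

Lemma continuous_bounded_square p (a : R) : continuous p ->
  exists2 M, 0 <= M & forall x y, `|x| <= a -> `|y| <= a -> `|p (x, y)| <= M.
Proof.
move=> cp.
have cK : compact (`[- a, a] `*` `[- a, a] : set (R * R)).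
  by apply: compact_setX; exact: segment_compact.
have := compact_bounded (continuous_compact (continuous_subspaceT cp) cK).
move=> [M [_ /(_ (`|M| + 1))]].
rewrite (le_lt_trans (ler_norm M)) ?ltrDl// => /(_ isT) h.
exists (`|M| + 1) => [|x y]; first by rewrite addr_ge0.
rewrite [`|x| <= a]ler_norml [`|y| <= a]ler_norml => hx hy.
by apply: h; exists (x, y).
Qed.

Lemma potential_bounded_square p q V (a : R) : continuous p -> continuous q ->
  (forall x y, is_derive x 1 (fun t => V (t, y)) (p (x, y))) ->
  (forall x y, is_derive y 1 (fun t => V (x, t)) (q (x, y))) ->
  0 <= a ->
  exists2 M, 0 <= M & forall x y, `|x| <= a -> `|y| <= a -> `|V (x, y)| <= M.
Proof.
move=> cp cq Vp Vq a0.
have [Mp Mp0 hp] := @continuous_bounded_square p a cp.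
have [Mq Mq0 hq] := @continuous_bounded_square q a cq.
have lip (f df : R -> R) (M x : R) : (forall t : R, is_derive t 1 f (df t)) ->
    (forall t : R, `|t| <= a -> `|df t| <= M) -> `|x| <= a ->
    `|f x - f 0| <= M * a.
  move=> dd hd xa.
  have cf := continuous_subspaceT (derive1_continuous dd).
  have [x0|/ltW x0] := leP 0 x.
    have [c] := MVT_segment x0 (fun t _ => dd t) (cf _).
    rewrite in_itv/= subr0 => /andP[c0 cx] ->; rewrite normrM ler_pM//.
    by apply: hd; rewrite ger0_norm// (le_trans cx)// (le_trans _ xa)// ler_norm.
  have [c] := MVT_segment x0 (fun t _ => dd t) (cf _).
  rewrite in_itv/= sub0r => /andP[xc c0] E; rewrite distrC E normrM ler_pM//.
    apply: hd; rewrite ler0_norm//; apply: le_trans xa.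
    by rewrite ler0_norm// lerN2.
  by rewrite normrN.
exists (`|V (0, 0)| + Mq * a + Mp * a) => [|x y xa ya].
  by rewrite !addr_ge0// mulr_ge0.
have a00 : `|0 : R| <= a by rewrite normr0.
have h1 := lip _ _ Mq y (Vq 0) (fun t => hq 0 t a00) ya.
have h2 := lip _ _ Mp x (Vp ^~ y) (fun t ta => hp t y ta ya) xa.
rewrite (_ : V (x, y) = V (0, 0) + (V (0, y) - V (0, 0)) + (V (x, y) - V (0, y)));
  last by ring.
by rewrite (le_trans (ler_normD _ _))// lerD// (le_trans (ler_normD _ _))// lerD.
Qed.

End potential.

(** * Weak form of closedness in the plane *)

Section plane_integral.
Context {R : realType}.
Notation leb := (@lebesgue_measure R).
Notation dA := (@dA R).
Implicit Types (f : R * R -> R).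

(** [f] is the pointwise limit of the functions obtained by rounding the
    first coordinate down to a multiple of [1/(n+1)].  A potential is measurable
    for this reason: it is differentiable along each axis. *)
Lemma separately_continuous_measurable f :
  (forall y, continuous (fun x => f (x, y))) ->
  (forall x, continuous (fun y => f (x, y))) -> measurable_fun [set: R * R] f.
Proof.
move=> c1 c2.
pose r (n : nat) (k : int) : R := k%:~R / n.+1%:R.
pose g (n : nat) (z : R * R) := f (r n (Num.floor (z.1 * n.+1%:R)), z.2).
apply: (@measurable_fun_cvg _ _ _ _ g) => [n|[x y] _].
  move=> _ Y mY; rewrite setTI.
  have -> : g n @^-1` Y = \bigcup_(k : int)
      ([set x | Num.floor (x * n.+1%:R) = k] `*` ((fun y => f (r n k, y)) @^-1` Y)).
    apply/seteqP; split => [[x y]/= gY|[x y] [k _ [/= <-]]//].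
    by exists (Num.floor (x * n.+1%:R)).
  apply: countable_bigcupT_measurable; first exact: countableP.
  move=> k; apply: measurableX; last first.
    rewrite -[X in measurable X]setTI.
    exact: (continuous_measurable_fun (c2 _) measurableT mY).
  have -> : [set x : R | Num.floor (x * n.+1%:R) = k] =
     `[k%:~R / n.+1%:R, (k + 1)%:~R / n.+1%:R[%classic.
    apply/seteqP; split => x /=; rewrite in_itv/= ler_pdivrMr// ltr_pdivlMr//.
      by move=> <-; exact: floor_itv.
    by move=> h; exact: floor_def.
  exact: measurable_itv.
apply: (@continuous_cvg _ _ _ _ _ _ (fun t => f (t, y))); first exact: c1.
apply/cvgrPdist_lt => e e0; near=> n.
have n0 : (0 : R) < n.+1%:R by [].
have /andP[h1 h2] := floor_itv (x * n.+1%:R).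
have -> : x - r n (Num.floor (x * n.+1%:R)) =
   (x * n.+1%:R - (Num.floor (x * n.+1%:R))%:~R) / n.+1%:R.
  by rewrite /r; field; rewrite addrC natr1 gt_eqF.
rewrite normrM ger0_norm ?subr_ge0// ger0_norm ?invr_ge0 ?ltW//.
apply: (@le_lt_trans _ _ (1 * n.+1%:R^-1)).
  apply: ler_wpM2r; first by rewrite invr_ge0 ltW.
  by move: h2; rewrite intrD => h2; rewrite lerBlDl ltW.
rewrite mul1r; near: n; exact: near_infty_natSinv_lt (PosNum e0).
Unshelve. all: by end_near. Qed.

Lemma square_measure (a : R) : 0 <= a ->
  dA (`[- a, a] `*` `[- a, a]) = (4 * a ^+ 2)%:E.
Proof.
move=> a0; rewrite /dA product_measure1E//= lebesgue_measure_itv/= lte_fin.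
have [aa|aa] := ltP (- a) a.
  by rewrite -!EFinD -EFinM; congr EFin; ring.
have -> : a = 0 by lra.
by rewrite mul0e expr0n mulr0.
Qed.

Lemma compact_support_integrable f (a M : R) : 0 <= a ->
  measurable_fun setT f ->
  (forall x y, `|x| <= a -> `|y| <= a -> `|f (x, y)| <= M) ->
  (forall x y, a < `|x| \/ a < `|y| -> f (x, y) = 0) ->
  dA.-integrable setT (EFin \o f).
Proof.
move=> a0 mf bf sf.
pose S : set (R * R) := `[- a, a] `*` `[- a, a].
have mS : measurable S by apply: measurableX.
have -> : EFin \o f = (EFin \o f) \_ S.
  apply/funext => -[x y]; rewrite patchE; case: ifPn => // /negP xyS.
  rewrite /= sf//; apply: contrapT => /not_orP[/negP h1 /negP h2]; apply: xyS.
  by rewrite inE; split; rewrite /= in_itv/= -ler_norml leNgt.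
apply: (@integrable_mkcond _ _ _ dA S (EFin \o f) mS).1.
apply: (@measurable_bounded_integrable _ _ _ dA f S) => //.
- by rewrite [X in (X < _)%E](_ : _ = (4 * a ^+ 2)%:E) ?ltry//; exact: square_measure.
- exact: measurable_funTS.
- exists M; split; first exact: num_real.
  move=> N MN [x y] [/=]; rewrite !in_itv/= -!ler_norml => hx hy.
  by rewrite (le_trans (bf _ _ hx hy))// ltW.
Qed.

Lemma integral_compact_derivative (F g : R -> R) (a : R) : 0 < a ->
  (forall x : R, is_derive x 1 F (g x)) -> continuous g ->
  (forall x, a <= `|x| -> F x = 0 /\ g x = 0) ->
  (\int[leb]_x (g x)%:E = 0)%E.
Proof.
move=> a0 dF cg F0.
have -> : (\int[leb]_x (g x)%:E = \int[leb]_(x in `[(- a)%R, a]) (g x)%:E)%E.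
  rewrite [RHS]integral_mkcond; apply: eq_integral => x _.
  rewrite patchE; case: ifPn => // /negP xa.
  rewrite (F0 x _).2//; apply: contrapT => /negP; rewrite -ltNge => h; apply: xa.
  by rewrite inE /= in_itv/= -ler_norml ltW.
have cF := derive1_continuous dF.
rewrite (@continuous_FTC2 _ g F).
- have [_] : F (- a) = 0 /\ F a = 0 by split; apply: (F0 _ _).1; rewrite ?normrN ger0_norm// ltW.
  move=> Fa; have -> : F (- a) = 0 by apply: (F0 _ _).1; rewrite normrN ger0_norm// ltW.
  by rewrite Fa subee.
- by lra.
- exact: continuous_subspaceT.
- split => [x _||]; first by case: (dF x).
  + exact/cvg_at_right_filter/cF.
  + exact/cvg_at_left_filter/cF.
- by move=> x _; rewrite derive1E; case: (dF x).
Qed.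

(** If [p dx + q dy] has a potential [V] and [A dx + B dy] is another closed
    form, compactly supported, with [A_y = B_x = M], then [A V_y - B V_x] integrates
    to 0: integrating by parts, each of [A V_y] and [B V_x] has integral
    [- \int M V]. *)
Lemma weak_closed (p q V A B M : R * R -> R) (a : R) : 0 < a ->
  continuous p -> continuous q ->
  (forall x y : R, is_derive x 1 (fun t => V (t, y)) (p (x, y))) ->
  (forall x y : R, is_derive y 1 (fun t => V (x, t)) (q (x, y))) ->
  continuous A -> continuous B -> continuous M ->
  (forall x y : R, is_derive x 1 (fun t => B (t, y)) (M (x, y))) ->
  (forall x y : R, is_derive y 1 (fun t => A (x, t)) (M (x, y))) ->
  (forall x y, a <= `|x| \/ a <= `|y| ->
    [/\ A (x, y) = 0, B (x, y) = 0 & M (x, y) = 0]) ->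
  dA.-integrable setT (fun z : R * R => (A z * q z - B z * p z)%:E) /\
  (\int[dA]_z (A z * q z - B z * p z)%:E = 0)%E.
Proof.
move=> a0 cp cq Vp Vq cA cB cM BM AM supp.
have cV1 y : continuous (fun x => V (x, y)) := derive1_continuous (Vp ^~ y).
have cV2 x : continuous (fun y => V (x, y)) := derive1_continuous (Vq x).
have mV := separately_continuous_measurable cV1 cV2.
have cmeas f : continuous f -> measurable_fun setT f.
  by move=> cf; apply: separately_continuous_measurable => t;
     [exact: continuous_fst|exact: continuous_snd].
have [KV KV0 hV] := potential_bounded_square cp cq Vp Vq (ltW a0).
have int_prod (f g : R * R -> R) : continuous f -> measurable_fun setT g ->
    (forall x y : R, a <= `|x| \/ a <= `|y| -> f (x, y) = 0) ->
    (exists K : R, forall x y : R, `|x| <= a -> `|y| <= a -> `|g (x, y)| <= K) ->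
    dA.-integrable setT (fun z : R * R => (f z * g z)%:E).
  move=> cf mg f0 [K hg].
  have [Kf Kf0 hf] := continuous_bounded_square a cf.
  apply: (@compact_support_integrable (fun z => f z * g z) a (Kf * K)) => //.
  - exact: ltW.
  - by apply: measurable_funM => //; exact: cmeas.
  - by move=> x y hx hy; rewrite normrM ler_pM// ?hf ?hg.
  - by move=> x y h; rewrite f0 ?mul0r//; case: h => /ltW; [left|right].
have bq := continuous_bounded_square a cq.
have bp := continuous_bounded_square a cp.
have iAq : dA.-integrable setT (fun z => (A z * q z)%:E).
  apply: int_prod => //; [exact: cmeas|by move=> x y /supp[]|].
  by case: bq => K _ ?; exists K.
have iBp : dA.-integrable setT (fun z => (B z * p z)%:E).
  apply: int_prod => //; [exact: cmeas|by move=> x y /supp[]|].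
  by case: bp => K _ ?; exists K.
have iMV : dA.-integrable setT (fun z => (M z * V z)%:E).
  by apply: int_prod => //; [move=> x y /supp[]|exists KV].
have i1 : dA.-integrable setT (fun z => (A z * q z + M z * V z)%:E).
  rewrite (_ : (fun z => _) = (fun z => (A z * q z)%:E) \+ (fun z => (M z * V z)%:E))%E//.
  exact: integrableD.
have i2 : dA.-integrable setT (fun z => (B z * p z + M z * V z)%:E).
  rewrite (_ : (fun z => _) = (fun z => (B z * p z)%:E) \+ (fun z => (M z * V z)%:E))%E//.
  exact: integrableD.
have cont2 (f g h k : R -> R) : continuous f -> continuous g -> continuous h ->
    continuous k -> continuous (fun x => f x * g x + h x * k x).
  move=> cf cg ch ck x; apply: cvgD; apply: cvgM.
  - exact: cf.
  - exact: cg.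
  - exact: ch.
  - exact: ck.
have E1 : (\int[dA]_z (A z * q z + M z * V z)%:E = 0)%E.
  rewrite /dA -(integral12_prod_meas1 i1); apply: integral0_eq => x _.
  rewrite /fubini_F.
  apply: (@integral_compact_derivative (fun y => A (x, y) * V (x, y)) _ a) => //.
  - move=> y.
    have := @is_deriveM _ _ (fun y => A (x, y)) (fun y => V (x, y)) y 1 _ _
       (AM x y) (Vq x y).
    rewrite /GRing.scale/=; congr (is_derive _ _ _ _); ring.
  - by apply: cont2; [exact: continuous_snd|exact: continuous_snd|exact: continuous_snd|].
  - by move=> y ya; have [-> _ ->] := supp x y (or_intror ya); rewrite !mul0r addr0.
have E2 : (\int[dA]_z (B z * p z + M z * V z)%:E = 0)%E.
  rewrite /dA -(integral21_prod_meas1 i2); apply: integral0_eq => y _.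
  rewrite /fubini_G.
  apply: (@integral_compact_derivative (fun x => B (x, y) * V (x, y)) _ a) => //.
  - move=> x.
    have := @is_deriveM _ _ (fun x => B (x, y)) (fun x => V (x, y)) x 1 _ _
       (BM x y) (Vp x y).
    rewrite /GRing.scale/=; congr (is_derive _ _ _ _); ring.
  - by apply: cont2; [exact: continuous_fst|exact: continuous_fst|exact: continuous_fst|].
  - by move=> x xa; have [_ -> ->] := supp x y (or_introl xa); rewrite !mul0r addr0.
split.
  rewrite (_ : (fun z => _) = (fun z => (A z * q z)%:E) \- (fun z => (B z * p z)%:E))%E//.
  exact: integrableB.
have -> : (\int[dA]_z (A z * q z - B z * p z)%:E =
  \int[dA]_z ((A z * q z + M z * V z)%:E - (B z * p z + M z * V z)%:E))%E.
  by apply: eq_integral => z _; rewrite -EFinB; congr EFin; ring.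
by rewrite integralB// E1 E2 subee.
Qed.

End plane_integral.

(** * The mean value property against truncated paraboloids *)

Section pointwise_rules.
Context {R : realType}.
Implicit Types (f g : R -> R) (x a b c : R) (p q : R * R -> R).

Lemma is_derive_add f g x a b : is_derive x 1 f a -> is_derive x 1 g b ->
  is_derive x 1 (fun t => f t + g t) (a + b).
Proof. by move=> df dg; exact: (@is_deriveD _ _ _ f g x 1 a b). Qed.

Lemma is_derive_mul f g x a b : is_derive x 1 f a -> is_derive x 1 g b ->
  is_derive x 1 (fun t => f t * g t) (f x * b + g x * a).
Proof. by move=> df dg; exact: (@is_deriveM _ _ f g x 1 a b). Qed.

Lemma is_derive_const c x : is_derive x 1 (fun=> c) 0.
Proof. exact: is_derive_cst. Qed.

Lemma is_derive_value f x a b : is_derive x 1 f a -> a = b -> is_derive x 1 f b.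
Proof. by move=> df <-. Qed.

Lemma continuous_add p q : continuous p -> continuous q ->
  continuous (fun z => p z + q z).
Proof. by move=> cp cq z; apply: cvgD; [exact: cp|exact: cq]. Qed.

Lemma continuous_mul p q : continuous p -> continuous q ->
  continuous (fun z => p z * q z).
Proof. by move=> cp cq z; apply: cvgM; [exact: cp|exact: cq]. Qed.

Lemma continuous_const c : continuous ((fun=> c) : R * R -> R).
Proof. by move=> z; exact: cvg_cst. Qed.

Lemma continuous_pow p n : continuous p -> continuous (fun z => p z ^+ n).
Proof.
move=> cp; elim: n => [|n ih]; first by under eq_fun do rewrite expr0; exact: continuous_const.
by under eq_fun do rewrite exprS; exact: continuous_mul.
Qed.

End pointwise_rules.

Section cap.
Context {R : realType}.
Implicit Types (rho : R) (z : R * R) (u v : R * R -> R).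

(** The positive part; its powers of order at least 2 are continuously
    differentiable. *)
Definition pos_part (t : R) : R := Num.max 0 t.

Lemma pos_part_ge0 t : 0 <= pos_part t.
Proof. by rewrite le_max lexx. Qed.

Lemma pos_part_continuous : continuous pos_part.
Proof.
have -> : pos_part = (fun t => (t + `|t|) / 2).
  apply/funext => t; rewrite /pos_part; case: (leP 0 t) => h.
    by rewrite ger0_norm//; field.
  by rewrite ltr0_norm// subrr mul0r.
move=> t; apply: cvgM; last exact: cvg_cst.
by apply: cvgD => //; exact: norm_continuous.
Qed.

Lemma is_derive_pos_part_pow n (x : R) :
  is_derive x 1 (fun t => pos_part t ^+ n.+2) (n.+2%:R * pos_part x ^+ n.+1).
Proof.
have [x0|x0|->] := ltgtP x 0.
- have -> : n.+2%:R * pos_part x ^+ n.+1 = 0.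
    by rewrite /pos_part max_l ?ltW// expr0n mulr0.
  apply: (near_eq_is_derive _ (is_derive_cst (0 : R) x 1)).
  near=> t; rewrite /pos_part max_l ?expr0n//= ltW//; near: t.
  exact: lt_nbhsl.
- rewrite {2}/pos_part max_r ?ltW//.
  have dX : is_derive x 1 (fun t => t ^+ n.+2) (n.+2%:R * x ^+ n.+1).
    have := @is_deriveX _ _ id n.+2 x 1 1 (is_derive_id _ _).
    by rewrite exprfctE => /is_derive_value; apply; rewrite /GRing.scale/= mulr1.
  apply: (near_eq_is_derive _ dX).
  by near=> t; rewrite /pos_part max_r// ltW//; near: t; exact: lt_nbhsr.
- apply/is_derive1_caratheodory; exists (fun t => pos_part t ^+ n.+1); split.
  + move=> t; rewrite {2}/pos_part maxxx expr0n/= !subr0 exprSr.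
    rewrite /pos_part; case: (leP 0 t) => // t0.
    by rewrite mulr0 expr0n mul0r.
  + apply: (@continuous_comp _ _ _ pos_part (fun t => t ^+ n.+1)).
      exact: pos_part_continuous.
    exact: exprn_continuous.
  + by rewrite /pos_part maxxx expr0n/= mulr0.
Unshelve. all: by end_near. Qed.

(** The truncated paraboloid [(1 - rho |z - z0|^2)_+]: a compactly supported
    bump whose powers have polynomial derivatives inside the support. *)
Definition cap rho (z0 z : R * R) : R :=
  pos_part (1 - rho * ((z.1 - z0.1) ^+ 2 + (z.2 - z0.2) ^+ 2)).

Lemma cap_ge0 rho (z0 : R * R) z : 0 <= cap rho z0 z.
Proof. exact: pos_part_ge0. Qed.

Lemma cap_le1 rho (z0 : R * R) z : 0 <= rho -> cap rho z0 z <= 1.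
Proof.
move=> r0; rewrite /cap /pos_part ge_max ler01/= gerBl.
by rewrite mulr_ge0// addr_ge0// sqr_ge0.
Qed.

Lemma cap_continuous rho (z0 : R * R) : continuous (cap rho z0).
Proof.
have c1 : continuous (fun z : R * R => z.1) by move=> z; exact: cvg_fst.
have c2 : continuous (fun z : R * R => z.2) by move=> z; exact: cvg_snd.
have sq (p : R * R -> R) : continuous p -> continuous (fun z : R * R => p z ^+ 2).
  exact: continuous_pow.
have h : continuous
   (fun z : R * R => 1 - rho * ((z.1 - z0.1) ^+ 2 + (z.2 - z0.2) ^+ 2)).
  have -> : (fun z : R * R => 1 - rho * ((z.1 - z0.1) ^+ 2 + (z.2 - z0.2) ^+ 2))
    = (fun z : R * R => 1 + (- rho) * ((z.1 + - z0.1) ^+ 2 + (z.2 + - z0.2) ^+ 2)).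
    by apply/funext => z; rewrite mulNr.
  apply: continuous_add; first exact: continuous_const.
  apply: continuous_mul; first exact: continuous_const.
  apply: continuous_add; apply: sq; apply: continuous_add => //; exact: continuous_const.
move=> z; apply: (@continuous_comp _ _ _ (fun z : R * R =>
  1 - rho * ((z.1 - z0.1) ^+ 2 + (z.2 - z0.2) ^+ 2)) pos_part); first exact: h.
exact: pos_part_continuous.
Qed.

Lemma cap_measurable rho (z0 : R * R) : measurable_fun [set: R * R] (cap rho z0).
Proof.
by apply: separately_continuous_measurable => t;
  [apply: continuous_fst|apply: continuous_snd]; exact: cap_continuous.
Qed.

Lemma cap_support rho (z0 : R * R) : 0 < rho -> forall x y,
  `|z0.1| + `|z0.2| + 1 + rho^-1 <= `|x| \/
  `|z0.1| + `|z0.2| + 1 + rho^-1 <= `|y| -> cap rho z0 (x, y) = 0.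
Proof.
move=> r0 x y h; rewrite /cap /pos_part max_l// subr_le0 /=.
have key (w w0 s : R) : 0 <= s -> `|w0| + 1 + rho^-1 <= `|w| ->
    1 <= rho * ((w - w0) ^+ 2 + s).
  move=> s0 hw.
  have hd : 1 + rho^-1 <= `|w - w0|.
    have := ler_normD (w - w0) w0; rewrite subrK; lra.
  have ri : 0 < rho^-1 by rewrite invr_gt0.
  have : (1 + rho^-1) ^+ 2 <= (w - w0) ^+ 2.
    by rewrite -[leRHS]real_normK ?num_real// lerXn2r// nnegrE addr_ge0// ltW.
  move=> h2; apply: (@le_trans _ _ (rho * (1 + rho^-1) ^+ 2)).
    rewrite (_ : _ * _ = rho + 2 + rho^-1); last by field; rewrite gt_eqF.
    lra.
  by rewrite ler_pM2l//; lra.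
case: h => h.
- apply: key; first exact: sqr_ge0.
  by apply: le_trans h; have := normr_ge0 z0.2; lra.
- rewrite addrC; apply: key; first exact: sqr_ge0.
  by apply: le_trans h; have := normr_ge0 z0.1; lra.
Qed.

Lemma cap_derive1 rho (z0 : R * R) n (x y : R) : is_derive x 1
  (fun t => cap rho z0 (t, y) ^+ n.+2)
  (n.+2%:R * cap rho z0 (x, y) ^+ n.+1 * (- (2 * rho * (x - z0.1)))).
Proof.
have di : is_derive x 1 (fun t => 1 - rho * ((t - z0.1) ^+ 2 + (y - z0.2) ^+ 2))
    (- (2 * rho * (x - z0.1))).
  have d1 : is_derive x 1 (fun t : R => t - z0.1) 1.
    by apply: is_derive_value (is_derive_add (is_derive_id _ _)
      (is_derive_const _ _)) _; rewrite addr0.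
  have d2 := is_derive_add (is_derive_mul d1 d1) (is_derive_const ((y - z0.2) ^+ 2) x).
  have d3 := is_derive_add (is_derive_const 1 x)
     (is_derive_mul (is_derive_const (- rho) x) d2).
  have -> : (fun t => 1 - rho * ((t - z0.1) ^+ 2 + (y - z0.2) ^+ 2)) =
     (fun t => 1 + - rho * ((t - z0.1) * (t - z0.1) + (y - z0.2) ^+ 2)).
    by apply/funext => t; rewrite mulNr expr2.
  by apply: is_derive_value d3 _; ring.
have := @is_derive1_comp _ (fun t => pos_part t ^+ n.+2)
  (fun t => 1 - rho * ((t - z0.1) ^+ 2 + (y - z0.2) ^+ 2)) x _ _
  (is_derive_pos_part_pow n _) di.
by apply.
Qed.

Lemma cap_sym rho (z0 : R * R) z :
  cap rho (z0.2, z0.1) (z.2, z.1) = cap rho z0 z.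
Proof. by rewrite /cap/= [X in rho * X]addrC. Qed.

Lemma cap_derive2 rho (z0 : R * R) n (x y : R) : is_derive y 1
  (fun t => cap rho z0 (x, t) ^+ n.+2)
  (n.+2%:R * cap rho z0 (x, y) ^+ n.+1 * (- (2 * rho * (y - z0.2)))).
Proof.
have E t : cap rho z0 (x, t) = cap rho (z0.2, z0.1) (t, x).
  exact: esym (cap_sym rho z0 (x, t)).
by under eq_fun do rewrite E; rewrite E; exact: cap_derive1.
Qed.

(** [u + iv] is complex differentiable everywhere, stated through its
    components: both forms [v dx + u dy] and [u dx - v dy] are differentiable and
    closed. *)
Definition cauchy_riemann (u v : R * R -> R) := closed_differentiable v u /\
  closed_differentiable u (fun z => - v z).

Lemma cauchy_riemann_rot u v : cauchy_riemann u v ->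
  cauchy_riemann v (fun z => - u z).
Proof.
move=> [h1 h2]; split => x y; last first.
  have [A [B [C h]]] := h1 x y; exists A, B, C => e e0.
  have [d d0 hd] := h e e0; exists d => // x' y' hx hy.
  by rewrite !opprK; exact: hd.
have [A [B [C h]]] := h2 x y; exists (- A), (- B), (- C) => e e0.
have [d d0 hd] := h e e0; exists d => // x' y' hx hy.
have [k1 k2] := hd x' y' hx hy; split.
  apply: le_trans k1; rewrite -normrN le_eqVlt; apply/orP; left.
  by apply/eqP; congr `|_|; ring.
apply: le_trans k2; rewrite -normrN le_eqVlt; apply/orP; left.
by apply/eqP; congr `|_|; ring.
Qed.

End cap.

Section mean_value.
Context {R : realType}.
Notation dA := (@dA R).
Variables (u v : R * R -> R).
Hypothesis uv : cauchy_riemann u v.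
Implicit Types (rho : R) (z : R * R).

(** With [T] the cap, [X, Y] the coordinates relative to the centre and [m = n+3],
    [weak_closed] is applied to the closed forms [v dx + u dy] and [u dx - v dy]
    paired with the gradients of [X T^m] and [- Y T^m] respectively.  On adding the two identities the terms in [v] cancel, and
    [rho (X^2 + Y^2) = 1 - T] on the support turns what is left into the stated
    relation between two consecutive moments of [u]. *)
Lemma cap_weak rho (z0 : R * R) n : 0 < rho ->
  (\int[dA]_z (((n.+4)%:R * cap rho z0 z ^+ n.+3 -
     (n.+3)%:R * cap rho z0 z ^+ n.+2) * u z)%:E = 0)%E.
Proof.
move=> r0; case: uv => vu uNv.
have [cv cu] := closed_differentiable_continuous vu.
have [_ cNv] := closed_differentiable_continuous uNv.
have [V [Vv Vu]] := closed_potential cv cu vu.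
have [U [Uu Uv]] := closed_potential cu cNv uNv.
pose T := cap rho z0; pose X (z : R * R) := z.1 - z0.1; pose Y (z : R * R) := z.2 - z0.2.
have cT : continuous T by exact: cap_continuous.
have cX : continuous X.
  apply: (@continuous_add _ (fun z : R * R => z.1)); last exact: continuous_const.
  by move=> z; exact: cvg_fst.
have cY : continuous Y.
  apply: (@continuous_add _ (fun z : R * R => z.2)); last exact: continuous_const.
  by move=> z; exact: cvg_snd.
(* A, B and M are the two first derivatives and the mixed derivative of
   X T^(n+3) for the index 1, and of - Y T^(n+3) for the index 2. *)
pose c : R := 2 * n.+3%:R * rho; pose d : R := 2 * n.+2%:R * rho.
pose A1 z := T z ^+ n.+3 + (- c) * (X z * X z) * T z ^+ n.+2.
pose B1 z := (- c) * (X z * Y z) * T z ^+ n.+2.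
pose M1 z := (- c) * Y z * T z ^+ n.+2 + c * d * (X z * X z * Y z) * T z ^+ n.+1.
pose A2 z := c * (X z * Y z) * T z ^+ n.+2.
pose B2 z := (- 1) * T z ^+ n.+3 + c * (Y z * Y z) * T z ^+ n.+2.
pose M2 z := c * X z * T z ^+ n.+2 + (- (c * d)) * (X z * (Y z * Y z)) * T z ^+ n.+1.
pose a := `|z0.1| + `|z0.2| + 1 + rho^-1.
have a0 : 0 < a.
  have : 0 < rho^-1 by rewrite invr_gt0.
  by rewrite /a; have := normr_ge0 z0.1; have := normr_ge0 z0.2; lra.
have T0 x y : a <= `|x| \/ a <= `|y| -> T (x, y) = 0 by exact: cap_support.
have dX1 (x y : R) : is_derive x 1 (fun t => X (t, y)) 1.
  by apply: is_derive_value (is_derive_add (is_derive_id _ _)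
    (is_derive_const _ _)) _; rewrite addr0.
have dY2 (x y : R) : is_derive y 1 (fun t => Y (x, t)) 1.
  by apply: is_derive_value (is_derive_add (is_derive_id _ _)
    (is_derive_const _ _)) _; rewrite addr0.
have cst2 := @is_derive_const R.
have [i1 W1] : dA.-integrable setT (fun z : R * R => (A1 z * u z - B1 z * v z)%:E)
    /\ (\int[dA]_z (A1 z * u z - B1 z * v z)%:E = 0)%E.
  apply: (weak_closed (M := M1) a0 cv cu Vv Vu).
  - rewrite /A1; apply: continuous_add; first exact: continuous_pow.
    apply: continuous_mul; last exact: continuous_pow.
    by apply: continuous_mul; [exact: continuous_const|exact: continuous_mul].
  - apply: continuous_mul; last exact: continuous_pow.
    by apply: continuous_mul; [exact: continuous_const|exact: continuous_mul].
  - apply: continuous_add; apply: continuous_mul; try exact: continuous_pow.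
      by apply: continuous_mul => //; exact: continuous_const.
    apply: continuous_mul; first exact: continuous_const.
    by apply: continuous_mul => //; exact: continuous_mul.
  - move=> x y.
    have h := (is_derive_mul (is_derive_mul (cst2 (- c) x)
      (is_derive_mul (dX1 x y) (cst2 (Y (x, y)) x))) (cap_derive1 rho z0 n x y)).
    apply: (is_derive_value h).
    by rewrite -/T /M1 /d /X /Y /=; ring.
  - move=> x y.
    apply: is_derive_value (is_derive_add (cap_derive2 rho z0 n.+1 x y)
      (is_derive_mul (cst2 (- c * (X (x, y) * X (x, y))) y)
         (cap_derive2 rho z0 n x y))) _.
    by rewrite -/T /M1 /d /c /X /Y /=; ring.
  - by move=> x y /T0 TE; rewrite /A1 /B1 /M1 TE !exprS !mul0r !mulr0 addr0.
have [i2 W2] : dA.-integrable setT (fun z : R * R => (A2 z * - v z - B2 z * u z)%:E)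
    /\ (\int[dA]_z (A2 z * - v z - B2 z * u z)%:E = 0)%E.
  apply: (weak_closed (M := M2) a0 cu cNv Uu Uv).
  - apply: continuous_mul; last exact: continuous_pow.
    by apply: continuous_mul; [exact: continuous_const|exact: continuous_mul].
  - rewrite /B2; apply: continuous_add; apply: continuous_mul; try exact: continuous_pow.
      exact: continuous_const.
    by apply: continuous_mul; [exact: continuous_const|exact: continuous_mul].
  - apply: continuous_add; apply: continuous_mul; try exact: continuous_pow.
      by apply: continuous_mul => //; exact: continuous_const.
    apply: continuous_mul; first exact: continuous_const.
    by apply: continuous_mul => //; exact: continuous_mul.
  - move=> x y.
    apply: is_derive_value (is_derive_add
      (is_derive_mul (cst2 (- 1) x) (cap_derive1 rho z0 n.+1 x y))
      (is_derive_mul (cst2 (c * (Y (x, y) * Y (x, y))) x)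
         (cap_derive1 rho z0 n x y))) _.
    by rewrite -/T /M2 /d /c /X /Y /=; ring.
  - move=> x y.
    apply: is_derive_value (is_derive_mul (is_derive_mul (cst2 c y)
      (is_derive_mul (cst2 (X (x, y)) y) (dY2 x y))) (cap_derive2 rho z0 n x y)) _.
    by rewrite -/T /M2 /d /X /Y /=; ring.
  - by move=> x y /T0 TE; rewrite /A2 /B2 /M2 TE !exprS !mul0r !mulr0 addr0.
have key z : ((n.+4)%:R * T z ^+ n.+3 - (n.+3)%:R * T z ^+ n.+2) * u z =
    2^-1 * ((A1 z * u z - B1 z * v z) + (A2 z * - v z - B2 z * u z)).
  have E : rho * (X z * X z + Y z * Y z) * T z ^+ n.+2 = (1 - T z) * T z ^+ n.+2.
    have [Tz0|Tz0] := eqVneq (T z) 0; first by rewrite Tz0 expr0n !mulr0.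
    congr (_ * _); have : T z = 1 - rho * (X z * X z + Y z * Y z).
      move: Tz0; rewrite /T /cap /pos_part -!expr2 -/(X z) -/(Y z).
      by case: (leP 0 (1 - rho * (X z ^+ 2 + Y z ^+ 2))); rewrite ?eqxx.
    by move=> ->; ring.
  rewrite (_ : A1 z * u z - B1 z * v z + (A2 z * - v z - B2 z * u z) =
    2 * (T z ^+ n.+3 - n.+3%:R * (rho * (X z * X z + Y z * Y z) * T z ^+ n.+2)) * u z).
    by rewrite E -mulrA mulKf ?pnatr_eq0// -[n.+4%:R]natr1 [T z ^+ n.+3]exprS; ring.
  by rewrite /A1 /B1 /A2 /B2 /c; ring.
under eq_integral do rewrite key EFinM.
have i12 : dA.-integrable setT (fun z : R * R =>
    ((A1 z * u z - B1 z * v z) + (A2 z * - v z - B2 z * u z))%:E).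
  rewrite (_ : (fun z => _) = (fun z => (A1 z * u z - B1 z * v z)%:E) \+
     (fun z => (A2 z * - v z - B2 z * u z)%:E))%E//.
  exact: integrableD.
rewrite (integralZl measurableT i12) (_ : (\int[dA]_z _)%E = 0%E) ?mule0//.
under eq_integral do rewrite EFinD.
by rewrite integralD// W1 W2 adde0.
Qed.

End mean_value.

Section mean_value_property.
Context {R : realType}.
Notation dA := (@dA R).
Implicit Types (rho : R) (z : R * R) (u v w : R * R -> R).

Lemma cap_integrable rho (z0 : R * R) k w : 0 < rho -> continuous w ->
  dA.-integrable setT (EFin \o (fun z => cap rho z0 z ^+ k.+1 * w z)).
Proof.
move=> r0 cw; set a := `|z0.1| + `|z0.2| + 1 + rho^-1.
have a0 : 0 <= a by rewrite /a !addr_ge0// invr_ge0 ltW.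
have [K K0 hK] := continuous_bounded_square a cw.
apply: (@compact_support_integrable _ _ a K) => //.
- apply: measurable_funM; first by apply: measurable_funX; exact: cap_measurable.
  by apply: separately_continuous_measurable => t; [exact: continuous_fst|exact: continuous_snd].
- move=> x y hx hy; rewrite normrM -[leRHS]mul1r ler_pM//; last exact: hK.
  by rewrite ger0_norm ?exprn_ge0 ?cap_ge0// exprn_ile1 ?cap_ge0// cap_le1// ltW.
- move=> x y h; rewrite cap_support ?expr0n ?mul0r//.
  by case: h => /ltW; [left|right].
Qed.

Lemma integrable_scale (f : R * R -> R) (c : R) :
  dA.-integrable setT (EFin \o f) ->
  dA.-integrable setT (EFin \o (fun z => c * f z)).
Proof.
rewrite (_ : EFin \o (fun z => c * f z) = (fun z => c%:E * (EFin \o f) z)%E).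
  exact: integrableZl.
by apply/funext => z; rewrite /= EFinM.
Qed.

Lemma integrable_add (f g : R * R -> R) :
  dA.-integrable setT (EFin \o f) -> dA.-integrable setT (EFin \o g) ->
  dA.-integrable setT (EFin \o (fun z => f z + g z)).
Proof.
rewrite (_ : EFin \o (fun z => f z + g z) = ((EFin \o f) \+ (EFin \o g))%E)//.
exact: integrableD.
Qed.

Lemma cauchy_riemann_const (c : R) : cauchy_riemann (fun=> c) (fun=> 0).
Proof.
split => x y; exists 0, 0, 0 => e e0; exists 1 => // x' y' _ _;
  by rewrite !subrr !mul0r addr0 subr0 normr0 mulr_ge0 ?addr_ge0// ltW.
Qed.

Lemma cauchy_riemann_continuous u v : cauchy_riemann u v -> continuous u.
Proof. by move=> [h _]; have [] := closed_differentiable_continuous h. Qed.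

(** Iterating [cap_weak] expresses every moment of [u] by the first one, with a
    constant that does not depend on [u]. *)
Lemma cap_moment rho (z0 : R * R) u v k : 0 < rho -> cauchy_riemann u v ->
  k.+3%:R * \int[dA]_z (cap rho z0 z ^+ k.+2 * u z) =
  3 * \int[dA]_z (cap rho z0 z ^+ 2 * u z).
Proof.
move=> r0 uv; have cu := cauchy_riemann_continuous uv.
elim: k => [//|k <-].
have iT n := cap_integrable z0 n r0 cu.
have := cap_weak uv z0 k r0 => /(congr1 fine)/= h.
apply/eqP; rewrite -subr_eq0 -!RintegralZl//; try exact: iT.
have iZ n (c : R) : dA.-integrable setT
    (EFin \o (fun z => c * (cap rho z0 z ^+ n.+1 * u z))).
  exact: integrable_scale.
rewrite -RintegralB//; try exact: iZ.
apply/eqP; rewrite -[RHS]h; apply: eq_Rintegral => z _; ring.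
Qed.

Lemma bernoulli (h : R) n : -1 <= h -> 1 + n%:R * h <= (1 + h) ^+ n.
Proof.
move=> h1; elim: n => [|n ih]; first by rewrite mul0r addr0 expr0.
rewrite exprS -natr1; apply: (@le_trans _ _ ((1 + h) * (1 + n%:R * h))).
  have : 0 <= n%:R * h ^+ 2 by rewrite mulr_ge0 ?sqr_ge0.
  by nra.
by rewrite ler_wpM2l//; lra.
Qed.

Lemma linear_times_geometric (t e : R) : 0 <= t < 1 -> 0 < e ->
  exists k, k.+3%:R * t ^+ k <= e.
Proof.
move=> /andP[t0 t1] e0.
pose s := (1 + t) / 2; pose h := (1 - t) / 2.
have s1 : `|s| < 1 by rewrite ger0_norm /s; lra.
have h0 : 0 < h by rewrite /h; lra.
have ts : t * (1 + h) <= s by rewrite /s /h; nra.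
have C0 : 0 < 3 + h^-1 by rewrite addr_gt0// invr_gt0.
have /cvgrPdist_lt/(_ (e / (3 + h^-1))) := cvg_expr s1.
rewrite divr_gt0// => /(_ isT)[k _ /(_ k (leqnn k))].
rewrite /= sub0r normrN => sk; exists k.
have : k.+3%:R <= (3 + h^-1) * (1 + h) ^+ k.
  have h1 : -1 <= h by lra.
  have b := bernoulli k h1.
  apply: (@le_trans _ _ ((3 + h^-1) * (1 + k%:R * h))).
    rewrite -addn3 natrD.
    have -> : (3 + h^-1) * (1 + k%:R * h) = 3 + h^-1 + 3 * k%:R * h + k%:R.
      by field; rewrite gt_eqF.
    have : 0 <= h^-1 by rewrite invr_ge0 ltW.
    have : 0 <= 3 * k%:R * h by apply: mulr_ge0 (ltW h0); apply: mulr_ge0.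
    lra.
  by rewrite ler_wpM2l// ltW.
move=> kb; apply: (@le_trans _ _ ((3 + h^-1) * (1 + h) ^+ k * t ^+ k)).
  by rewrite ler_wpM2r ?exprn_ge0.
rewrite -mulrA -exprMn mulrC -ler_pdivlMr//; apply: le_trans (ltW sk).
rewrite normrX ger0_norm ?lerXn2r ?nnegrE ?mulr_ge0//; rewrite ?[(1 + h) * t]mulrC//.
all: by rewrite /s /h; lra.
Qed.

(** Away from its centre the cap is bounded by a constant smaller than 1. *)
Lemma cap_far rho (z0 : R * R) (d : R) z : 0 < rho -> 0 < d ->
  d <= `|z0.1 - z.1| \/ d <= `|z0.2 - z.2| ->
  cap rho z0 z <= Num.max 0 (1 - rho * d ^+ 2).
Proof.
move=> r0 d0 h; rewrite /cap /pos_part ge_max le_max lexx/= le_max.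
apply/orP; right; rewrite lerD2l lerN2 ler_pM2l//.
have sq (a : R) : d <= `|a| -> d ^+ 2 <= a ^+ 2.
  by move=> da; rewrite -[leRHS]real_normK ?num_real// lerXn2r// nnegrE// ltW.
case: h; rewrite distrC => /sq h.
  by rewrite (le_trans h)// lerDl sqr_ge0.
by rewrite (le_trans h)// lerDr sqr_ge0.
Qed.

(** By [cap_moment] the difference [\int T^n u - u(z0) \int T^n], multiplied by
    [n+1], is the same for all [n >= 2].  As [n] grows, [T^n] concentrates at
    [z0], where [u - u(z0)] is small, so this common value is 0. *)
Theorem mean_value rho (z0 : R * R) u v k : 0 < rho -> cauchy_riemann u v ->
  \int[dA]_z (cap rho z0 z ^+ k.+2 * u z) =
  u z0 * \int[dA]_z (cap rho z0 z ^+ k.+2).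
Proof.
move=> r0 uv; have cu := cauchy_riemann_continuous uv.
pose T := cap rho z0; pose c := u z0.
have c1 : continuous ((fun=> 1) : R * R -> R) := @continuous_const _ 1.
pose I n (w : R * R -> R) := \int[dA]_z (T z ^+ n.+2 * w z).
have IE n : \int[dA]_z (T z ^+ n.+2) = I n (fun=> 1).
  by apply: eq_Rintegral => z _; rewrite mulr1.
have mu n : n.+3%:R * I n u = 3 * I 0%N u by exact: cap_moment uv.
have m1 n : n.+3%:R * I n (fun=> 1) = 3 * I 0%N (fun=> 1).
  exact: cap_moment (cauchy_riemann_const 1).
have i_ n w : continuous w -> dA.-integrable setT (EFin \o (fun z => T z ^+ n.+2 * w z)).
  exact: cap_integrable.
have I0 n : 0 <= I n (fun=> 1).
  by apply: Rintegral_ge0 => z _; rewrite mulr1 exprn_ge0// cap_ge0.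
suff D0 : I 0%N u = c * I 0%N (fun=> 1).
  rewrite IE; apply: (@mulfI _ k.+3%:R); first by rewrite pnatr_eq0.
  by rewrite [LHS](mu k) D0 [RHS]mulrCA m1 /c; ring.
pose w z := u z - c.
have cw : continuous w.
  by apply: (@continuous_add _ u); [exact: cu|exact: continuous_const].
have Iw n : I n w = I n u - c * I n (fun=> 1).
  rewrite /I -RintegralZl//; last exact: i_.
  rewrite -RintegralB//; [|exact: i_|]; last first.
    exact: integrable_scale (i_ n _ c1).
  by apply: eq_Rintegral => z _; rewrite /w; ring.
suff : I 0%N w = 0 by rewrite Iw => /eqP; rewrite subr_eq0 => /eqP.
set a := `|z0.1| + `|z0.2| + 1 + rho^-1.
have [K K0 hK] := continuous_bounded_square a cw.
apply/eqP; rewrite -normr_eq0 eq_le normr_ge0 andbT.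
apply/ler_addgt0Pl => e e0; rewrite addr0.
pose J := I 0%N (fun=> 1); have J0 : 0 <= J by exact: I0.
pose e1 := e / (2 * (J + 1)).
have e10 : 0 < e1 by rewrite divr_gt0// mulr_gt0// ltr_wpDl.
have [d d0 hd] : exists2 d : R, 0 < d & forall z, `|z0.1 - z.1| < d ->
    `|z0.2 - z.2| < d -> `|w z| <= e1.
  have /cvgrPdist_le/(_ e1 e10)[[B1 B2] /= [/nbhs_ballP[d1 /= d10 h1]
    /nbhs_ballP[d2 /= d20 h2]] h] := cw z0.
  exists (Num.min d1 d2); first by rewrite lt_min d10.
  move=> z; rewrite !lt_min => /andP[hz1 _] /andP[_ hz2].
  have := h z; rewrite /= {1}/w subrr sub0r normrN; apply.
  by split; [apply: h1|apply: h2].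
(* t bounds the cap outside the d-neighbourhood of z0; the factor n+3 of
   cap_moment does not prevent (n+3) t^n from being small. *)
pose t := Num.max 0 (1 - rho * d ^+ 2).
have t01 : 0 <= t < 1.
  by rewrite /t le_max lexx/= gt_max ltr01/= gtrBl mulr_gt0// exprn_gt0.
have e2 : 0 < 3 * e / (2 * (K * J + 1)).
  by rewrite divr_gt0 ?mulr_gt0// ltr_wpDl// mulr_ge0.
have [n hn] := linear_times_geometric t01 e2.
have bound : `|I n w| <= e1 * I n (fun=> 1) + K * t ^+ n * J.
  apply: (le_trans (le_normr_Rintegral _ _)) => //; first exact: i_.
  have iZ m (b : R) : dA.-integrable setT (EFin \o (fun z => b * (T z ^+ m.+2 * 1))).
    exact: integrable_scale (i_ m _ c1).
  rewrite /J /I -RintegralZl//; last exact: i_.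
  rewrite -[X in _ <= _ + X]RintegralZl//; last exact: i_.
  rewrite -RintegralD//.
  apply: le_Rintegral => //.
  - exact: (integrable_norm (i_ n w cw)).
  - by apply: integrable_add; exact: iZ.
  move=> z _; rewrite !mulr1 normrM ger0_norm ?exprn_ge0 ?cap_ge0//.
  have [Tz0|Tz0] := eqVneq (T z) 0; first by rewrite Tz0 !expr0n/= mul0r !mulr0 addr0.
  have [hz|hz] := pselect (`|z0.1 - z.1| < d /\ `|z0.2 - z.2| < d).
    have [hz1 hz2] := hz; rewrite ler_wpDr//.
      by rewrite !mulr_ge0// ?exprn_ge0 ?cap_ge0//; case/andP: t01.
    by rewrite mulrC ler_wpM2r ?exprn_ge0 ?cap_ge0// hd.
  rewrite ler_wpDl//; first by apply: mulr_ge0; [exact: ltW|rewrite exprn_ge0// cap_ge0].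
  have Tt : T z <= t.
    apply: cap_far => //; move/not_andP : hz => [] /negP; rewrite -leNgt => ?;
    by [left|right].
  have wK : `|w z| <= K.
    case: z Tz0 {hz Tt} => x y Tz0.
    have h0 : ~ (a <= `|x| \/ a <= `|y|).
      by move=> h; move/eqP: Tz0; apply; exact: cap_support.
    by apply: hK; apply: ltW; rewrite ltNge; apply/negP => h; apply: h0; auto.
  have Ttn : T z ^+ n <= t ^+ n.
    by apply: lerXn2r => //; rewrite nnegrE ?cap_ge0//; case/andP: t01.
  rewrite -addn2 exprD (_ : K * t ^+ n * T z ^+ 2 = t ^+ n * T z ^+ 2 * K); last by ring.
  apply: ler_pM => //; first by rewrite mulr_ge0 ?exprn_ge0 ?cap_ge0.
  by rewrite ler_wpM2r ?exprn_ge0 ?cap_ge0.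
have n0 : (0 : R) < n.+3%:R by [].
have E3 : 3 * I 0%N w = n.+3%:R * I n w.
  by rewrite !Iw !mulrBr (mu n) [3 * (c * _)]mulrCA [n.+3%:R * (c * _)]mulrCA (m1 n).
have : 3 * `|I 0%N w| <= e1 * (3 * J) + K * J * (n.+3%:R * t ^+ n).
  have -> : 3 * `|I 0%N w| = `|3 * I 0%N w| by rewrite normrM [`|3|]ger0_norm.
  rewrite E3 normrM [`|n.+3%:R|]ger0_norm//.
  apply: (le_trans (ler_wpM2l (ltW n0) bound)).
  rewrite (_ : 3 * J = n.+3%:R * I n (fun=> 1)); last by rewrite (m1 n).
  by rewrite le_eqVlt; apply/orP; left; apply/eqP; ring.
have h1 : e1 * J <= e / 2.
  rewrite /e1 mulrAC ler_pdivrMr; first by nra.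
  by rewrite mulr_gt0// ltr_wpDl.
have h2 : K * J * (n.+3%:R * t ^+ n) <= 3 * e / 2.
  apply: (le_trans (ler_wpM2l (mulr_ge0 K0 J0) hn)).
  rewrite mulrA ler_pdivrMr; last by rewrite mulr_gt0// ltr_wpDl// mulr_ge0.
  by have := mulr_ge0 K0 J0; nra.
lra.
Qed.

End mean_value_property.

(** * Entire functions and the Cauchy-Riemann equations *)

Section modulus.
Context {R : realType}.
Implicit Types (z w : R[i]) (r : R).

Lemma norm_modC z : `|z| = (modC z)%:C.
Proof. by rewrite normc_def modCE. Qed.

Lemma modC_ge0 z : 0 <= modC z.
Proof. by rewrite modCE sqrtr_ge0. Qed.

Lemma sqr_modC z : modC z ^+ 2 = Re z ^+ 2 + Im z ^+ 2.
Proof. by rewrite modCE sqr_sqrtr// addr_ge0// sqr_ge0. Qed.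

Lemma modCM z w : modC (z * w) = modC z * modC w.
Proof. by apply: complexI; rewrite -norm_modC normrM !norm_modC -rmorphM. Qed.

Lemma modCX z n : modC (z ^+ n) = modC z ^+ n.
Proof. by apply: complexI; rewrite -norm_modC normrX norm_modC -rmorphXn. Qed.

Lemma modC_real r : modC r%:C = `|r|.
Proof. by rewrite modCE/= expr0n/= addr0 sqrtr_sqr. Qed.

Lemma modC_conj z : modC (conjc z) = modC z.
Proof. by rewrite !modCE; case: z => a b /=; rewrite sqrrN. Qed.

Lemma normr_Re_le z : `|Re z| <= modC z.
Proof.
rewrite -(ler_pXn2r (_ : 0 < 2)%N) ?nnegrE ?modC_ge0// sqr_modC.
by rewrite real_normK ?num_real// lerDl sqr_ge0.
Qed.

Lemma normr_Im_le z : `|Im z| <= modC z.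
Proof.
rewrite -(ler_pXn2r (_ : 0 < 2)%N) ?nnegrE ?modC_ge0// sqr_modC.
by rewrite real_normK ?num_real// lerDr sqr_ge0.
Qed.

Lemma modC_le_normD z : modC z <= `|Re z| + `|Im z|.
Proof.
rewrite -(ler_pXn2r (_ : 0 < 2)%N) ?nnegrE ?modC_ge0 ?addr_ge0// sqr_modC.
rewrite -(real_normK (num_real (Re z))) -(real_normK (num_real (Im z))).
by have := normr_ge0 (Re z); have := normr_ge0 (Im z); nra.
Qed.

Lemma modC_eq0 z : (modC z == 0) = (z == 0).
Proof. by rewrite -[z == 0]normr_eq0 norm_modC eq_complex/= eqxx andbT. Qed.

Lemma modC0 : modC (0 : R[i]) = 0.
Proof. by apply/eqP; rewrite modC_eq0. Qed.

Lemma sqr_modC_sub z w : modC (z - w) ^+ 2 <= 2 * modC z ^+ 2 + 2 * modC w ^+ 2.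
Proof. rewrite !sqr_modC; case: z w => [a b] [c d] /=.
by have := sqr_ge0 (a + c); have := sqr_ge0 (b + d); nra. Qed.

End modulus.

Section entire_functions.
Context {R : realType}.
Implicit Types (f g : R[i] -> R[i]) (z : R[i]).

(** Complex differentiability in terms of the real modulus. *)
Lemma derivable_local f z : derivable (f : R[i]^o -> R[i]^o) z 1 ->
  exists L : R[i], forall e : R, 0 < e -> exists2 d : R, 0 < d &
    forall h, modC h < d -> modC (f (z + h) - f z - L * h) <= e * modC h.
Proof.
move=> /cvg_ex[/= L /cvgrPdist_le/= hL]; exists L => e e0.
have ec : (0 : R[i]) < e%:C by rewrite ltcR.
have := hL _ ec => /nbhs_ballP[/= d d0 hd].
have dE : d = (Re d)%:C by rewrite RRe_real// ger0_real// ltW.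
have d0' : 0 < Re d by rewrite -ltcR -dE.
exists (Re d) => // h hlt.
have [->|h0] := eqVneq h 0.
  by rewrite addr0 subrr mulr0 subr0 modC0 mulr0.
have := hd h; rewrite /ball/= sub0r normrN norm_modC dE ltcR => /(_ hlt h0).
rewrite norm_modC lecR => H.
have -> : f (z + h) - f z - L * h = - (h * (L - h^-1 *: (f (h *: 1 + z) - f z))).
  rewrite /GRing.scale/= mulr1 mulrBr mulrA mulfV// mul1r [h + z]addrC.
  by rewrite opprB [L * h]mulrC.
rewrite -[X in modC X]mulN1r modCM modCM.
have -> : modC (- 1 : R[i]) = 1.
  by apply: complexI; rewrite -norm_modC normrN1.
by rewrite mul1r mulrC ler_wpM2r// modC_ge0.
Qed.

Lemma entire_cauchy_riemann f : entire f ->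
  cauchy_riemann (fun p => Re (f (toC p))) (fun p => Im (f (toC p))).
Proof.
move=> ef.
have key x y : exists a b : R, forall e : R, 0 < e -> exists2 d : R, 0 < d &
  forall x' y', `|x' - x| < d -> `|y' - y| < d ->
  `|Re (f (toC (x', y'))) - Re (f (toC (x, y))) - (a * (x' - x) + (- b) * (y' - y))|
     <= e * (`|x' - x| + `|y' - y|) /\
  `|Im (f (toC (x', y'))) - Im (f (toC (x, y))) - (b * (x' - x) + a * (y' - y))|
     <= e * (`|x' - x| + `|y' - y|).
  have [L hL] := derivable_local (ef (toC (x, y))).
  exists (Re L), (Im L) => e e0; have [d d0 hd] := hL e e0.
  exists (d / 2); first by rewrite divr_gt0.
  move=> x' y' hx hy; pose h : R[i] := (x' - x) +i* (y' - y).
  have hE : modC h <= `|x' - x| + `|y' - y| by exact: modC_le_normD h.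
  have := hd h; have -> : toC (x, y) + h = toC (x', y').
    by apply/eqP; rewrite eq_complex/= [x + _]addrC [y + _]addrC !subrK !eqxx.
  have hlt : modC h < d by apply: le_lt_trans hE _; lra.
  move=> /(_ hlt) H.
  have {}H := le_trans H (ler_wpM2l (ltW e0) hE).
  have reE (w w' : R[i]) : Re (w - w') = Re w - Re w' by case: w w' => [? ?] [? ?].
  have imE (w w' : R[i]) : Im (w - w') = Im w - Im w' by case: w w' => [? ?] [? ?].
  have reM : Re (L * h) = Re L * (x' - x) + (- Im L) * (y' - y).
    by rewrite /h; case: (L) => a b /=; rewrite mulNr.
  have imM : Im (L * h) = Im L * (x' - x) + Re L * (y' - y).
    by rewrite /h; case: (L) => a b /=; rewrite addrC.
  split; [rewrite -reM -!reE|rewrite -imM -!imE].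
    exact: le_trans (normr_Re_le _) H.
  exact: le_trans (normr_Im_le _) H.
split => x y; have [a [b h]] := key x y.
  exists b, a, (- b) => e e0; have [d d0 hd] := h e e0; exists d => // x' y' hx hy.
  by have [] := hd x' y' hx hy.
exists a, (- b), (- a) => e e0; have [d d0 hd] := h e e0; exists d => // x' y' hx hy.
have [h1 h2] := hd x' y' hx hy; split => //.
apply: le_trans h2; rewrite -normrN le_eqVlt; apply/orP; left.
by apply/eqP; congr `|_|; ring.
Qed.

Lemma entire_cst (c : R[i]) : entire (fun=> c).
Proof. by move=> z; exact: derivable_cst. Qed.

Lemma entireB f g : entire f -> entire g -> entire (fun z => f z - g z).
Proof. by move=> ef eg z; apply: derivableB; [exact: ef|exact: eg]. Qed.

Lemma entireX n : entire (fun z : R[i] => z ^+ n).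
Proof.
by move=> z; exact: exprn_derivable.
Qed.

End entire_functions.

(** * The Gaussian measure as a density *)

Section density.
Import HBNNSimple.
Context d (T : measurableType d) {R : realType}.
Variables (lam nu : {measure set T -> \bar R}) (g : T -> R).
Hypotheses (mg : measurable_fun setT g) (g0 : forall x, 0 <= g x).
Hypothesis nuE : forall A, measurable A -> nu A = (\int[lam]_(x in A) (g x)%:E)%E.

(** Integration against a measure with a density, for nonnegative functions;
    the density relation is assumed on sets only. *)
Lemma integral_density (f : T -> \bar R) : (forall p, 0 <= f p)%E ->
  measurable_fun setT f -> (\int[nu]_p f p = \int[lam]_p (f p * (g p)%:E))%E.
Proof.
move=> f0 mf.
pose h := nnsfun_approx measurableT mf.
have mh n : measurable_fun [set: T] (EFin \o h n) by exact/measurable_EFinP.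
have ndh (p : T) a b : (a <= b)%N -> h a p <= h b p.
  by move=> ab; exact/lefP/nd_nnsfun_approx.
have -> : (\int[nu]_x f x = lim ((\int[nu]_x (EFin \o h n) x) @[n --> \oo]))%E.
  have fE x : f x = lim ((EFin \o h n) x @[n --> \oo]).
    by apply/esym/cvg_lim => //; exact: cvg_nnsfun_approx.
  under eq_integral do rewrite fE.
  apply: monotone_convergence => //.
  - by move=> n x _ //=; rewrite lee_fin.
  - by move=> x _ a b ab; rewrite lee_fin; exact/lefP/nd_nnsfun_approx.
have -> : (\int[lam]_x (f x * (g x)%:E) =
    lim ((\int[lam]_x ((EFin \o h n) x * (g x)%:E)) @[n --> \oo]))%E.
  have fg x : (f x * (g x)%:E)%E = lim (((EFin \o h n) x * (g x)%:E)%E @[n --> \oo]).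
    by apply/esym/cvg_lim => //; apply: cvgeZr => //; exact: cvg_nnsfun_approx.
  under eq_integral do rewrite fg.
  apply: monotone_convergence => //.
  - move=> n; apply/emeasurable_funM; last exact/measurable_EFinP.
    exact: mh.
  - by move=> n x _ /=; rewrite mule_ge0 ?lee_fin ?g0.
  - move=> x _ a b ab/=; apply: lee_wpmul2r; rewrite lee_fin//.
    exact: ndh.
suff suf n : (\int[lam]_x ((EFin \o h n) x * (g x)%:E) =
    \int[nu]_x (EFin \o h n) x)%E.
  by under [in RHS]eq_fun do rewrite suf.
transitivity (\int[nu]_x
   (\sum_(y \in range (h n)) (y * \1_(h n @^-1` [set y]) x)%:E))%E; last first.
  by apply: eq_integral => t tE; rewrite /= fimfunE -fsumEFin.
have hE (p : T) : (h n p)%:E =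
    (\sum_(y \in range (h n)) (y * \1_(h n @^-1` [set y]) p)%:E)%E.
  by rewrite fimfunE -fsumEFin.
have indich m r : measurable_fun setT (fun x => (r * \1_(h m @^-1` [set r]) x)%:E).
  by apply: (measurable_comp measurableT) => //; exact: measurable_funM.
rewrite ge0_integral_fsum//; last by move=> m y Ey; exact: nnfun_muleindic_ge0.
transitivity (\int[lam]_x (\sum_(y \in range (h n))
    (y * \1_(h n @^-1` [set y]) x)%:E * (g x)%:E))%E.
  apply: eq_integral => x _.
  rewrite -ge0_mule_fsuml => [|y]; last exact: nnfun_muleindic_ge0.
  by rewrite -hE.
rewrite ge0_integral_fsum//; last 2 first.
  - by move=> y; apply: emeasurable_funM => //; exact/measurable_EFinP.
  - by move=> m y Ey; apply: mule_ge0; [exact: nnfun_muleindic_ge0|rewrite lee_fin].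
apply: eq_fsbigr => r rhn.
under [RHS]eq_integral do rewrite EFinM.
rewrite integralZl_indic_nnsfun => //.
under eq_integral do rewrite EFinM -muleA.
rewrite ge0_integralZl//.
- under eq_integral do rewrite muleC.
  rewrite (eq_integral ((EFin \o g) \_ (h n @^-1` [set r]))); last first.
    by move=> x xE; rewrite epatch_indic.
  by rewrite -integral_mkcondr setTI -nuE// integral_indic// setIT.
- apply: emeasurable_funM; last exact/measurable_EFinP.
  by apply/measurable_EFinP; exact: measurable_indic.
- by move=> t Et; rewrite mule_ge0 ?lee_fin ?g0.
- by move: rhn; rewrite inE => -[t _ <-]; rewrite lee_fin.
Qed.

End density.

Section gaussian_measure.
Context {R : realType}.
Notation dA := (@dA R).
Notation mu := (@gaussian R).
Notation density := (fun p : R * R => gauss_density (toC p)).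

Lemma density_ge0 p : (0 <= (density p)%:E)%E.
Proof. by rewrite lee_fin gauss_density_ge0. Qed.

Lemma density_measurable : measurable_fun [set: R * R] (fun p => (density p)%:E).
Proof. by apply/measurable_EFinP; exact: measurable_gauss_density. Qed.

(** The measures [mu] and [dA] are declared on two presentations of the product
    sigma-algebra of the plane; the identity map is used to pass from one to the
    other. *)
Lemma gaussian_integral (f : R * R -> \bar R) : (forall p, 0 <= f p)%E ->
  measurable_fun setT f ->
  (\int[mu]_p f p = \int[dA]_p (f p * (density p)%:E))%E.
Proof.
move=> f0 mf.
pose phi : _ -> (R * R)%type := fun p : R * R => p.
have mphi : measurable_fun setT phi by move=> _ Y mY; rewrite setTI.
have md (A : set (R * R)) : measurable A -> (mu A =
    \int[pushforward dA phi]_(p in A) (density p)%:E)%E.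
  move=> mA; rewrite ge0_integral_pushforward//.
  - apply: measurable_funTS; exact: density_measurable.
  - by move=> p _; exact: density_ge0.
rewrite (@integral_density _ _ R (pushforward dA phi) mu density)//.
- rewrite ge0_integral_pushforward//.
  + by apply: emeasurable_funM => //; exact: density_measurable.
  + by move=> p _; rewrite mule_ge0// density_ge0.
- exact: measurable_gauss_density.
- by move=> p; exact: gauss_density_ge0.
Qed.

Lemma density_prod (x y : R) :
  density (x, y) = pi^-1 * (gauss_fun x * gauss_fun y).
Proof.
by rewrite /gauss_density sqr_modC /gauss_fun -expRD opprD.
Qed.

Lemma gaussian_setT : mu setT = 1%E.
Proof.
rewrite /gaussian fubini_tonelli1; [|exact: density_measurable|exact: density_ge0].
rewrite /fubini_F.
have mg : measurable_fun setT (fun x : R => (gauss_fun x)%:E).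
  by apply/measurable_EFinP; exact: measurable_gauss_fun.
have g0 (x : R) : (0 <= (gauss_fun x)%:E)%E by rewrite lee_fin gauss_fun_ge0.
have pi0 : (0 : R) < pi := pi_gt0 R.
under eq_integral.
  move=> x _.
  under eq_integral do rewrite density_prod mulrA EFinM.
  rewrite ge0_integralZl//; last first.
    by rewrite lee_fin mulr_ge0 ?gauss_fun_ge0// invr_ge0 ltW.
  rewrite integralT_gauss -EFinM mulrAC EFinM.
  over.
rewrite ge0_integralZl//; last by rewrite lee_fin mulr_ge0 ?sqrtr_ge0// invr_ge0 ltW.
rewrite integralT_gauss -EFinM -mulrA -expr2 sqr_sqrtr ?ltW//.
by rewrite mulVf// gt_eqF.
Qed.

End gaussian_measure.

(** * Norm estimates in the Bargmann space *)

Section cauchy_schwarz.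
Context d (T : measurableType d) {R : realType}.
Variable nu : {measure set T -> \bar R}.

(** Stated with explicit bounds [A] and [B] for the two norms, which may
    vanish; the proof integrates the weighted inequality
    [a b <= l a^2 + b^2/(4l)], the bounds being first enlarged to make them
    positive. *)
Lemma cauchy_schwarz (a b : T -> R) (A B : R) :
  measurable_fun setT a -> measurable_fun setT b ->
  (forall x, 0 <= a x) -> (forall x, 0 <= b x) -> 0 <= A -> 0 <= B ->
  (\int[nu]_x (a x ^+ 2)%:E <= (A ^+ 2)%:E)%E ->
  (\int[nu]_x (b x ^+ 2)%:E <= (B ^+ 2)%:E)%E ->
  (\int[nu]_x (a x * b x)%:E <= (A * B)%:E)%E.
Proof.
move=> ma mb a0 b0 A0 B0 hA hB.
have am e : 0 < e -> (\int[nu]_x (a x * b x)%:E <= ((A + e) * (B + e))%:E)%E.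
  move=> e0; have Ae : 0 < A + e by rewrite ltr_wpDl.
  have Be : 0 < B + e by rewrite ltr_wpDl.
  (* The weights for which both terms equal half of the product of the bounds. *)
  pose l := (B + e) / (A + e) / 2; pose m := (A + e) / (B + e) / 2.
  have l0 : 0 < l by rewrite /l !divr_gt0.
  have m0 : 0 < m by rewrite /m !divr_gt0.
  apply: (@le_trans _ _ (\int[nu]_x (l%:E * (a x ^+ 2)%:E + m%:E * (b x ^+ 2)%:E))%E).
    apply: ge0_le_integral => //.
    - by move=> x _; rewrite lee_fin mulr_ge0.
    - by apply/measurable_EFinP; exact: measurable_funM.
    - by apply: emeasurable_funD; apply: emeasurable_funM => //;
        apply/measurable_EFinP; exact: measurable_funX.
    - move=> x _; rewrite -!EFinM -EFinD lee_fin.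
      have lm : 4 * l * m = 1 by rewrite /l /m; field; rewrite !gt_eqF.
      have : 0 <= (2 * l * a x - b x) ^+ 2 by exact: sqr_ge0.
      move=> h; rewrite -subr_ge0 -(pmulr_rge0 _ (_ : 0 < 4 * l)); last by rewrite mulr_gt0.
      have id4 (s t p q : R) : 4 * s * (s * p ^+ 2 + t * q ^+ 2 - p * q) =
          (2 * s * p - q) ^+ 2 + (4 * s * t - 1) * q ^+ 2 by ring.
      by rewrite id4 lm subrr mul0r addr0.
  rewrite ge0_integralD//; first last.
  - by apply: emeasurable_funM => //; apply/measurable_EFinP; exact: measurable_funX.
  - by move=> x _; rewrite -EFinM lee_fin mulr_ge0 ?sqr_ge0// ltW.
  - by apply: emeasurable_funM => //; apply/measurable_EFinP; exact: measurable_funX.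
  - by move=> x _; rewrite -EFinM lee_fin mulr_ge0 ?sqr_ge0// ltW.
  rewrite !ge0_integralZl//; first last.
  - by rewrite lee_fin ltW.
  - by move=> x _; rewrite lee_fin sqr_ge0.
  - by apply/measurable_EFinP; exact: measurable_funX.
  - by rewrite lee_fin ltW.
  - by move=> x _; rewrite lee_fin sqr_ge0.
  - by apply/measurable_EFinP; exact: measurable_funX.
  apply: (@le_trans _ _ (l%:E * ((A + e) ^+ 2)%:E + m%:E * ((B + e) ^+ 2)%:E)%E).
    apply: leeD; (apply: lee_wpmul2l; first by rewrite lee_fin ltW).
    - by apply: (le_trans hA); rewrite lee_fin lerXn2r ?nnegrE// ?lerDl ltW.
    - by apply: (le_trans hB); rewrite lee_fin lerXn2r ?nnegrE// ?lerDl ltW.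
  rewrite -!EFinM -EFinD lee_fin le_eqVlt; apply/orP; left; apply/eqP.
  by rewrite /l /m; field; rewrite !gt_eqF.
have fin : (\int[nu]_x (a x * b x)%:E)%E \is a fin_num.
  rewrite ge0_fin_numE; last by apply: integral_ge0 => x _; rewrite lee_fin mulr_ge0.
  by apply: le_lt_trans (am 1 ltr01) _; rewrite ltry.
move: am; rewrite -(fineK fin) => am; rewrite lee_fin.
apply/ler_addgt0Pl => e e0.
pose t := Num.min 1 (e / (A + B + 1)).
have AB1 : 0 < A + B + 1 by rewrite ltr_wpDl// addr_ge0.
have t0 : 0 < t by rewrite lt_min ltr01 divr_gt0.
have t1 : t <= 1 by rewrite ge_min lexx.
have te : t * (A + B + 1) <= e by rewrite -ler_pdivlMr// ge_min lexx orbT.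
have := am t t0; rewrite lee_fin => /le_trans; apply.
by nra.
Qed.

End cauchy_schwarz.

Section bargmann_norm.
Context {R : realType}.
Notation dA := (@dA R).
Notation mu := (@gaussian R).
Notation density := (fun p : R * R => gauss_density (toC p)).
Implicit Types (f g : R[i] -> R[i]).

Lemma measurable_modC f : Defs.measurableC f ->
  measurable_fun setT (fun p : R * R => modC (f (toC p))).
Proof.
move=> [mr mi]; under eq_fun do rewrite modCE.
apply: (@measurableT_comp _ _ _ _ _ _ (@Num.sqrt R)).
  by apply: continuous_measurable_fun; exact: sqrt_continuous.
by apply: measurable_funD; exact: measurable_funX.
Qed.

Lemma measurable_modC_toC : measurable_fun setT (fun p : R * R => modC (toC p)).
Proof.
by apply: (@measurable_modC id); split;
  [exact: measurable_fst|exact: measurable_snd].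
Qed.

Lemma sqr_normL2 f : L2 f ->
  ((normL2 f ^+ 2)%:E = \int[mu]_p (modC (f (toC p)) ^+ 2)%:E)%E.
Proof.
move=> [mf hf]; rewrite /normL2 sqr_sqrtr; last first.
  by apply: Rintegral_ge0 => p _; exact: sqr_ge0.
rewrite /Rintegral fineK// ge0_fin_numE//.
by apply: integral_ge0 => p _; rewrite lee_fin sqr_ge0.
Qed.

Lemma normL2_ge0 f : 0 <= normL2 f.
Proof. exact: sqrtr_ge0. Qed.

Lemma normL2_le f (C : R) : L2 f -> 0 <= C ->
  (\int[mu]_p (modC (f (toC p)) ^+ 2)%:E <= (C ^+ 2)%:E)%E -> normL2 f <= C.
Proof.
move=> Lf C0; rewrite -sqr_normL2// lee_fin => h.
by rewrite -(ler_pXn2r (_ : 0 < 2)%N) ?nnegrE ?normL2_ge0.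
Qed.

Lemma integral_modC_le f : L2 f ->
  (\int[mu]_p (modC (f (toC p)))%:E <= (normL2 f)%:E)%E.
Proof.
move=> Lf.
have : (\int[mu]_p (modC (f (toC p)) * 1)%:E <= (normL2 f * 1)%:E)%E.
  apply: cauchy_schwarz => //.
  - by apply: measurable_modC; case: Lf.
  - by move=> p; exact: modC_ge0.
  - exact: normL2_ge0.
  - by rewrite sqr_normL2.
  - by rewrite expr1n integral_cst//= gaussian_setT mule1.
by rewrite mulr1; under eq_integral do rewrite mulr1.
Qed.

(** The cap is at least [1/2] on a square of side [2h]. *)
Lemma cap_mass_ge (rho : R) (z0 : R * R) : 0 < rho ->
  (2 * (rho + 1))^-1 ^+ 2 <= \int[dA]_z (cap rho z0 z ^+ 2).
Proof.
move=> r0; set h := (2 * (rho + 1))^-1.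
have r1 : 0 < 2 * (rho + 1) by lra.
have h0 : 0 < h by rewrite invr_gt0.
have hr : rho * (2 * h ^+ 2) <= 1 / 2.
  rewrite /h exprVn -subr_ge0.
  rewrite (_ : _ - _ = (rho ^+ 2 + rho + 1) / (2 * (rho + 1) ^+ 2)); last first.
    by field; rewrite gt_eqF//; lra.
  by rewrite divr_ge0// ?mulr_ge0 ?sqr_ge0// !addr_ge0 ?sqr_ge0// ltW.
pose S : set (R * R) := `[z0.1 - h, z0.1 + h] `*` `[z0.2 - h, z0.2 + h].
have mS : measurable S by apply: measurableX.
have SE : dA S = (4 * h ^+ 2)%:E.
  rewrite /dA product_measure1E//= !lebesgue_measure_itv/= !lte_fin.
  rewrite !ltrD2l gt0_cp// -!EFinD -EFinM; congr EFin; ring.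
have i2 : dA.-integrable setT (EFin \o (fun z => cap rho z0 z ^+ 2)).
  have := cap_integrable z0 1 r0 (@continuous_const R 1).
  by apply: eq_integrable => // z _ /=; rewrite mulr1.
rewrite -lee_fin /Rintegral fineK; last exact: integrable_fin_num.
apply: (@le_trans _ _ (\int[dA]_(z in S) (4^-1)%:E)%E).
  have -> : (\int[dA]_(z in S) (4^-1)%:E = (4^-1)%:E * dA S)%E by exact: integral_cst.
  rewrite SE -EFinM lee_fin.
  by rewrite mulrA mulVf ?pnatr_eq0// mul1r.
apply: (@le_trans _ _ (\int[dA]_(z in S) (cap rho z0 z ^+ 2)%:E)%E).
  apply: ge0_le_integral => //.
  - apply/measurable_EFinP; apply: measurable_funTS; apply: measurable_funX.
    exact: cap_measurable.
  - move=> [x y] [/=]; rewrite !in_itv/= => hx hy; rewrite lee_fin.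
    have hb : 1 / 2 <= cap rho z0 (x, y).
      rewrite /cap/= /pos_part le_max; apply/orP; right.
      have hx2 : (x - z0.1) ^+ 2 <= h ^+ 2 by nra.
      have hy2 : (y - z0.2) ^+ 2 <= h ^+ 2 by nra.
      have : rho * ((x - z0.1) ^+ 2 + (y - z0.2) ^+ 2) <= rho * (2 * h ^+ 2).
        by rewrite ler_pM2l//; lra.
      by lra.
    by nra.
apply: ge0_subset_integral => //.
- apply/measurable_EFinP; apply: measurable_funX; exact: cap_measurable.
- by move=> z _; rewrite lee_fin sqr_ge0.
Qed.

Lemma cap_le_density (x0 y0 : R) p : `|x0| <= 1 -> `|y0| <= 1 ->
  cap 1 (x0, y0) p ^+ 2 <= pi * expR 8 * density p.
Proof.
move=> hx hy; case: p => x y.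
have pi0 : (0 : R) < pi := pi_gt0 R.
have [->|T0] := eqVneq (cap 1 (x0, y0) (x, y)) 0.
  by rewrite expr0n/= mulr_ge0 ?gauss_density_ge0// mulr_ge0 ?expR_ge0// ltW.
apply: (@le_trans _ _ 1).
  by rewrite exprn_ile1 ?cap_ge0// cap_le1.
rewrite /gauss_density sqr_modC/= mulrACA mulfV ?gt_eqF// mul1r -expRD.
rewrite -[leLHS]expR0 ler_expR.
have s1 : (x - x0) ^+ 2 + (y - y0) ^+ 2 < 1.
  move: T0; rewrite /cap /pos_part/= mul1r.
  by move=> T0; rewrite ltNge; apply/negP => h; move: T0; rewrite max_l ?eqxx//; lra.
have hx' : (x - x0) ^+ 2 < 1 by have := sqr_ge0 (y - y0); lra.
have hy' : (y - y0) ^+ 2 < 1 by have := sqr_ge0 (x - x0); lra.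
have bd (t t0 : R) : `|t0| <= 1 -> (t - t0) ^+ 2 < 1 -> t ^+ 2 <= 4.
  rewrite ler_norml => /andP[? ?] ?; have : t0 ^+ 2 <= 1 by nra.
  by have := sqr_ge0 (t - 2 * t0); nra.
by have := bd _ _ hx hx'; have := bd _ _ hy hy'; lra.
Qed.

Lemma pointwise_bound (u v : R * R -> R) (x0 y0 N : R) :
  `|x0| <= 1 -> `|y0| <= 1 -> cauchy_riemann u v ->
  measurable_fun setT u -> (\int[mu]_p `|u p|%:E <= N%:E)%E ->
  `|u (x0, y0)| <= 16 * (pi * expR 8) * N.
Proof.
move=> hx hy uv mu_ hN; pose z0 := (x0, y0).
have cu := cauchy_riemann_continuous uv.
have pi0 : (0 : R) < pi := pi_gt0 R.
have K0 : (0 : R) <= pi * expR 8 by rewrite mulr_ge0 ?expR_ge0// ltW.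
pose J := \int[dA]_z (cap 1 z0 z ^+ 2).
have J16 : 1 / 16 <= J.
  apply: le_trans (cap_mass_ge z0 ltr01).
  by rewrite (_ : 2 * (1 + 1) = 4) ?exprVn; [lra|ring].
have E := mean_value z0 0 ltr01 uv.
have iT := cap_integrable z0 1 ltr01 cu.
have b1 : (`|u z0| * J)%:E%R = (`|\int[dA]_z (cap 1 z0 z ^+ 2 * u z)%:E|)%E.
  rewrite -EFin_normr_Rintegral// E normrM; congr (_ * _)%:E.
  by apply/esym/ger0_norm; apply: le_trans J16; lra.
have b2 : ((`|u z0| * J)%:E <= (pi * expR 8 * N)%:E)%E.
  rewrite b1; apply: (le_trans (le_abse_integral _ _ _)) => //.
    by case/integrableP : iT.
  apply: (@le_trans _ _ (\int[dA]_p ((pi * expR 8)%:E * (`|u p|%:E * (density p)%:E)))%E).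
    apply: ge0_le_integral => //.
    - by apply: measurableT_comp => //; case/integrableP : iT.
    - apply: emeasurable_funM => //; apply: emeasurable_funM; last exact: density_measurable.
      by apply/measurable_EFinP; exact: measurableT_comp.
    - move=> p _; rewrite -!EFinM lee_fin normrM [X in X * _]ger0_norm ?sqr_ge0//.
      rewrite mulrCA mulrC ler_wpM2l//; exact: cap_le_density.
  rewrite ge0_integralZl//; first last.
  - by move=> p _; rewrite mule_ge0 ?density_ge0// lee_fin.
  - apply: emeasurable_funM; last exact: density_measurable.
    by apply/measurable_EFinP; exact: measurableT_comp.
  rewrite -(@gaussian_integral R (fun p => `|u p|%:E)).
  - by rewrite [leRHS]EFinM; apply: lee_wpmul2l => //; rewrite lee_fin.
  - by move=> p; rewrite lee_fin.
  - by apply/measurable_EFinP; exact: measurableT_comp.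
rewrite lee_fin in b2; have := normr_ge0 (u z0).
by rewrite -/z0; nra.
Qed.

(** Evaluation at a point of the square [[-1,1]^2] is bounded on the Bargmann
    space, uniformly: by [mean_value] the value at the point is an average against
    a squared cap, and on the support of that cap the Gaussian density is bounded
    below. *)
Lemma entire_pointwise_bound : exists2 C : R, 0 <= C &
  forall f x y, F2 f -> `|x| <= 1 -> `|y| <= 1 -> modC (f (toC (x, y))) <= C * normL2 f.
Proof.
have pi0 : (0 : R) < pi := pi_gt0 R.
exists (32 * (pi * expR 8)).
  by rewrite !mulr_ge0 ?expR_ge0// ltW.
move=> f x y [ef Lf] hx hy.
have [mr mi] : Defs.measurableC f by case: Lf.
have uv := entire_cauchy_riemann ef.
have vu := cauchy_riemann_rot uv.
have part (w : R[i] -> R) : (forall z, `|w z| <= modC z) ->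
    measurable_fun setT (fun p : R * R => w (f (toC p))) ->
    (\int[mu]_p `|w (f (toC p))|%:E <= (normL2 f)%:E)%E.
  move=> hw mw; apply: le_trans (integral_modC_le Lf).
  apply: ge0_le_integral => //.
  - by apply/measurable_EFinP; exact: measurableT_comp.
  - by apply/measurable_EFinP; exact: measurable_modC.
  - by move=> p _; rewrite lee_fin.
apply: (le_trans (modC_le_normD _)).
have h1 := pointwise_bound hx hy uv mr (part _ (@normr_Re_le R) mr).
have h2 := pointwise_bound hx hy vu mi (part _ (@normr_Im_le R) mi).
rewrite /= in h1 h2; lra.
Qed.

End bargmann_norm.

(** * The Gaussian mean value property *)

Section gaussian_mean_value.
Context {R : realType}.
Notation dA := (@dA R).
Notation mu := (@gaussian R).
Notation density := (fun p : R * R => gauss_density (toC p)).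
Notation origin := ((0, 0) : R * R).

Lemma EFin_Rintegral (f : R * R -> R) : dA.-integrable setT (EFin \o f) ->
  ((\int[dA]_p f p)%R%:E = \int[dA]_p (f p)%:E)%E.
Proof. by move=> fi; rewrite /Rintegral fineK//; exact: integrable_fin_num. Qed.

Lemma gaussian_integral_real (u : R * R -> R) : measurable_fun setT u ->
  (\int[mu]_p (u p)%:E = \int[dA]_p (u p * density p)%:E)%E.
Proof.
move=> mu_; rewrite integralE [RHS]integralE; congr (_ - _)%E.
- rewrite gaussian_integral//; last first.
    by apply: measurable_funepos; exact/measurable_EFinP.
  apply: eq_integral => p _; rewrite !funeposE -!EFin_max -EFinM.
  by rewrite maxr_pMl ?gauss_density_ge0// mul0r.
- rewrite gaussian_integral//; last first.
    by apply: measurable_funeneg; exact/measurable_EFinP.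
  apply: eq_integral => p _; rewrite !funenegE -!EFinN -!EFin_max -EFinM.
  by rewrite maxr_pMl ?gauss_density_ge0// mul0r mulNr.
Qed.

Lemma gaussian_integrable (u : R * R -> R) : mu.-integrable setT (EFin \o u) ->
  dA.-integrable setT (EFin \o (fun p => u p * density p)).
Proof.
move=> /integrableP[mu_ hu].
have mu' : measurable_fun setT u by exact/measurable_EFinP.
apply/integrableP; split.
  apply/measurable_EFinP; apply: measurable_funM => //.
  exact: measurable_gauss_density.
move: hu; rewrite gaussian_integral//; last exact: measurableT_comp.
apply: le_lt_trans; rewrite le_eqVlt; apply/orP; left; apply/eqP.
apply: eq_integral => p _ /=; rewrite -EFinM normrM.
by rewrite [`|gauss_density _|]ger0_norm ?gauss_density_ge0.
Qed.

(** The square of the modulus, on pairs of reals. *)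
Definition sqnorm (p : R * R) : R := p.1 ^+ 2 + p.2 ^+ 2.

Lemma sqnorm_ge0 p : 0 <= sqnorm p.
Proof. by rewrite addr_ge0// sqr_ge0. Qed.

Lemma sqnormE p : sqnorm p = modC (toC p) ^+ 2.
Proof. by rewrite sqr_modC. Qed.

Lemma cap_origin (rho : R) p : cap rho origin p = Num.max 0 (1 - rho * sqnorm p).
Proof. by rewrite /cap /= !subr0. Qed.

(** [(1 - |p|^2/m)_+^m] with [m = n+2], which converges to [exp (- |p|^2)] from below. *)
Definition gauss_approx (n : nat) p : R := cap (n.+2%:R^-1) origin p ^+ n.+2.

Lemma gauss_approx_le n p : gauss_approx n p <= expR (- sqnorm p).
Proof.
rewrite /gauss_approx cap_origin.
have n0 : (0 : R) < n.+2%:R by [].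
have -> : - sqnorm p = n.+2%:R * (- (n.+2%:R^-1 * sqnorm p)).
  by rewrite mulrN mulrA mulfV ?gt_eqF// mul1r.
rewrite expRM_natl lerXn2r ?nnegrE ?expR_ge0 ?le_max ?lexx//.
by rewrite ge_max expR_ge0/= expR_ge1Dx.
Qed.

Lemma gauss_approx_cvg p : gauss_approx n p @[n --> \oo] --> expR (- sqnorm p).
Proof.
set s := sqnorm p; have s0 : 0 <= s := sqnorm_ge0 p.
(* With m = n+2 and y = s/m, one has 1 - y >= e^(-y) (1 - y^2); the m-th power
   of the last factor is bounded below by the Bernoulli inequality. *)
have low : \forall n \near \oo,
    expR (- s) * (1 - s ^+ 2 / n.+1%:R) <= gauss_approx n p.
  exists (Num.bound s) => // n /= sn.
  have n0 : (0 : R) < n.+2%:R by [].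
  have sn' : s <= n.+2%:R.
    rewrite (le_trans (ltW (archi_boundP s0)))// ler_nat.
    by rewrite (leq_trans sn)// ltnW.
  pose y := n.+2%:R^-1 * s.
  have y0 : 0 <= y by rewrite mulr_ge0// invr_ge0 ltW.
  have y1 : y <= 1 by rewrite /y mulrC ler_pdivrMr// mul1r.
  have E1 : expR (- y) * (1 - y ^+ 2) <= 1 - y.
    rewrite expRN ler_pdivrMl ?expR_gt0//.
    have := expR_ge1Dx y; nra.
  have E2 : 1 - n.+2%:R * y ^+ 2 <= (1 - y ^+ 2) ^+ n.+2.
    have := @bernoulli R (- y ^+ 2) n.+2; rewrite mulrN; apply.
    by rewrite lerN2; nra.
  rewrite /gauss_approx cap_origin -/s -/y max_r ?subr_ge0//.
  apply: (@le_trans _ _ ((expR (- y) * (1 - y ^+ 2)) ^+ n.+2)); last first.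
    rewrite lerXn2r ?nnegrE ?subr_ge0//.
    by rewrite mulr_ge0 ?expR_ge0// subr_ge0; nra.
  rewrite exprMn -expRM_natl mulrN.
  have -> : n.+2%:R * y = s by rewrite /y mulrA mulfV ?gt_eqF// mul1r.
  rewrite ler_wpM2l ?expR_ge0//; apply: le_trans E2.
  rewrite lerD2l lerN2.
  have -> : n.+2%:R * y ^+ 2 = s ^+ 2 / n.+2%:R.
    by rewrite /y; field; rewrite gt_eqF.
  by rewrite ler_wpM2l ?sqr_ge0// lef_pV2 ?posrE// ler_nat.
apply: (@squeeze_cvgr _ _ _ _ (fun n => expR (- s) * (1 - s ^+ 2 / n.+1%:R))
  (fun=> expR (- s))).
- near=> n; rewrite gauss_approx_le andbT; near: n; exact: low.
- rewrite -[X in _ --> X]mulr1; apply: cvgMr.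
  rewrite -[X in _ --> X]subr0; apply: cvgB; first exact: cvg_cst.
  rewrite -(mulr0 (s ^+ 2)); apply: cvgMr.
  exact: cvg_harmonic.
- exact: cvg_cst.
Unshelve. all: by end_near. Qed.

Lemma densityE p : density p = pi^-1 * expR (- sqnorm p).
Proof. by rewrite /gauss_density sqnormE. Qed.

Lemma gauss_approx_integral_cvg (u : R * R -> R) :
  measurable_fun setT u -> mu.-integrable setT (EFin \o u) ->
  (\int[dA]_p (pi^-1 * (gauss_approx n p * u p))%:E)%E @[n --> \oo] -->
  (\int[mu]_p (u p)%:E)%E.
Proof.
move=> mu_ iu; have pi0 : (0 : R) < pi := pi_gt0 R.
have iud := gaussian_integrable iu.
have mg n : measurable_fun setT (fun p : R * R => pi^-1 * (gauss_approx n p * u p)).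
  apply: measurable_funM => //; apply: measurable_funM => //.
  by apply: measurable_funX; exact: cap_measurable.
rewrite gaussian_integral_real//.
have [] := @dominated_convergence _ _ R dA setT measurableT
  (fun n p => (pi^-1 * (gauss_approx n p * u p))%:E)
  (fun p => (u p * density p)%:E) (fun p => `|u p * density p|%:E).
- by move=> n; apply/measurable_EFinP; exact: mg.
- by case/integrableP : iud.
- apply: aeW => p _; apply: cvg_EFin; first exact: nearW.
  rewrite densityE (_ : u p * _ = pi^-1 * (expR (- sqnorm p) * u p)); last by ring.
  by apply: cvgMr; apply: cvgMl; exact: gauss_approx_cvg.
- exact: (integrable_norm iud).
- apply: aeW => p n _; rewrite lee_fin densityE.
  rewrite (_ : u p * _ = pi^-1 * (expR (- sqnorm p) * u p)); last by ring.
  rewrite !(normrM pi^-1) ler_wpM2l// (normrM (gauss_approx n p)).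
  rewrite (normrM (expR _)) ler_wpM2r// !ger0_norm ?expR_ge0//.
    exact: gauss_approx_le.
  by rewrite exprn_ge0// cap_ge0.
by [].
Qed.

(** The mean value property holds against each [gauss_approx n], and these
    functions converge to the Gaussian while staying below it. *)
Theorem gaussian_mean_value (u v : R * R -> R) : cauchy_riemann u v ->
  measurable_fun setT u -> mu.-integrable setT (EFin \o u) ->
  (\int[mu]_p (u p)%:E = (u origin)%:E)%E.
Proof.
move=> uv mu_ iu; have cu := cauchy_riemann_continuous uv.
have i1 : mu.-integrable setT (EFin \o (fun=> 1 : R)).
  apply/integrableP; split; first exact/measurable_EFinP.
  by under eq_integral do rewrite /= normr1; rewrite integral_cst//= gaussian_setT mule1 ltry.
have l1 := gauss_approx_integral_cvg mu_ iu.
have l2 := gauss_approx_integral_cvg (@measurable_cst _ _ _ _ setT (1 : R)) i1.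
have E n : (\int[dA]_p (pi^-1 * (gauss_approx n p * u p))%:E =
    (u origin)%:E * \int[dA]_p (pi^-1 * (gauss_approx n p * 1))%:E)%E.
  have r0 : (0 : R) < n.+2%:R^-1 by rewrite invr_gt0.
  have iT w : continuous w -> dA.-integrable setT
     (EFin \o (fun p => gauss_approx n p * w p)) by exact: cap_integrable.
  have c1 : continuous ((fun=> 1) : R * R -> R) := @continuous_const R 1.
  under eq_integral do rewrite EFinM.
  under [in RHS]eq_integral do rewrite EFinM.
  rewrite integralZl//; last exact: iT.
  rewrite [in RHS]integralZl//; last exact: iT.
  have i2 : dA.-integrable setT (EFin \o gauss_approx n).
    have := iT _ c1; apply: eq_integrable => // p _ /=; by rewrite mulr1.
  have := congr1 EFin (mean_value origin n r0 uv).
  rewrite EFinM EFin_Rintegral; last exact: iT.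
  rewrite EFin_Rintegral; last exact: i2.
  move=> ->; rewrite muleCA; congr (_ * (_ * _))%E.
  by apply: eq_integral => p _; rewrite mulr1.
have l3 : (\int[dA]_p (pi^-1 * (gauss_approx n p * u p))%:E)%E @[n --> \oo] -->
    ((u origin)%:E * \int[mu]_p (1 : R)%:E)%E.
  by under eq_fun do rewrite E; exact: cvgeZl.
rewrite (cvg_unique _ l1 l3)//.
by rewrite integral_cst//= gaussian_setT mul1e mule1.
Qed.

End gaussian_mean_value.

(** * Local integrability of powers of the modulus *)

Section local_power.
Context {R : realType}.
Notation dA := (@dA R).
Notation origin := ((0, 0) : R * R).
Implicit Types (p : R * R) (rho : R).

(** With [s = rho |p|^2] and [T = (1 - s)_+], the sum [T^2 + ... + T^(M+1)], a
    partial sum of the geometric series of [T^2/s]: it satisfies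
    [s * cap_sum <= 1], while its mass grows like the harmonic series. *)
Definition cap_sum rho (M : nat) p : R := \sum_(k < M) cap rho origin p ^+ k.+2.

Lemma cap_sum_ge0 rho M p : 0 <= cap_sum rho M p.
Proof. by apply: sumr_ge0 => k _; rewrite exprn_ge0// cap_ge0. Qed.

Lemma cap_sum_measurable rho M : measurable_fun [set: R * R] (cap_sum rho M).
Proof.
rewrite /cap_sum; apply: measurable_sum => k; apply: measurable_funX.
exact: cap_measurable.
Qed.

Lemma cap_sum_le rho M p : 0 < rho -> rho * sqnorm p * cap_sum rho M p <= 1.
Proof.
move=> r0; have s0 := sqnorm_ge0 p.
have [T0|T0] := eqVneq (cap rho origin p) 0.
  by rewrite /cap_sum big1 ?mulr0// => k _; rewrite T0 expr0n.
have TE : rho * sqnorm p = 1 - cap rho origin p.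
  by move: T0; rewrite cap_origin; case: leP; rewrite ?eqxx// => _ _; ring.
have T1 : cap rho origin p <= 1 by apply: cap_le1; exact: ltW.
rewrite TE; set T := cap rho origin p.
have T0' : 0 <= T := cap_ge0 _ _ _.
have -> : (1 - T) * cap_sum rho M p = T ^+ 2 - T ^+ M.+2.
  rewrite /cap_sum -/T; elim: M => [|M ih]; first by rewrite big_ord0 mulr0 subrr.
  by rewrite big_ord_recr/= mulrDr ih [T ^+ M.+3]exprS; ring.
have : T ^+ 2 <= 1 by rewrite exprn_ile1.
have : 0 <= T ^+ M.+2 by rewrite exprn_ge0.
lra.
Qed.

Lemma cap_sum_support rho M p : 0 < rho -> 1 <= rho * sqnorm p -> cap_sum rho M p = 0.
Proof.
move=> r0 h; rewrite /cap_sum big1// => k _.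
by rewrite cap_origin max_l ?expr0n// subr_le0.
Qed.

(** The sum [1/3 + 1/4 + ... + 1/(M+2)]. *)
Definition shifted_harmonic (M : nat) : R := \sum_(k < M) k.+3%:R^-1.

Lemma shifted_harmonic_unbounded (K : R) : exists M, K <= shifted_harmonic M.
Proof.
have hd : series (@harmonic R) n @[n --> \oo] --> +oo%R.
  apply: nondecreasing_dvgn_lt; last exact: dvg_harmonic.
  by apply: nondecreasing_series => n _ _; rewrite invr_ge0.
have /cvgryPge/(_ (K + 2))[N _ hN] := hd.
exists N; have := hN (N + 2)%N (leq_addr _ _).
rewrite /series/= addn2 big_nat_recl// big_nat_recl// big_mkord.
have -> : \sum_(i < N) harmonic i.+2 = shifted_harmonic N by [].
have : (2 : R)^-1 <= 1 by rewrite invf_le1 ?ler1n.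
by rewrite /harmonic/= invr1; lra.
Qed.

Lemma cap_sum_integral rho M (u v : R * R -> R) : 0 < rho -> cauchy_riemann u v ->
  (\int[dA]_p (cap_sum rho M p * u p)%:E =
   (u origin * (3 * (\int[dA]_p (cap rho origin p ^+ 2))%R * shifted_harmonic M))%:E)%E.
Proof.
move=> r0 uv; have cu := cauchy_riemann_continuous uv.
set J := (\int[dA]_p (cap rho origin p ^+ 2))%R.
have iT k := cap_integrable origin k.+1 r0 cu.
under eq_integral do rewrite /cap_sum mulr_suml -sumEFin.
rewrite integral_sum//; last by move=> k; exact: iT.
rewrite /shifted_harmonic !mulr_sumr -sumEFin; apply: eq_bigr => k _.
have m1 := cap_moment origin k r0 (cauchy_riemann_const (1 : R)).
have m2 := mean_value origin k r0 uv.
have E1 : \int[dA]_z (cap rho origin z ^+ 2 * 1) = J.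
  by apply: eq_Rintegral => z _; rewrite mulr1.
have E2 : \int[dA]_z (cap rho origin z ^+ k.+2 * 1) =
    \int[dA]_z (cap rho origin z ^+ k.+2).
  by apply: eq_Rintegral => z _; rewrite mulr1.
move: m1; rewrite E1 E2 => m1.
rewrite -[LHS]fineK; last by apply: integrable_fin_num => //; exact: iT.
congr EFin; rewrite -/(Rintegral _ _ _) [LHS]m2 -m1.
by field; rewrite gt_eqF// ltr0n.
Qed.

Lemma cap_mass_gt0 rho : 0 < rho -> 0 < \int[dA]_p (cap rho origin p ^+ 2).
Proof.
move=> r0; apply: lt_le_trans (cap_mass_ge origin r0).
by rewrite exprn_gt0// invr_gt0; lra.
Qed.

Lemma origin_null : {ae dA, forall p : R * R, p != origin}.
Proof.
exists [set origin]; split.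
- rewrite (_ : [set origin] = [set 0] `*` [set 0]); first exact: measurableX.
  by apply/seteqP; split => -[x y] /=; [case=> -> ->|case=> -> ->].
- rewrite (_ : [set origin] = [set 0] `*` [set 0]).
    by rewrite /dA product_measure1E//= !lebesgue_measure_set1 mule0.
  by apply/seteqP; split => -[x y] /=; [case=> -> ->|case=> -> ->].
- by move=> p /= /negP; rewrite negbK => /eqP ->.
Qed.

Lemma ball_measurable (r : R) :
  measurable [set p : R * R | modC (toC p) <= r].
Proof.
have := @measurable_modC_toC R measurableT `]-oo, r]%classic (measurable_itv _).
by rewrite setTI; congr (measurable _).
Qed.

Lemma power_measurable (a : R) :
  measurable_fun [set: R * R] (fun p => modC (toC p) `^ a).
Proof.
apply: (@measurableT_comp _ _ _ _ _ _ (fun t : R => t `^ a)).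
  exact: measurable_powR.
exact: measurable_modC_toC.
Qed.

(** [|p|^-2] dominates every [cap_sum], up to scaling, and their masses are
    unbounded. *)
Lemma power_not_integrable (a r : R) : a <= -2 -> 0 < r <= 1 ->
  (\int[dA]_p (\1_[set p : R * R | modC (toC p) <= r] p * modC (toC p) `^ a)%:E = +oo)%E.
Proof.
move=> a2 /andP[r0 r1]; set B := [set p : R * R | _].
(* For this rho the caps are supported in the disc of radius r. *)
pose rho := (r ^+ 2)^-1.
have rho0 : 0 < rho by rewrite invr_gt0 exprn_gt0.
pose J := (\int[dA]_p (cap rho origin p ^+ 2))%R.
have J0 : 0 < J := cap_mass_gt0 rho0.
apply/eqyP => K K0.
have [M hM] := shifted_harmonic_unbounded (K / (3 * J * rho)).
have c0 : 0 < 3 * J * rho by rewrite !mulr_gt0.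
apply: (@le_trans _ _ (\int[dA]_p (rho * cap_sum rho M p)%:E)%E).
  under eq_integral do rewrite EFinM.
  rewrite ge0_integralZl//; first last.
  - by rewrite lee_fin ltW.
  - by move=> p _; rewrite lee_fin cap_sum_ge0.
  - by apply/measurable_EFinP; exact: cap_sum_measurable.
  have -> : (\int[dA]_p (cap_sum rho M p)%:E = (3 * J * shifted_harmonic M)%:E)%E.
    rewrite -[X in X%:E]mul1r.
    rewrite -(cap_sum_integral M rho0 (cauchy_riemann_const (1 : R))).
    by apply: eq_integral => p _; rewrite mulr1.
  rewrite -EFinM lee_fin.
  by move: hM; rewrite ler_pdivrMr//; nra.
apply: ae_ge0_le_integral => //.
- by move=> p _; rewrite lee_fin mulr_ge0 ?cap_sum_ge0// ltW.
- by apply/measurable_EFinP; apply: measurable_funM => //; exact: cap_sum_measurable.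
- by move=> p _; rewrite lee_fin mulr_ge0// ?powR_ge0.
- apply/measurable_EFinP; apply: measurable_funM; last exact: power_measurable.
  by apply: measurable_indic; exact: ball_measurable.
have [N [mN N0 hN]] := origin_null; exists N; split => // p /= hp.
apply: hN => /= p0; apply: hp => _; rewrite lee_fin.
have m0 : 0 < modC (toC p).
  rewrite lt_neqAle modC_ge0 andbT eq_sym modC_eq0; apply: contra p0.
  by case: p => x y; rewrite eq_complex/= => /andP[/eqP -> /eqP ->].
have s0 : 0 < sqnorm p by rewrite sqnormE exprn_gt0.
have [pB|pB] := leP (modC (toC p)) r; last first.
  rewrite (cap_sum_support _ rho0) ?mulr0 ?mulr_ge0 ?powR_ge0//.
  rewrite /rho mulrC ler_pdivlMr ?exprn_gt0// mul1r sqnormE lerXn2r ?nnegrE ?modC_ge0//;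
  exact: ltW.
rewrite indicE mem_set// mul1r.
have h1 : rho * cap_sum rho M p <= (sqnorm p)^-1.
  by rewrite -[leRHS]mul1r ler_pdivlMr// mulrAC cap_sum_le.
apply: (le_trans h1); rewrite sqnormE -powR_mulrn ?modC_ge0// -powRN.
rewrite /powR gt_eqF// ler_expR ler_wnM2r// ln_le0//.
exact: le_trans pB r1.
Qed.

(** Dyadic decomposition: [|p|^b] is dominated by the sum over [k] of
    [c^(k+1)] times the indicator of the square of half-side [2^-k], with
    [c = 2^(-b) < 4], and that square has area [4 * 4^-k]. *)
Lemma power_locally_integrable (b : R) : -2 < b <= 0 -> exists2 W : R, 0 <= W &
  (\int[dA]_p (\1_[set p : R * R | modC (toC p) <= 1%R] p * modC (toC p) `^ b)%:E <= W%:E)%E.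
Proof.
move=> /andP[b2 b0]; set B := [set p : R * R | _].
pose c : R := 2 `^ (- b).
have c1 : 1 <= c by rewrite /c -[leLHS](powRr0 2) ler_powR ?oppr_ge0//; lra.
have c4 : c < 4.
  rewrite (_ : 4 = 2 `^ 2); last by rewrite powR_mulrn//; ring.
  by rewrite /c /powR pnatr_eq0/= ltr_expR ltr_pM2r ?ln_gt0 ?ltr1n//; lra.
have q1 : `|c / 4| < 1 by rewrite ger0_norm; lra.
exists (4 * c / (1 - c / 4)); first by rewrite divr_ge0//; lra.
pose Q (k : nat) : set (R * R) := `[- (2 ^- k), 2 ^- k] `*` `[- (2 ^- k), 2 ^- k].
have mQ k : measurable (Q k) by apply: measurableX.
have mi k : measurable_fun [set: R * R] (fun p => (\1_(Q k) p : R)%:E).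
  by apply/measurable_EFinP; exact: measurable_indic.
pose f k p : \bar R := (c ^+ k.+1 * \1_(Q k) p)%:E.
have c0 : 0 < c by lra.
have f0 k p : (0 <= f k p)%E by rewrite lee_fin mulr_ge0// exprn_ge0// ltW.
have mf k : measurable_fun [set: R * R] (f k).
  by apply/measurable_EFinP; apply: measurable_funM => //; exact: measurable_indic.
apply: (@le_trans _ _ (\int[dA]_p (\sum_(k <oo) f k p))%E).
  apply: ge0_le_integral => //.
  - by move=> p _; rewrite lee_fin mulr_ge0// powR_ge0.
  - apply/measurable_EFinP; apply: measurable_funM; last exact: power_measurable.
    by apply: measurable_indic; exact: ball_measurable.
  - apply: ge0_emeasurable_sum => [k p _ _|k _]; [exact: f0|exact: mf].
  move=> p _; have [pB|pB] := pselect (B p); last first.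
    by rewrite indicE memNset// mul0r; apply: nneseries_ge0 => k _ _; exact: f0.
  rewrite indicE mem_set// mul1r.
  have [k hk pk] : exists2 k, Q k p & modC (toC p) `^ b <= c ^+ k.+1.
    have inQ k : modC (toC p) <= 2 ^- k -> Q k p.
      move=> h; have := le_trans (normr_Re_le (toC p)) h.
      have := le_trans (normr_Im_le (toC p)) h.
      by case: p {pB h} => x y /=; rewrite /Q/= !in_itv/= -!ler_norml => -> ->.
    have [p0|p0] := eqVneq (modC (toC p)) 0.
      exists 0%N; first by apply: inQ; rewrite p0 expr0 invr1.
      rewrite p0 expr1; apply: le_trans c1.
      by have [->|bn0] := eqVneq b 0; rewrite ?powRr0 ?powR0.
    have m0 : 0 < modC (toC p) by rewrite lt_neqAle eq_sym p0 modC_ge0.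
    have exn : exists n, 2 ^- n < modC (toC p).
      have [n hn] := pow2_gt (modC (toC p))^-1; exists n.
      by rewrite -[ltRHS]invrK ltf_pV2 ?posrE ?invr_gt0 ?exprn_gt0.
    (* p lies in the square of half-side 2^-n, but |p| > 2^-(n+1). *)
    case: (ex_minnP exn) => -[|n] hn nmin.
      by move: pB hn; rewrite /B/= expr0 invr1 => /le_lt_trans h /h; rewrite ltxx.
    exists n; first by apply: inQ; rewrite leNgt; apply/negP => /nmin; rewrite ltnn.
    rewrite -[b]opprK powRN.
    have -> : c ^+ n.+1 = ((2 ^- n.+1) `^ (- b))^-1.
      rewrite /c -powR_mulrn ?powR_ge0// -powRrM mulrC powRrM powR_mulrn//.
      rewrite -[2 ^- n.+1](@powR_inv1 _ (2 ^+ n.+1)) ?exprn_ge0//.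
      by rewrite -powRrM mulN1r [in RHS]powRN invrK.
    rewrite lef_pV2 ?posrE ?powR_gt0 ?invr_gt0 ?exprn_gt0//.
    apply: ge0_ler_powR.
    - by rewrite oppr_ge0.
    - by rewrite nnegrE invr_ge0 exprn_ge0.
    - by rewrite nnegrE modC_ge0.
    - exact: ltW.
  apply: (@le_trans _ _ (f k p)).
    by rewrite lee_fin indicE mem_set// mulr1.
  apply: le_trans (nneseries_lim_ge k.+1 (fun n _ _ => f0 n p)).
  by rewrite big_nat_recr//= leeDr// sume_ge0.
rewrite integral_nneseries//.
have fE k : (\int[dA]_p f k p)%E = (4 * c * (c / 4) ^+ k)%:E.
  under eq_integral do rewrite /f EFinM.
  rewrite ge0_integralZl//; first last.
  - by rewrite lee_fin exprn_ge0// ltW.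
  - exact: mi.
  have QE : (\int[dA]_p (\1_(Q k) p)%:E = (4 * (2 ^- k) ^+ 2)%:E)%E.
    rewrite -(@square_measure R (2 ^- k)) ?invr_ge0 ?exprn_ge0//.
    transitivity (dA (Q k `&` setT)); last by congr (dA _); exact: setIT.
    by apply: integral_indic => //; exact: mQ.
  rewrite QE.
  rewrite -EFinM; congr EFin; rewrite expr_div_n exprS.
  have -> : (4 : R) ^+ k = (2 ^+ k) ^+ 2.
    by rewrite -exprM mulnC exprM; congr (_ ^+ k); ring.
  by field; rewrite expf_neq0.
apply: lime_le.
  by apply: is_cvg_nneseries => k _ _; apply: integral_ge0 => p _; exact: f0.
apply: nearW => n; under eq_bigr do rewrite fE.
rewrite sumEFin lee_fin.
apply: le_trans (@geometric_le_lim R n (4 * c) (c / 4) _ _ q1).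
- by rewrite /series/geometric/=.
- by rewrite mulr_ge0// ltW.
- by rewrite divr_gt0.
Qed.

End local_power.

(** * The heat transform *)

(** A partial integral over a product of two sigma-finite factors is
    measurable: it is an iterated partial integral. *)
Lemma measurable_product_integral (R : realType) (d d1 d2 : measure_display)
  (T : measurableType d) (T1 : measurableType d1) (T2 : measurableType d2)
  (m1 : {sigma_finite_measure set T1 -> \bar R})
  (m2 : {sigma_finite_measure set T2 -> \bar R}) (k : T * (T1 * T2) -> \bar R) :
  measurable_fun setT k -> (forall z, 0 <= k z)%E ->
  measurable_fun setT (fun x => \int[(m1 \x m2)%E]_p k (x, p))%E.
Proof.
move=> mk k0.
pose k' (z : (T * T1) * T2) := k (z.1.1, (z.1.2, z.2)).
have mk' : measurable_fun setT k'.
  apply: (measurableT_comp mk).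
  apply: measurable_fun_pair.
    exact: (measurableT_comp measurable_fst measurable_fst).
  apply: measurable_fun_pair => //.
  exact: (measurableT_comp measurable_snd measurable_fst).
have m1k := @measurable_fun_fubini_tonelli_F _ _ _ _ R m2 k' mk' (fun z => k0 _).
have i0 z : (0 <= fubini_F m2 k' z)%E by apply: integral_ge0 => y _; exact: k0.
have := @measurable_fun_fubini_tonelli_F _ _ _ _ R m1 _ m1k i0.
congr (measurable_fun _ _); apply/funext => x.
rewrite fubini_tonelli1//.
exact: (measurableT_comp mk (measurable_fun_pair (measurable_cst x) (@measurable_id _ _ setT))).
Qed.

Section heat_kernel.
Context {R : realType}.
Notation dA := (@dA R).
Implicit Types (p q : R * R) (t alpha : R).

(** The square of the distance, on pairs of reals. *)
Definition sqdist q p : R := (q.1 - p.1) ^+ 2 + (q.2 - p.2) ^+ 2.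

Lemma sqdistE q p : modC (toC q - toC p) ^+ 2 = sqdist q p.
Proof. by rewrite sqr_modC. Qed.

Lemma sqdist_ge0 q p : 0 <= sqdist q p.
Proof. by rewrite addr_ge0// sqr_ge0. Qed.

Lemma gaussian_kernel_integral (t : R) : 0 < t -> exists2 C : R, 0 < C &
  forall q, (\int[dA]_p (expR (- sqdist q p / (4 * t)))%:E = C%:E)%E.
Proof.
move=> t0; pose s : R := Num.sqrt (2 * t).
have s2 : s ^+ 2 = 2 * t by rewrite /s sqr_sqrtr// mulr_ge0// ltW.
have s0 : s != 0 by rewrite /s gt_eqF// sqrtr_gt0 mulr_gt0.
have pk : 0 < normal_peak s by exact: normal_peak_gt0.
pose c := (normal_peak s)^-1; have c0 : 0 < c by rewrite invr_gt0.
have nf m : (\int[@lebesgue_measure R]_x (normal_fun m s x)%:E = c%:E)%E.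
  have := integral_normal_pdf m s.
  under eq_integral do rewrite (normal_pdfE m s0) EFinM.
  rewrite ge0_integralZl//; first last.
  - by rewrite lee_fin ltW.
  - by move=> x _; rewrite lee_fin normal_fun_ge0.
  - by apply/measurable_EFinP; exact: measurable_normal_fun.
  move=> h; rewrite /c -[LHS]mul1e -(mulVf (lt0r_neq0 pk)) EFinM -muleA h.
  by rewrite mule1.
exists (c * c) => [|q]; first exact: mulr_gt0.
have E p : expR (- sqdist q p / (4 * t)) = normal_fun q.1 s p.1 * normal_fun q.2 s p.2.
  rewrite /normal_fun -expRD s2; congr expR; rewrite /sqdist.
  by field; rewrite gt_eqF.
under eq_integral do rewrite E EFinM.
have mn m : measurable_fun setT (fun x : R => (normal_fun m s x)%:E).
  by apply/measurable_EFinP; exact: measurable_normal_fun.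
rewrite fubini_tonelli1; first last.
- by move=> p; rewrite mule_ge0// lee_fin normal_fun_ge0.
- apply: emeasurable_funM.
    exact: (measurableT_comp (mn q.1) measurable_fst).
  exact: (measurableT_comp (mn q.2) measurable_snd).
rewrite /fubini_F/=.
under eq_integral.
  move=> x _; rewrite ge0_integralZl//; first last.
  - by rewrite lee_fin normal_fun_ge0.
  - by move=> y _; rewrite lee_fin normal_fun_ge0.
  - exact: mn.
  rewrite nf; over.
rewrite ge0_integralZr//; first by rewrite nf -EFinM.
- exact: mn.
- by move=> y _; rewrite lee_fin normal_fun_ge0.
- by rewrite lee_fin ltW.
Qed.

Lemma heat_transformE alpha t q : heat_transform (power_symbol alpha) t (toC q) =
  ((4 * pi * t)^-1%:E * \int[dA]_p (modC (toC p) `^ alpha *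
     expR (- sqdist q p / (4 * t)))%:E)%E.
Proof.
by rewrite /heat_transform; under eq_integral do rewrite sqdistE.
Qed.

Lemma heat_transform_ge0 alpha t q : 0 < t ->
  (0 <= heat_transform (power_symbol alpha) t (toC q))%E.
Proof.
move=> t0; have pi0 : (0 : R) < pi := pi_gt0 R.
rewrite heat_transformE mule_ge0//.
  by rewrite lee_fin invr_ge0 ltW// !mulr_gt0.
by apply: integral_ge0 => p _; rewrite lee_fin mulr_ge0 ?powR_ge0 ?expR_ge0.
Qed.

Lemma sqdist_measurable : measurable_fun [set: (R * R) * (R * R)]
  (fun z => sqdist z.1 z.2).
Proof.
have m11 : measurable_fun [set: (R * R) * (R * R)] (fun z => z.1.1).
  exact: (measurableT_comp measurable_fst measurable_fst).
have m12 : measurable_fun [set: (R * R) * (R * R)] (fun z => z.1.2).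
  exact: (measurableT_comp measurable_snd measurable_fst).
have m21 : measurable_fun [set: (R * R) * (R * R)] (fun z => z.2.1).
  exact: (measurableT_comp measurable_fst measurable_snd).
have m22 : measurable_fun [set: (R * R) * (R * R)] (fun z => z.2.2).
  exact: (measurableT_comp measurable_snd measurable_snd).
by apply: measurable_funD; apply: measurable_funX; exact: measurable_funB.
Qed.

Lemma sqdist_measurable2 q : measurable_fun [set: R * R] (sqdist q).
Proof.
by apply: measurable_funD; apply: measurable_funX; apply: measurable_funB.
Qed.

Lemma kernel_measurable alpha t q : measurable_fun [set: R * R]
  (fun p => (modC (toC p) `^ alpha * expR (- sqdist q p / (4 * t)))%:E).
Proof.
apply/measurable_EFinP; apply: measurable_funM; first exact: power_measurable.
apply: measurableT_comp => //; apply: measurable_funM => //.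
by apply: measurableT_comp => //; exact: sqdist_measurable2.
Qed.

Lemma heat_transform_measurable alpha t : measurable_fun [set: R * R]
  (fun q => heat_transform (power_symbol alpha) t (toC q)).
Proof.
under eq_fun do rewrite heat_transformE.
apply: emeasurable_funM => //.
pose k (z : (R * R) * (R * R)) : \bar R :=
  (modC (toC z.2) `^ alpha * expR (- sqdist z.1 z.2 / (4 * t)))%:E.
apply: (@measurable_product_integral R _ _ _ (R * R)%type _ _
  (@lebesgue_measure R) (@lebesgue_measure R) k).
- apply/measurable_EFinP; apply: measurable_funM.
    exact: (measurableT_comp (power_measurable alpha) measurable_snd).
  apply: measurableT_comp => //; apply: measurable_funM => //.
  by apply: measurableT_comp => //; exact: sqdist_measurable.
- by move=> z; rewrite /k lee_fin mulr_ge0 ?powR_ge0 ?expR_ge0.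
Qed.

Lemma heat_transform_bounded alpha t : 0 < t -> -2 < alpha <= 0 ->
  exists C : R, forall q,
    (heat_transform (power_symbol alpha) t (toC q) <= C%:E)%E.
Proof.
move=> t0 a0; have pi0 : (0 : R) < pi := pi_gt0 R.
have [W W0 hW] := power_locally_integrable a0.
have [C C0 hC] := gaussian_kernel_integral t0.
exists ((4 * pi * t)^-1 * (W + C)) => q; rewrite heat_transformE [leRHS]EFinM.
apply: lee_wpmul2l; first by rewrite lee_fin invr_ge0 ltW// !mulr_gt0.
set B := [set p : R * R | modC (toC p) <= 1] in hW.
have mB : measurable_fun [set: R * R] (fun p => (\1_B p * modC (toC p) `^ alpha)%:E).
  apply/measurable_EFinP; apply: measurable_funM; last exact: power_measurable.
  by apply: measurable_indic; exact: ball_measurable.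
have mk : measurable_fun [set: R * R] (fun p => (expR (- sqdist q p / (4 * t)))%:E).
  apply/measurable_EFinP; apply: measurableT_comp => //; apply: measurable_funM => //.
  by apply: measurableT_comp => //; exact: sqdist_measurable2.
apply: (@le_trans _ _ (\int[dA]_p ((\1_B p * modC (toC p) `^ alpha)%:E +
    (expR (- sqdist q p / (4 * t)))%:E))%E).
  apply: ge0_le_integral => //.
  - by move=> p _; rewrite lee_fin mulr_ge0 ?powR_ge0 ?expR_ge0.
  - exact: kernel_measurable.
  - exact: emeasurable_funD.
  move=> p _; rewrite -EFinD lee_fin.
  have e1 : expR (- sqdist q p / (4 * t)) <= 1.
    rewrite -[leRHS]expR0 ler_expR mulNr oppr_le0.
    by rewrite divr_ge0 ?sqdist_ge0// ltW// mulr_gt0.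
  have [pB|pB] := pselect (B p).
    rewrite indicE mem_set// mul1r.
    apply: (@le_trans _ _ (modC (toC p) `^ alpha)).
      by rewrite -[leRHS]mulr1 ler_wpM2l// powR_ge0.
    by rewrite lerDl expR_ge0.
  rewrite indicE memNset// mul0r add0r.
  rewrite -[leRHS]mul1r ler_wpM2r ?expR_ge0//.
  have p1 : 1 <= modC (toC p) by rewrite ltW// ltNge; apply/negP.
  by rewrite -(powRr0 (modC (toC p))) ler_powR//; case/andP: a0.
rewrite ge0_integralD//; first last.
- by move=> p _; rewrite lee_fin mulr_ge0 ?powR_ge0.
by rewrite EFinD; apply: leeD => //; rewrite hC.
Qed.

Lemma bounded_Linfty (u : R[i] -> \bar R) (C : R) :
  measurable_fun [set: R * R] (fun p => u (toC p)) ->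
  (forall p, 0 <= u (toC p) <= C%:E)%E -> Linfty u.
Proof.
move=> mu_ hu; split => //; rewrite unlock; case: ifP => [_|_]; last exact: ltry.
apply: (@le_lt_trans _ _ C%:E); last exact: ltry.
apply/ess_sup_inf.ess_supP; apply: aeW => p /=.
by have /andP[u0 uC] := hu p; rewrite gee0_abs.
Qed.

(** An essentially bounded function is bounded by a fixed constant at some
    point of every set of positive measure. *)
Lemma Linfty_bounded_somewhere (u : R[i] -> \bar R) :
  Linfty u -> exists C : R, forall S, measurable S -> (0 < dA S)%E ->
  exists2 p, S p & (`|u (toC p)| <= C%:E)%E.
Proof.
(* The norm is an essential supremum only if the plane has positive measure;
   otherwise no set has positive measure. *)
move=> [mu_ +]; rewrite unlock; case: ifPn => [_|].
  move=> hlt.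
  have [C hC] : exists C : R, (ess_sup_inf.ess_sup dA (abse \o (u \o @toC R)) <= C%:E)%E.
    move: hlt; case: (ess_sup_inf.ess_sup _ _) => [r _|//|_]; first by exists r.
    by exists 0; rewrite leNye.
  exists C => A mA A0; apply: contrapT => hn.
  have /ess_sup_inf.ess_supP[N [mN N0 hN]] := hC.
  have AN : A `<=` N.
    move=> p Ap; apply: hN => /= hp; apply: hn; exists p => //; exact: hp.
  have : (dA A <= 0)%E by rewrite -N0; apply: le_measure => //; rewrite inE.
  by rewrite leNgt A0.
move=> h0 _; exists 0 => A mA A0; exfalso; move/negP: h0; apply.
apply: lt_le_trans A0 _; apply: le_measure => //; rewrite inE//.
Qed.

Lemma rectangle_measure (a b c d : R) : a < b -> c < d ->
  dA (`[a, b] `*` `[c, d]) = ((b - a) * (d - c))%:E.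
Proof.
move=> ab cd; rewrite /dA product_measure1E//= !lebesgue_measure_itv/= !lte_fin.
by rewrite ab cd -!EFinD -EFinM.
Qed.

Lemma heat_transform_infinite alpha t q : 0 < t -> alpha <= -2 ->
  heat_transform (power_symbol alpha) t (toC q) = +oo%E.
Proof.
move=> t0 a2; have pi0 : (0 : R) < pi := pi_gt0 R.
rewrite heat_transformE.
rewrite [X in (_ * X)%E](_ : _ = +oo%E).
  by rewrite gt0_muley// lte_fin invr_gt0 !mulr_gt0.
  apply/eqP; rewrite -leye_eq.
  pose c := expR (- ((modC (toC q) + 1) ^+ 2 / (4 * t))).
  have h := power_not_integrable a2 (introT andP (conj ltr01 (lexx (1 : R)))).
  set B := [set p : R * R | modC (toC p) <= 1] in h.
  rewrite -(@gt0_muley _ c%:E) ?lte_fin ?expR_gt0// -h -ge0_integralZl//; first last.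
  - by rewrite lee_fin expR_ge0.
  - by move=> p _; rewrite lee_fin mulr_ge0 ?powR_ge0.
  - apply/measurable_EFinP; apply: measurable_funM; last exact: power_measurable.
    by apply: measurable_indic; exact: ball_measurable.
  apply: ge0_le_integral => //.
  - by move=> p _; rewrite -EFinM lee_fin mulr_ge0 ?expR_ge0// mulr_ge0 ?powR_ge0.
  - apply: emeasurable_funM => //; apply/measurable_EFinP.
    apply: measurable_funM; last exact: power_measurable.
    by apply: measurable_indic; exact: ball_measurable.
  - exact: kernel_measurable.
  move=> p _; rewrite -EFinM lee_fin.
  have [pB|pB] := pselect (B p); last first.
    by rewrite indicE memNset// mul0r mulr0 mulr_ge0 ?powR_ge0 ?expR_ge0.
  rewrite indicE mem_set// mul1r mulrC ler_wpM2l ?powR_ge0// ler_expR.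
  rewrite mulNr lerN2 ler_wpM2r ?invr_ge0 ?mulr_ge0 ?(ltW t0)//.
  rewrite -sqdistE lerXn2r ?nnegrE ?modC_ge0 ?addr_ge0 ?modC_ge0//.
  apply: (@le_trans _ _ (modC (toC q) + modC (toC p))); last by rewrite lerD2l.
  by rewrite -lecR rmorphD/= -!norm_modC ler_normB.
Qed.

(** The integral is bounded below by its part over a square of side [1/2] with
    corner [q], where [|p| >= r] and the heat kernel is not small. *)
Lemma heat_transform_lower alpha t (r : R) q : 0 < t -> 0 < alpha -> 0 < r ->
  r <= q.1 -> ((4 * pi * t)^-1%:E * (r `^ alpha * expR (- (1 / (4 * t))) / 4)%:E <=
    heat_transform (power_symbol alpha) t (toC q))%E.
Proof.
move=> t0 a0 r0 rq; have pi0 : (0 : R) < pi := pi_gt0 R.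
rewrite heat_transformE; apply: lee_wpmul2l.
  by rewrite lee_fin invr_ge0 ltW// !mulr_gt0.
pose S : set (R * R) := `[q.1, q.1 + 1 / 2] `*` `[q.2, q.2 + 1 / 2].
have mS : measurable S by apply: measurableX.
have SE : dA S = (1 / 4)%:E.
  by rewrite rectangle_measure; [congr EFin; field|lra|lra].
set m := r `^ alpha * expR (- (1 / (4 * t))).
apply: (@le_trans _ _ (\int[dA]_(p in S) m%:E)%E).
  have -> : (\int[dA]_(p in S) m%:E = m%:E * dA S)%E by exact: integral_cst.
  by rewrite SE -EFinM lee_fin; lra.
apply: (@le_trans _ _ (\int[dA]_(p in S) (modC (toC p) `^ alpha *
     expR (- sqdist q p / (4 * t)))%:E)%E); last first.
  apply: ge0_subset_integral => //.
  - exact: kernel_measurable.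
  - by move=> p _; rewrite lee_fin mulr_ge0 ?powR_ge0 ?expR_ge0.
apply: ge0_le_integral => //.
- by move=> p _; rewrite lee_fin mulr_ge0 ?powR_ge0 ?expR_ge0.
- by apply: measurable_funTS; exact: kernel_measurable.
move=> [x y] [/=]; rewrite !in_itv/= => /andP[x1 x2] /andP[y1 y2].
rewrite lee_fin /m ler_pM ?powR_ge0 ?expR_ge0//.
  apply: ge0_ler_powR; [exact: ltW|by rewrite nnegrE ltW|by rewrite nnegrE modC_ge0|].
  apply: le_trans (normr_Re_le _); rewrite /=; apply: le_trans (ler_norm _).
  exact: le_trans rq x1.
rewrite ler_expR mulNr lerN2 ler_wpM2r ?invr_ge0 ?mulr_ge0 ?(ltW t0)//.
by rewrite /sqdist/=; nra.
Qed.

Theorem heat_transform_Linfty alpha t : 0 < t ->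
  (Linfty (heat_transform (power_symbol alpha) t) <-> -2 < alpha <= 0).
Proof.
move=> t0; have pi0 : (0 : R) < pi := pi_gt0 R.
split; last first.
  move=> /(heat_transform_bounded t0)[C hC].
  apply: (@bounded_Linfty _ C); first exact: heat_transform_measurable.
  by move=> p; rewrite heat_transform_ge0//= hC.
move=> /Linfty_bounded_somewhere[C hC]; apply/andP; split.
  rewrite ltNge; apply/negP => a2.
  have [||p _] := hC (`[0, 1] `*` `[0, 1]).
  - by apply: measurableX.
  - by rewrite rectangle_measure// subr0 mulr1 lte_fin.
  by rewrite heat_transform_infinite.
rewrite leNgt; apply/negP => a0.
(* r is chosen so that the lower bound of heat_transform_lower exceeds C. *)
pose kappa := (4 * pi * t)^-1 * expR (- (1 / (4 * t))) / 4.
have k0 : 0 < kappa by rewrite !mulr_gt0 ?invr_gt0 ?expR_gt0 ?mulr_gt0.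
pose M := (`|C| + 1) / kappa.
have M0 : 0 < M by rewrite divr_gt0// ltr_wpDl.
pose r := M `^ alpha^-1.
have r0 : 0 < r by rewrite powR_gt0.
have rE : r `^ alpha = M by rewrite /r -powRrM mulVf ?gt_eqF// powRr1// ltW.
have [||[x y] [/= hx _]] := hC (`[r, r + 1] `*` `[0, 1]).
- by apply: measurableX.
- by rewrite rectangle_measure ?ltrDl// lte_fin; lra.
rewrite gee0_abs ?heat_transform_ge0//.
have rx : r <= (x, y).1 by move: hx; rewrite in_itv/= => /andP[].
move=> /(le_trans (heat_transform_lower t0 a0 r0 rx)).
rewrite rE -EFinM lee_fin.
have -> : (4 * pi * t)^-1 * (M * expR (- (1 / (4 * t))) / 4) = `|C| + 1.
  suff -> : (4 * pi * t)^-1 * (M * expR (- (1 / (4 * t))) / 4) = M * kappa.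
    by rewrite /M divfK// gt_eqF.
  by rewrite /kappa -2!(mulrA _ _ 4^-1) mulrCA.
by have := ler_norm C; lra.
Qed.

End heat_kernel.

(** * Weighted norms of entire functions *)

Section square_integrable.
Context {R : realType}.
Notation mu := (@gaussian R).
Notation C := R[i].
Notation dA := (@dA R).

Lemma measurableC_real (g : C -> R) :
  measurable_fun [set: R * R] (fun p => g (toC p)) ->
  Defs.measurableC (fun z => (g z)%:C).
Proof. by move=> mg; split => //=; exact: measurable_cst. Qed.

Lemma measurableC_mul (f h : C -> C) : Defs.measurableC f -> Defs.measurableC h ->
  Defs.measurableC (fun z => f z * h z).
Proof.
move=> [fr fi] [hr hi]; split.
- apply: (eq_measurable_fun (fun p : R * R => Re (f (toC p)) * Re (h (toC p)) -
    Im (f (toC p)) * Im (h (toC p)))).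
    by move=> p _; case: (f _) (h _) => [a b] [c d].
  by apply: measurable_funB; exact: measurable_funM.
- apply: (eq_measurable_fun (fun p : R * R => Re (f (toC p)) * Im (h (toC p)) +
    Im (f (toC p)) * Re (h (toC p)))).
    by move=> p _; case: (f _) (h _) => [a b] [c d].
  by apply: measurable_funD; exact: measurable_funM.
Qed.

Lemma measurableC_conj (f : C -> C) : Defs.measurableC f ->
  Defs.measurableC (fun z => conjc (f z)).
Proof.
move=> [fr fi]; split.
  by apply: (eq_measurable_fun _ _ fr) => p _; case: (f _).
apply: (eq_measurable_fun (fun p : R * R => 0 - Im (f (toC p)))).
  by move=> p _; rewrite sub0r; case: (f _).
exact: measurable_funB.
Qed.

Lemma measurableC_sub (f h : C -> C) : Defs.measurableC f -> Defs.measurableC h ->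
  Defs.measurableC (fun z => f z - h z).
Proof.
move=> [fr fi] [hr hi]; split.
  apply: (eq_measurable_fun _ _ (measurable_funB fr hr)) => p _ /=.
  by case: (f _) (h _) => [a b] [c d].
apply: (eq_measurable_fun _ _ (measurable_funB fi hi)) => p _ /=.
by case: (f _) (h _) => [a b] [c d].
Qed.

Lemma measurableC_exp n : Defs.measurableC (fun z : C => z ^+ n).
Proof.
have mid : Defs.measurableC (fun z : C => z).
  by split; [exact: measurable_fst|exact: measurable_snd].
elim: n => [|n IH]; first exact: (@measurableC_real (fun=> 1)) (measurable_cst _).
have := measurableC_mul mid IH.
by congr Defs.measurableC; apply/funext => z; rewrite exprS.
Qed.

Lemma L2_sub (f h : C -> C) : L2 f -> L2 h -> L2 (fun z => f z - h z).
Proof.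
move=> [mf ff] [mh fh]; split; first exact: measurableC_sub.
have m2 (k : C -> C) : Defs.measurableC k ->
    measurable_fun [set: R * R] (fun p => (2 * modC (k (toC p)) ^+ 2)%:E).
  move=> mk; apply/measurable_EFinP; apply: measurable_funM => //.
  by apply: measurable_funX; exact: measurable_modC.
have f2 (k : C -> C) : Defs.measurableC k ->
    (\int[mu]_p (modC (k (toC p)) ^+ 2)%:E < +oo)%E ->
    (\int[mu]_p (2 * modC (k (toC p)) ^+ 2)%:E < +oo)%E.
  move=> mk fk; under eq_integral do rewrite EFinM.
  rewrite ge0_integralZl//.
  - by rewrite lte_mul_pinfty.
  - by apply/measurable_EFinP; apply: measurable_funX; exact: measurable_modC.
  - by move=> p _; rewrite lee_fin sqr_ge0.
apply: (@le_lt_trans _ _ (\int[mu]_p ((2 * modC (f (toC p)) ^+ 2)%:E +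
    (2 * modC (h (toC p)) ^+ 2)%:E))%E).
  apply: ge0_le_integral => //.
  - by move=> p _; rewrite lee_fin sqr_ge0.
  - apply/measurable_EFinP; apply: measurable_funX.
    exact: (measurable_modC (measurableC_sub mf mh)).
  - by apply: emeasurable_funD; exact: m2.
  - by move=> p _; rewrite -EFinD lee_fin sqr_modC_sub.
rewrite ge0_integralD//; first by rewrite lte_add_pinfty// f2.
- by move=> p _; rewrite lee_fin mulr_ge0// sqr_ge0.
- exact: m2.
- by move=> p _; rewrite lee_fin mulr_ge0// sqr_ge0.
- exact: m2.
Qed.

Lemma F2_sub (f h : C -> C) : F2 f -> F2 h -> F2 (fun z => f z - h z).
Proof. by move=> [ef Lf] [eh Lh]; split; [exact: entireB|exact: L2_sub]. Qed.

Lemma F2_cst (c : R) : F2 (fun=> c%:C).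
Proof.
split; first exact: entire_cst.
split; first exact: (@measurableC_real (fun=> c)) (measurable_cst _).
by rewrite integral_cst//= [X in (_ * X)%E]gaussian_setT mule1 ltry.
Qed.

Lemma normr_Rintegral_le (w : R * R -> R) (B : R) : measurable_fun setT w ->
  (\int[mu]_p `|w p|%:E <= B%:E)%E -> `|\int[mu]_p w p| <= B.
Proof.
move=> mw hB.
have iw : mu.-integrable setT (EFin \o w).
  apply/integrableP; split; first exact/measurable_EFinP.
  exact: le_lt_trans hB (ltry _).
rewrite -lee_fin /Rintegral -fine_abse ?integrable_fin_num// fineK; last first.
  by rewrite abse_fin_num; exact: integrable_fin_num.
apply: le_trans hB; apply: le_abse_integral => //; exact/measurable_EFinP.
Qed.

Lemma modC_integralC_le (w : C -> C) (B : R) : Defs.measurableC w ->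
  (\int[mu]_p (modC (w (toC p)))%:E <= B%:E)%E -> modC (integralC w) <= 2 * B.
Proof.
move=> mw hB; apply: (le_trans (modC_le_normD _)); rewrite /integralC/=.
have [mr mi] := mw.
suff h (u : R * R -> R) : measurable_fun setT u ->
    (forall p, `|u p| <= modC (w (toC p))) -> `|\int[mu]_p u p| <= B.
  by rewrite mulr2n mulrDl mul1r lerD// h// => p; [exact: normr_Re_le|exact: normr_Im_le].
move=> mu_ hu; apply: normr_Rintegral_le => //.
apply: le_trans hB; apply: ge0_le_integral => //.
- by apply/measurable_EFinP; exact: measurableT_comp.
- by apply/measurable_EFinP; exact: measurable_modC.
by move=> p _; rewrite lee_fin.
Qed.

Lemma gaussian_le_lebesgue (w : R * R -> R) : measurable_fun setT w ->
  (forall p, 0 <= w p) ->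
  (\int[mu]_p (w p)%:E <= (pi^-1)%:E * \int[dA]_p (w p)%:E)%E.
Proof.
move=> mw w0; have pi0 : (0 : R) < pi := pi_gt0 R.
have mwE : measurable_fun [set: R * R] (EFin \o w) by exact/measurable_EFinP.
rewrite (gaussian_integral (f := EFin \o w))//.
rewrite -ge0_integralZl//; first last.
- by rewrite lee_fin invr_ge0 ltW.
- by move=> p _; rewrite lee_fin.
apply: ge0_le_integral => //.
- by move=> p _; rewrite -EFinM lee_fin mulr_ge0// gauss_density_ge0.
- by apply: emeasurable_funM => //; exact: density_measurable.
- by apply: emeasurable_funM.
move=> p _; rewrite -!EFinM lee_fin mulrC ler_wpM2r// densityE.
rewrite ler_piMr ?invr_ge0 ?(ltW pi0)// -[leRHS]expR0 ler_expR oppr_le0.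
exact: sqnorm_ge0.
Qed.

(** On the unit disc the weight is integrable and [f] is bounded by its norm;
    outside the disc the weight is at most 1. *)
Lemma weighted_norm_bound (b : R) : -2 < b <= 0 -> exists2 K : R, 0 <= K &
  forall f : C -> C, F2 f -> (\int[mu]_p (modC (toC p) `^ b * modC (f (toC p)) ^+ 2)%:E <=
    ((K * normL2 f) ^+ 2)%:E)%E.
Proof.
move=> hb; have pi0 : (0 : R) < pi := pi_gt0 R.
have [W W0 hW] := power_locally_integrable hb.
have [A A0 hA] := @entire_pointwise_bound R.
set B := [set p : R * R | modC (toC p) <= 1] in hW.
have L0 : 0 <= pi^-1 * W * A ^+ 2 + 1.
  by rewrite addr_ge0// mulr_ge0 ?sqr_ge0// mulr_ge0 ?invr_ge0// ltW.
exists (Num.sqrt (pi^-1 * W * A ^+ 2 + 1)); first exact: sqrtr_ge0.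
move=> f Ff; have [ef Lf] := Ff; have [mf _] := Lf.
rewrite exprMn sqr_sqrtr//.
set N := normL2 f; have N0 : 0 <= N := normL2_ge0 f.
have mB : measurable_fun [set: R * R] (fun p => \1_B p * modC (toC p) `^ b).
  apply: measurable_funM; last exact: power_measurable.
  by apply: measurable_indic; exact: ball_measurable.
have mB2 : measurable_fun [set: R * R] (fun p => \1_B p * modC (toC p) `^ b * (A * N) ^+ 2).
  exact: measurable_funM.
have mf2 : measurable_fun [set: R * R] (fun p => modC (f (toC p)) ^+ 2).
  by apply: measurable_funX; exact: measurable_modC.
apply: (@le_trans _ _ (\int[mu]_p ((\1_B p * modC (toC p) `^ b * (A * N) ^+ 2)%:E +
    (modC (f (toC p)) ^+ 2)%:E))%E).
  apply: ge0_le_integral => //.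
  - by move=> p _; rewrite lee_fin mulr_ge0 ?powR_ge0 ?sqr_ge0.
  - apply/measurable_EFinP; apply: measurable_funM => //; exact: power_measurable.
  - by apply: emeasurable_funD; exact/measurable_EFinP.
  move=> p _; rewrite -EFinD lee_fin.
  have [pB|pB] := pselect (B p).
    rewrite indicE mem_set// mul1r; apply: ler_wpDr; first exact: sqr_ge0.
    apply: ler_wpM2l; first exact: powR_ge0.
    rewrite lerXn2r ?nnegrE ?modC_ge0 ?mulr_ge0//.
    case: p pB => x y pB; apply: hA => //.
      exact: le_trans (normr_Re_le (toC (x, y))) pB.
    exact: le_trans (normr_Im_le (toC (x, y))) pB.
  rewrite indicE memNset// !mul0r add0r.
  rewrite -[leRHS]mul1r ler_wpM2r ?sqr_ge0//.
  have p1 : 1 <= modC (toC p) by rewrite ltW// ltNge; apply/negP.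
  by rewrite -(powRr0 (modC (toC p))) ler_powR//; case/andP: hb.
rewrite ge0_integralD//; first last.
- exact/measurable_EFinP.
- by move=> p _; rewrite lee_fin sqr_ge0.
- exact/measurable_EFinP.
- by move=> p _; rewrite lee_fin !mulr_ge0 ?powR_ge0 ?sqr_ge0.
rewrite -sqr_normL2// -/N mulrDl mul1r EFinD; apply: leeD => //.
apply: le_trans (gaussian_le_lebesgue mB2 _) _.
  by move=> p; rewrite !mulr_ge0 ?powR_ge0 ?sqr_ge0.
have -> : (\int[dA]_p (\1_B p * modC (toC p) `^ b * (A * N) ^+ 2)%:E =
    \int[dA]_p (((A * N) ^+ 2)%:E * (\1_B p * modC (toC p) `^ b)%:E))%E.
  by apply: eq_integral => p _; rewrite -EFinM mulrC.
rewrite ge0_integralZl//; first last.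
- by rewrite lee_fin sqr_ge0.
- by move=> p _; rewrite lee_fin mulr_ge0 ?powR_ge0.
- exact/measurable_EFinP.
have -> : pi^-1 * W * A ^+ 2 * N ^+ 2 = pi^-1 * ((A * N) ^+ 2 * W) by ring.
rewrite [leRHS]EFinM lee_wpmul2l ?lee_fin ?invr_ge0 ?(ltW pi0)//.
by rewrite [leRHS]EFinM lee_wpmul2l// lee_fin sqr_ge0.
Qed.

End square_integrable.

(** * Gaussian moments of the modulus *)

Section power_moments.
Context {R : realType}.
Notation mu := (@gaussian R).
Notation dA := (@dA R).
Notation origin := ((0, 0) : R * R).

(** Since [x^n <= n! e^x], half of the exponent of the density absorbs the power. *)
Lemma gaussian_moment k : (\int[mu]_p (sqnorm p ^+ k.+1)%:E < +oo)%E.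
Proof.
have pi0 : (0 : R) < pi := pi_gt0 R.
have ms : measurable_fun [set: R * R] (fun p : R * R => sqnorm p).
  by apply: measurable_funD; apply: measurable_funX.
have h0 : (0 : R) < 2^-1 by [].
have [D D0 hD] := @gaussian_kernel_integral R _ h0.
pose K : R := pi^-1 * (2 ^+ k.+1 * k.+1`!%:R).
have K0 : 0 <= K by rewrite mulr_ge0 ?invr_ge0 ?(ltW pi0)// mulr_ge0.
rewrite (gaussian_integral (f := fun p => (sqnorm p ^+ k.+1)%:E)); first last.
- by apply/measurable_EFinP; exact: measurable_funX.
- by move=> p; rewrite lee_fin exprn_ge0// sqnorm_ge0.
apply: (@le_lt_trans _ _ (K%:E * D%:E)%E); last by rewrite -EFinM ltry.
rewrite -(hD origin) -ge0_integralZl//; last first.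
  apply/measurable_EFinP; apply: measurableT_comp => //; apply: measurable_funM => //.
  by apply: measurableT_comp => //; exact: sqdist_measurable2.
apply: ge0_le_integral => //.
- by move=> p _; rewrite -EFinM lee_fin mulr_ge0 ?gauss_density_ge0// exprn_ge0// sqnorm_ge0.
- apply: emeasurable_funM; last exact: density_measurable.
  by apply/measurable_EFinP; exact: measurable_funX.
- apply: emeasurable_funM => //.
  apply/measurable_EFinP; apply: measurableT_comp => //; apply: measurable_funM => //.
  by apply: measurableT_comp => //; exact: sqdist_measurable2.
move=> p _; rewrite -!EFinM lee_fin densityE.
have -> : sqdist origin p = sqnorm p by rewrite /sqdist /sqnorm /= !sub0r !sqrrN.
set s := sqnorm p; have s0 : 0 <= s := sqnorm_ge0 p.
have -> : - s / (4 * 2^-1) = - (s / 2) by field.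
have -> : - s = - (s / 2) + - (s / 2) by field.
rewrite expRD /K.
have h : s ^+ k.+1 * expR (- (s / 2)) <= 2 ^+ k.+1 * k.+1`!%:R.
  rewrite expRN ler_pdivrMr ?expR_gt0//.
  have := @expR_ge1Dxn R (s / 2) k; rewrite divr_ge0// => /(_ isT) e1.
  have f0 : (0 : R) < 2 ^+ k.+1 * k.+1`!%:R by rewrite mulr_gt0 ?exprn_gt0// ltr0n fact_gt0.
  rewrite -ler_pdivrMl//; apply: le_trans e1; apply: ler_wpDl => //.
  by rewrite expr_div_n invfM; rewrite le_eqVlt; apply/orP; left; apply/eqP; ring.
have e0 : 0 <= pi^-1 * expR (- (s / 2)) by rewrite mulr_ge0 ?invr_ge0 ?(ltW pi0) ?expR_ge0.
have := ler_wpM2l e0 h; set A := expR _; set B := s ^+ _; set D' := 2 ^+ _ * _.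
congr (_ <= _).
  by rewrite mulrCA -!mulrA.
by rewrite mulrAC.
Qed.

Lemma power_moment_finite (b : R) : 0 <= b ->
  (\int[mu]_p (modC (toC p) `^ b)%:E < +oo)%E.
Proof.
move=> b0; set k := Num.bound b.
have bk : b <= 2 * k.+1%:R.
  have := archi_boundP b0; rewrite -/k => /ltW/le_trans; apply.
  by rewrite -natrM ler_nat (leq_trans (leqnSn k))// leq_pmull.
have ms : measurable_fun [set: R * R] (fun p : R * R => sqnorm p ^+ k.+1).
  by apply: measurable_funX; apply: measurable_funD; apply: measurable_funX.
apply: (@le_lt_trans _ _ (\int[mu]_p (1%:E + (sqnorm p ^+ k.+1)%:E))%E); last first.
  rewrite ge0_integralD//; first last.
  - exact/measurable_EFinP.
  - by move=> p _; rewrite lee_fin exprn_ge0// sqnorm_ge0.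
  rewrite lte_add_pinfty ?gaussian_moment// integral_cst//= [X in (_ * X)%E]gaussian_setT.
  by rewrite mule1 ltry.
apply: ge0_le_integral => //.
- by move=> p _; rewrite lee_fin powR_ge0.
- by apply/measurable_EFinP; exact: power_measurable.
- by apply: emeasurable_funD => //; exact/measurable_EFinP.
move=> p _; rewrite -EFinD lee_fin sqnormE -exprM.
have [p1|/ltW p1] := leP (modC (toC p)) 1.
  apply: ler_wpDr; first by rewrite exprn_ge0// modC_ge0.
  apply: (@le_trans _ _ (1 `^ b)); last by rewrite powR1.
  apply: ge0_ler_powR => //; rewrite nnegrE ?modC_ge0//.
apply: ler_wpDl => //; rewrite -powR_mulrn ?modC_ge0//; apply: ler_powR => //.
by rewrite natrM.
Qed.

(** Multiplying by [|p|^a] eventually increases the moments of order [b] by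
    more than any given factor [c].  With [r^a = 2c], the part of the moment
    lying in [|p| <= r] is at most [r^b], whereas the whole moment is at least a
    constant times [(2r)^b]. *)
Lemma power_moment_growth (a c : R) : 0 < a -> 0 < c -> exists N : nat,
  forall b : R, N%:R <= b -> (c%:E * \int[mu]_p (modC (toC p) `^ b)%:E <
    \int[mu]_p (modC (toC p) `^ (b + a))%:E)%E.
Proof.
move=> a0 c0; have pi0 : (0 : R) < pi := pi_gt0 R.
pose r := (2 * c) `^ a^-1; have r0 : 0 < r by rewrite powR_gt0// mulr_gt0.
have rE : r `^ a = 2 * c.
  by rewrite /r -powRrM mulVf ?gt_eqF// powRr1// ltW// mulr_gt0.
pose S : set (R * R) := `[2 * r, 2 * r + 1] `*` `[0, 1].
have mS : measurable S by apply: measurableX.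
pose kappa : R := pi^-1 * expR (- ((2 * r + 1) ^+ 2 + 1)).
have k0 : 0 < kappa by rewrite mulr_gt0 ?invr_gt0 ?expR_gt0.
have muS : (kappa%:E <= mu S)%E.
  rewrite /gaussian.
  apply: (@le_trans _ _ (\int[dA]_(p in S) kappa%:E)%E).
    have -> : (\int[dA]_(p in S) kappa%:E = kappa%:E * dA S)%E by exact: integral_cst.
    by rewrite rectangle_measure ?ltrDl// subr0 addrAC subrr add0r mulr1 mule1.
  apply: ge0_le_integral => //.
  - by move=> p _; rewrite lee_fin ltW.
  - by apply: measurable_funTS; exact: density_measurable.
  move=> [x y] [/=]; rewrite !in_itv/= => /andP[x1 x2] /andP[y1 y2].
  rewrite lee_fin densityE ler_wpM2l ?invr_ge0 ?(ltW pi0)// ler_expR lerN2 /sqnorm/=.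
  by nra.
have [N hN] := pow2_gt (2 / kappa).
exists N => b Nb; have b0 : 0 <= b by apply: le_trans Nb; rewrite ler0n.
have low : ((kappa * (2 * r) `^ b)%:E <= \int[mu]_p (modC (toC p) `^ b)%:E)%E.
  apply: (@le_trans _ _ (\int[mu]_(p in S) ((2 * r) `^ b)%:E)%E).
    rewrite integral_cst//= mulrC EFinM lee_wpmul2l// lee_fin powR_ge0//.
  apply: (@le_trans _ _ (\int[mu]_(p in S) (modC (toC p) `^ b)%:E)%E).
    apply: ge0_le_integral => //.
    - by move=> p _; rewrite lee_fin powR_ge0.
    - by apply: measurable_funTS; apply/measurable_EFinP; exact: power_measurable.
    move=> [x y] [/=]; rewrite !in_itv/= => /andP[x1 x2] _; rewrite lee_fin.
    apply: ge0_ler_powR => //; rewrite ?nnegrE ?modC_ge0 ?mulr_ge0 ?(ltW r0)//.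
    apply: le_trans (normr_Re_le _); rewrite /=; apply: le_trans (ler_norm _).
    exact: x1.
  apply: ge0_subset_integral => //.
  - by apply/measurable_EFinP; exact: power_measurable.
  - by move=> p _; rewrite lee_fin powR_ge0.
have up : ((2 * c)%:E * \int[mu]_p (modC (toC p) `^ b)%:E <=
    \int[mu]_p (modC (toC p) `^ (b + a))%:E + (2 * c * r `^ b)%:E)%E.
  have rp : 0 <= 2 * c * r `^ b by rewrite mulr_ge0 ?powR_ge0// mulr_ge0// ltW.
  have -> : ((2 * c * r `^ b)%:E = \int[mu]_p (2 * c * r `^ b)%:E)%E.
    rewrite (integral_cst mu measurableT)/= [X in (_ * X)%E]gaussian_setT.
    by rewrite mule1.
  rewrite -ge0_integralD//; first last.
  - by apply/measurable_EFinP; exact: power_measurable.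
  - by move=> p _; rewrite lee_fin powR_ge0.
  rewrite -ge0_integralZl//; first last.
  - by rewrite lee_fin mulr_ge0// ltW.
  - by move=> p _; rewrite lee_fin powR_ge0.
  - by apply/measurable_EFinP; exact: power_measurable.
  apply: ge0_le_integral => //.
  - by move=> p _; rewrite -EFinM lee_fin mulr_ge0 ?powR_ge0// mulr_ge0// ltW.
  - by apply: emeasurable_funM => //; apply/measurable_EFinP; exact: power_measurable.
  - by apply: emeasurable_funD => //; apply/measurable_EFinP; exact: power_measurable.
  move=> p _; rewrite -EFinM -EFinD lee_fin /=.
  have c2 : 0 <= 2 * c by rewrite mulr_ge0// ltW.
  have [pr|/ltW pr] := leP (modC (toC p)) r.
    apply: ler_wpDl; first exact: powR_ge0.
    apply: ler_wpM2l => //; apply: ge0_ler_powR => //; rewrite nnegrE ?modC_ge0// ltW//.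
  apply: ler_wpDr => //.
  have p0 : 0 < modC (toC p) by exact: lt_le_trans pr.
  rewrite powRD; last by rewrite (gt_eqF p0) implybT.
  rewrite mulrC ler_wpM2l ?powR_ge0// -rE; apply: ge0_ler_powR => //.
  - exact: ltW.
  - by rewrite nnegrE ltW.
  - by rewrite nnegrE modC_ge0.
have fin (d : R) : 0 <= d -> (\int[mu]_p (modC (toC p) `^ d)%:E)%E \is a fin_num.
  move=> d0; rewrite ge0_fin_numE ?power_moment_finite//.
  by apply: integral_ge0 => p _; rewrite lee_fin powR_ge0.
have ba : 0 <= b + a by rewrite addr_ge0// ltW.
move: up low; rewrite -(fineK (fin _ b0)) -(fineK (fin _ ba)).
set x := fine _; set y := fine _; rewrite -!EFinM -EFinD !lee_fin lte_fin => up low.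
have two : 2 / kappa < 2 `^ b.
  apply: lt_le_trans hN _; rewrite -powR_mulrn//; apply: ler_powR => //.
  by rewrite ler1n.
have rb : 0 < r `^ b by rewrite powR_gt0.
have h1 : 2 < kappa * 2 `^ b by rewrite -ltr_pdivrMl// mulrC.
have h2 : 2 * r `^ b < x.
  apply: lt_le_trans low; rewrite powRM ?(ltW r0)// mulrA.
  by rewrite ltr_pM2r.
have h3 : c * (2 * r `^ b) < c * x by rewrite ltr_pM2l.
move: up h3; rewrite -!mulrA [c * (2 * _)]mulrCA.
by move: (c * x) (c * _) => A B; lra.
Qed.

End power_moments.

(** * The form-defined operator *)

Section toeplitz.
Context {R : realType}.
Notation mu := (@gaussian R).
Notation C := R[i].
Notation origin := ((0, 0) : R * R).

Lemma power_symbol_ge0 (alpha : R) z : 0 <= power_symbol alpha z.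
Proof. exact: powR_ge0. Qed.

Lemma modC_sqrt_mul (r : R) (w : C) : 0 <= r ->
  modC ((Num.sqrt `|r|)%:C * w) ^+ 2 = r * modC w ^+ 2.
Proof.
move=> r0; rewrite modCM modC_real exprMn (ger0_norm (sqrtr_ge0 _)).
by rewrite sqr_sqrtr ?normr_ge0// ger0_norm.
Qed.

Lemma measurableC_sqrt_symbol (alpha : R) (f : C -> C) : Defs.measurableC f ->
  Defs.measurableC (fun z => (Num.sqrt `|power_symbol alpha z|)%:C * f z).
Proof.
move=> mf; apply: measurableC_mul => //.
apply: (@measurableC_real R (fun z => Num.sqrt `|power_symbol alpha z|)).
apply: (@measurableT_comp _ _ _ _ _ _ (@Num.sqrt R)).
  by apply: continuous_measurable_fun; exact: sqrt_continuous.
by apply: measurableT_comp => //; exact: power_measurable.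
Qed.

Lemma measurableC_symbol (alpha : R) (f : C -> C) : Defs.measurableC f ->
  Defs.measurableC (fun z => (power_symbol alpha z)%:C * f z).
Proof.
move=> mf; apply: measurableC_mul => //.
by apply: measurableC_real; exact: power_measurable.
Qed.

Lemma normL2_diag (f : C -> C) : normL2 (fun z => f z - f z) = 0.
Proof.
rewrite /normL2 /Rintegral.
under eq_integral do rewrite subrr modC0 expr0n/=.
by rewrite integral0/= sqrtr0.
Qed.

Lemma F2_exp n : (0 < n)%N -> F2 (fun z : C => z ^+ n).
Proof.
move=> n0; split; first exact: entireX.
split; first exact: measurableC_exp.
have := @power_moment_finite R (2 * n)%:R (ler0n _ _).
congr (_ < _)%E; apply: eq_integral => p _.
by rewrite powR_mulrn ?modC_ge0// modCX -exprM mulnC.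
Qed.

Lemma form_dom_all (alpha : R) (f : C -> C) : -2 < alpha <= 0 -> F2 f ->
  form_dom (power_symbol alpha) f.
Proof.
move=> ha Ff; split => //; have [_ [mf _]] := Ff.
split; first exact: measurableC_sqrt_symbol.
have [K K0 /(_ f Ff)] := weighted_norm_bound ha.
move=> /le_lt_trans/(_ (ltry _)); congr (_ < _)%E; apply: eq_integral => p _.
by rewrite modC_sqrt_mul ?power_symbol_ge0.
Qed.

Lemma T_bounded_small (alpha : R) : -2 < alpha <= 0 -> T_bounded (power_symbol alpha).
Proof.
move=> ha; split.
  move=> f Ff e e0; exists f; first exact: form_dom_all.
  by rewrite normL2_diag.
have [K K0 hK] := weighted_norm_bound ha.
exists (2 * K ^+ 2 + 1); first by rewrite ltr_wpDl// mulr_ge0// sqr_ge0.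
move=> f h [Ff _] [Fh _].
have [_ [mf _]] := Ff; have [_ [mh _]] := Fh.
set A := normL2 f; set B := normL2 h.
have A0 : 0 <= A := normL2_ge0 f; have B0 : 0 <= B := normL2_ge0 h.
apply: (@le_trans _ _ (2 * (K * A * (K * B)))); last first.
  rewrite (_ : 2 * _ = 2 * K ^+ 2 * A * B); last by ring.
  rewrite -!mulrA; have := mulr_ge0 A0 B0; move: (A * B) => D D0.
  by rewrite [leRHS]mulrDl mul1r; rewrite -mulrA; lra.
apply: modC_integralC_le.
  apply: measurableC_mul; last exact: measurableC_conj.
  exact: measurableC_symbol.
pose a (k : C -> C) p := modC ((Num.sqrt `|power_symbol alpha (toC p)|)%:C * k (toC p)).
have ma k : Defs.measurableC k -> measurable_fun setT (a k).
  by move=> mk; exact: (measurable_modC (measurableC_sqrt_symbol alpha mk)).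
have ha2 k : F2 k -> (\int[mu]_p (a k p ^+ 2)%:E <= ((K * normL2 k) ^+ 2)%:E)%E.
  move=> /hK; congr (_ <= _)%E; apply: eq_integral => p _.
  by rewrite /a modC_sqrt_mul ?power_symbol_ge0.
have -> : (\int[mu]_p (modC ((power_symbol alpha (toC p))%:C * f (toC p) *
    conjc (h (toC p))))%:E = \int[mu]_p (a f p * a h p)%:E)%E.
  apply: eq_integral => p _; congr EFin.
  rewrite /a !modCM !modC_real modC_conj mulrACA -normrM -expr2 sqr_sqrtr ?normr_ge0//.
  by rewrite normr_id mulrA.
apply: cauchy_schwarz.
- exact: ma.
- exact: ma.
- by move=> p; exact: modC_ge0.
- by move=> p; exact: modC_ge0.
- exact: mulr_ge0.
- exact: mulr_ge0.
- exact: ha2.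
- exact: ha2.
Qed.

(** The quotients of the form by the squared norm are unbounded on the monomials
    [z^n]. *)
Lemma T_unbounded_pos (alpha : R) : 0 < alpha -> ~ T_bounded (power_symbol alpha).
Proof.
move=> a0 [_ [c c0 hc]].
have [N hN] := power_moment_growth a0 c0.
pose n := N.+1; pose f : C -> C := fun z => z ^+ n.
have Ff : F2 f by exact: F2_exp.
have n2 : N%:R <= (2 * n)%:R :> R.
  by rewrite ler_nat /n (leq_trans (leqnSn N))// leq_pmull.
have n20 : (0 : R) < (2 * n)%:R by rewrite ltr0n.
have E p : power_symbol alpha (toC p) * modC (f (toC p)) ^+ 2 =
    modC (toC p) `^ ((2 * n)%:R + alpha).
  rewrite powRD ?(gt_eqF (addr_gt0 n20 a0))// /f modCX -exprM mulnC.
  by rewrite powR_mulrn ?modC_ge0// mulrC.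
have Df : form_dom (power_symbol alpha) f.
  split => //; have [_ [mf _]] := Ff.
  split; first exact: measurableC_sqrt_symbol.
  have := @power_moment_finite R ((2 * n)%:R + alpha) (ltW (addr_gt0 n20 a0)).
  congr (_ < _)%E; apply: eq_integral => p _.
  by rewrite modC_sqrt_mul ?power_symbol_ge0// E.
have := hN _ n2; rewrite ltNge => /negP; apply.
have := hc _ _ Df Df; rewrite -mulrA -expr2 => h.
have -> : (\int[mu]_p (modC (toC p) `^ ((2 * n)%:R))%:E = (normL2 f ^+ 2)%:E)%E.
  rewrite sqr_normL2; last by case: Ff.
  by apply: eq_integral => p _; rewrite powR_mulrn ?modC_ge0// modCX -exprM mulnC.
rewrite -EFinM; apply: le_trans (_ : (modC (toeplitz_form (power_symbol alpha) f f))%:E <= _)%E;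
  last by rewrite lee_fin.
have -> : (\int[mu]_p (modC (toC p) `^ ((2 * n)%:R + alpha))%:E =
    (Re (toeplitz_form (power_symbol alpha) f f))%:E)%E.
  rewrite /= /Rintegral.
  have -> : (\int[mu]_p (Re ((power_symbol alpha (toC p))%:C * f (toC p) *
    conjc (f (toC p))))%:E = \int[mu]_p (modC (toC p) `^ ((2 * n)%:R + alpha))%:E)%E.
    apply: eq_integral => p _; rewrite -E sqr_modC; case: (f _) => [x y].
    by congr EFin; rewrite /=; ring.
  rewrite fineK// ge0_fin_numE ?power_moment_finite ?(ltW (addr_gt0 n20 a0))//.
  by apply: integral_ge0 => p _; rewrite lee_fin powR_ge0.
by rewrite lee_fin; apply: le_trans (normr_Re_le _); exact: ler_norm.
Qed.

(** If [h 0 <> 0], continuity bounds [|h|] below near 0, and [|z|^alpha |h|^2] is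
    not integrable there. *)
Lemma form_dom_vanish (alpha : R) (h : C -> C) : alpha <= -2 ->
  form_dom (power_symbol alpha) h -> h 0 = 0.
Proof.
move=> a2 [[eh [mh _]] [_ hfin]]; have pi0 : (0 : R) < pi := pi_gt0 R.
apply/eqP/negPn/negP => h0.
have CR := entire_cauchy_riemann eh.
have cu := cauchy_riemann_continuous CR.
have cv := cauchy_riemann_continuous (cauchy_riemann_rot CR).
set u := (fun p => Re (h (toC p))) in CR cu.
set v := (fun p => Im (h (toC p))) in CR cv.
pose w p := u p ^+ 2 + v p ^+ 2.
have wE p : w p = modC (h (toC p)) ^+ 2 by rewrite sqr_modC.
pose d := w origin / 2.
have w0 : 0 < w origin.
  by rewrite wE exprn_gt0// lt_neqAle modC_ge0 andbT eq_sym modC_eq0.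
have d0 : 0 < d by rewrite divr_gt0.
have cw : continuous w.
  by apply: continuous_add; exact: continuous_pow.
have [r r0 hr] : exists2 r : R, 0 < r <= 1 & forall p, modC (toC p) <= r -> d <= w p.
  have : \forall p \near origin, d <= w p.
    have /cvgrPdist_lt/(_ d d0) := cw origin; apply: filterS => p.
    by rewrite ltr_norml => /andP[_]; rewrite /d; lra.
  move=> /nbhs_ballP[/= e e0 he].
  exists (Num.min 1 (e / 2)); first by rewrite lt_min ltr01 divr_gt0// ge_min lexx.
  move=> p pr; apply: he; have := normr_Re_le (toC p); have := normr_Im_le (toC p).
  move: pr; rewrite le_min => /andP[_ pr] i1 i2.
  split => /=; rewrite /ball/= sub0r normrN.
    by apply: le_lt_trans i2 _; apply: le_lt_trans pr _; lra.
  by apply: le_lt_trans i1 _; apply: le_lt_trans pr _; lra.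
have := power_not_integrable a2 r0; set B := [set p | _] => hB.
have r1 : 0 < r by case/andP: r0.
pose k : R := d * (pi^-1 * expR (-1)).
have k0 : 0 < k by rewrite !mulr_gt0 ?invr_gt0 ?expR_gt0.
have mB : measurable_fun [set: R * R] (fun p => (\1_B p * modC (toC p) `^ alpha)%:E).
  apply/measurable_EFinP; apply: measurable_funM; last exact: power_measurable.
  by apply: measurable_indic; exact: ball_measurable.
move: hfin; rewrite ltNge => /negP; apply.
have mm : measurable_fun [set: R * R] (fun p =>
    (modC ((Num.sqrt `|power_symbol alpha (toC p)|)%:C * h (toC p)) ^+ 2)%:E).
  apply/measurable_EFinP; apply: measurable_funX.
  exact: (measurable_modC (measurableC_sqrt_symbol alpha mh)).
rewrite (gaussian_integral _ mm); last by move=> p; rewrite lee_fin sqr_ge0.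
rewrite -(@gt0_muley _ k%:E) ?lte_fin// -hB -ge0_integralZl//; first last.
- by rewrite lee_fin ltW.
- by move=> p _; rewrite lee_fin mulr_ge0 ?powR_ge0.
apply: ge0_le_integral => //.
- by move=> p _; rewrite -EFinM lee_fin mulr_ge0 ?(ltW k0)// mulr_ge0 ?powR_ge0.
- exact: emeasurable_funM.
- by apply: emeasurable_funM => //; exact: density_measurable.
move=> p _; rewrite -!EFinM lee_fin.
have [pB|pB] := pselect (B p); last first.
  by rewrite indicE memNset// mul0r mulr0 mulr_ge0 ?sqr_ge0 ?gauss_density_ge0.
rewrite indicE mem_set// mul1r modC_sqrt_mul ?power_symbol_ge0//.
rewrite [leLHS]mulrC -[leRHS]mulrA ler_wpM2l ?powR_ge0// /k -wE.
apply: ler_pM.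
- exact: ltW.
- by rewrite mulr_ge0 ?expR_ge0// invr_ge0 ltW.
- exact: hr.
rewrite densityE ler_wpM2l ?invr_ge0 ?(ltW pi0)// ler_expR lerN2 sqnormE.
rewrite expr_le1 ?modC_ge0//; apply: le_trans pB _; by case/andP: r0.
Qed.

(** Functions in the form domain vanish at 0, so the constant 1 is not in the
    closure of the domain. *)
Lemma T_unbounded_singular (alpha : R) : alpha <= -2 -> ~ T_bounded (power_symbol alpha).
Proof.
move=> a2 [dense _].
have [A A0 hA] := @entire_pointwise_bound R.
have e0 : 0 < (A + 1)^-1 by rewrite invr_gt0 ltr_wpDl.
have [h Dh hh] := dense _ (F2_cst 1) _ e0.
have Fk : F2 (fun z => 1%:C - h z) by apply: F2_sub; [exact: F2_cst|case: Dh].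
have := hA _ 0 0 Fk; rewrite normr0 ler01 => /(_ isT isT).
have -> : toC (0, 0) = 0 :> C by [].
rewrite (form_dom_vanish a2 Dh) subr0 modC_real normr1 => le1.
have : A * normL2 (fun z => 1%:C - h z) < 1.
  apply: (@le_lt_trans _ _ (A * (A + 1)^-1)); first by rewrite ler_wpM2l// ltW.
  by rewrite ltr_pdivrMr ?mul1r ?ltrDl// ltr_wpDl.
by move=> /(le_lt_trans le1); rewrite ltxx.
Qed.

Theorem T_bounded_power (alpha : R) : T_bounded (power_symbol alpha) <-> -2 < alpha <= 0.
Proof.
split=> [T|]; last exact: T_bounded_small.
apply/andP; split.
  by rewrite ltNge; apply/negP => /T_unbounded_singular; exact.
by rewrite leNgt; apply/negP => /T_unbounded_pos; exact.
Qed.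

End toeplitz.

(** * The natural-domain operator *)

Section projection.
Context {R : realType}.
Notation mu := (@gaussian R).
Notation C := R[i].

(** The real part of the inner product. *)
Definition pairing (f k : C -> C) : R :=
  \int[mu]_p Re (f (toC p) * conjc (k (toC p))).

Lemma integral_modC_mul_le (f k : C -> C) : L2 f -> L2 k ->
  (\int[mu]_p (modC (f (toC p)) * modC (k (toC p)))%:E <= (normL2 f * normL2 k)%:E)%E.
Proof.
move=> Lf Lk; have [mf _] := Lf; have [mk _] := Lk; apply: cauchy_schwarz.
- exact: (measurable_modC mf).
- exact: (measurable_modC mk).
- by move=> p; exact: modC_ge0.
- by move=> p; exact: modC_ge0.
- exact: normL2_ge0.
- exact: normL2_ge0.
- by rewrite sqr_normL2.
- by rewrite sqr_normL2.
Qed.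

Lemma pairing_measurable (f k : C -> C) : Defs.measurableC f -> Defs.measurableC k ->
  measurable_fun [set: R * R] (fun p => Re (f (toC p) * conjc (k (toC p)))).
Proof.
by move=> mf mk; have [] := measurableC_mul mf (measurableC_conj mk).
Qed.

Lemma normr_pairing_le (f k : C -> C) p :
  `|Re (f (toC p) * conjc (k (toC p)))| <= modC (f (toC p)) * modC (k (toC p)).
Proof. by apply: (le_trans (normr_Re_le _)); rewrite modCM modC_conj. Qed.

Lemma pairing_integrable (f k : C -> C) : L2 f -> L2 k ->
  mu.-integrable setT (EFin \o (fun p : R * R => Re (f (toC p) * conjc (k (toC p))))).
Proof.
move=> Lf Lk; have [mf _] := Lf; have [mk _] := Lk.
apply/integrableP; split.
  by apply/measurable_EFinP; exact: pairing_measurable.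
apply: le_lt_trans (ltry (normL2 f * normL2 k)).
apply: le_trans (integral_modC_mul_le Lf Lk); apply: ge0_le_integral => //.
- apply/measurable_EFinP; apply: measurableT_comp => //; exact: pairing_measurable.
- apply/measurable_EFinP; apply: measurable_funM.
    exact: (measurable_modC mf).
  exact: (measurable_modC mk).
by move=> p _; rewrite lee_fin normr_pairing_le.
Qed.

Lemma pairing_le_integral (f k : C -> C) (B : R) : L2 f -> L2 k ->
  (\int[mu]_p (modC (f (toC p)) * modC (k (toC p)))%:E <= B%:E)%E -> pairing f k <= B.
Proof.
move=> Lf Lk hB; have [mf _] := Lf; have [mk _] := Lk.
apply: le_trans (ler_norm _) _; apply: normr_Rintegral_le.
  exact: pairing_measurable.
apply: le_trans hB; apply: ge0_le_integral => //.
- apply/measurable_EFinP; apply: measurableT_comp => //; exact: pairing_measurable.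
- apply/measurable_EFinP; apply: measurable_funM.
    exact: (measurable_modC mf).
  exact: (measurable_modC mk).
by move=> p _; rewrite lee_fin normr_pairing_le.
Qed.

Lemma pairing_le (f k : C -> C) : L2 f -> L2 k -> pairing f k <= normL2 f * normL2 k.
Proof.
by move=> Lf Lk; apply: pairing_le_integral => //; exact: integral_modC_mul_le.
Qed.

Lemma pairing_diag (h : C -> C) : L2 h -> pairing h h = normL2 h ^+ 2.
Proof.
move=> Lh; rewrite /pairing /Rintegral.
have -> : (\int[mu]_p (Re (h (toC p) * conjc (h (toC p))))%:E = (normL2 h ^+ 2)%:E)%E.
  rewrite sqr_normL2//; apply: eq_integral => p _; rewrite sqr_modC.
  by case: (h _) => [x y]; congr EFin; rewrite /=; ring.
by [].
Qed.

Lemma pairing_orthogonal (phi h k : C -> C) : L2 phi -> L2 h -> L2 k ->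
  innerL2 (fun z => phi z - h z) k = 0 -> pairing phi k = pairing h k.
Proof.
move=> Lp Lh Lk /(congr1 (@Re R))/=.
have -> : (\int[mu]_p Re ((phi (toC p) - h (toC p)) * conjc (k (toC p))) =
    \int[mu]_p (Re (phi (toC p) * conjc (k (toC p))) - Re (h (toC p) * conjc (k (toC p)))))%R.
  by apply: eq_Rintegral => p _; rewrite mulrBl; case: (_ * _) (_ * _) => [a b] [c d].
rewrite RintegralB//; try exact: pairing_integrable.
by move/eqP; rewrite subr_eq0 => /eqP.
Qed.

Lemma bargmann_projP (phi h : C -> C) : F2 h ->
  (forall k, F2 k -> innerL2 (fun z => phi z - h z) k = 0) ->
  F2 (bargmann_proj phi) /\
  forall k, F2 k -> innerL2 (fun z => phi z - bargmann_proj phi z) k = 0.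
Proof.
by move=> Fh ho; rewrite /bargmann_proj; case: xgetP => [//|/(_ h)[]].
Qed.

Lemma sqr_powR (x a : R) : (x `^ a) ^+ 2 = x `^ (2 * a).
Proof. by rewrite mulrC powRrM powR_mulrn// powR_ge0. Qed.

(** If [h] is the projection of [g f], then [|h|^2 = <g f, h>], which equals
    [<f, g h>] and is at most [|f| |g h|]; and [|g h| <= K |h|] by
    [weighted_norm_bound] for the exponent [2 alpha]. *)
Lemma U_bounded_small (alpha : R) : -1 < alpha <= 0 -> U_bounded (power_symbol alpha).
Proof.
move=> ha.
have hb : -2 < 2 * alpha <= 0 by case/andP: ha => ? ?; apply/andP; split; lra.
have [K K0 hK] := weighted_norm_bound hb.
exists (K + 1); first by rewrite ltr_wpDl.
move=> f [Lf Lphi]; rewrite /U_op; set phi := (fun z => _) in Lphi *.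
rewrite /bargmann_proj; case: xgetP => [h _ [Fh ho]|_]; last first.
  have -> : normL2 (fun=> 0 : C) = 0.
    by rewrite -(normL2_diag (fun=> 0)); congr normL2; apply/funext => z; rewrite subrr.
  by rewrite mulr_ge0 ?normL2_ge0// addr_ge0.
have [_ Lh] := Fh; have [mf _] := Lf; have [mh _] := Lh.
set A := normL2 f; set B := normL2 h.
have A0 : 0 <= A := normL2_ge0 f; have B0 : 0 <= B := normL2_ge0 h.
have hAB : B ^+ 2 <= A * (K * B).
  rewrite /B -pairing_diag// -(pairing_orthogonal Lphi Lh Lh (ho h Fh)).
  apply: pairing_le_integral => //.
  (* The real symbol moves to the second factor. *)
  pose gh p := power_symbol alpha (toC p) * modC (h (toC p)).
  have -> : (\int[mu]_p (modC (phi (toC p)) * modC (h (toC p)))%:E =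
      \int[mu]_p (modC (f (toC p)) * gh p)%:E)%E.
    apply: eq_integral => p _; congr EFin; rewrite /phi modCM modC_real.
    by rewrite ger0_norm ?power_symbol_ge0// /gh mulrCA mulrA.
  apply: cauchy_schwarz.
  - exact: (measurable_modC mf).
  - by apply: measurable_funM; [exact: power_measurable|exact: (measurable_modC mh)].
  - by move=> p; exact: modC_ge0.
  - by move=> p; rewrite mulr_ge0 ?power_symbol_ge0 ?modC_ge0.
  - by [].
  - exact: mulr_ge0.
  - by rewrite sqr_normL2.
  - have := hK _ Fh; congr (_ <= _)%E; apply: eq_integral => p _.
    by rewrite /gh exprMn sqr_powR.
have [B1|B1] := eqVneq B 0; first by rewrite B1 mulr_ge0// addr_ge0.
have B2 : 0 < B by rewrite lt_neqAle eq_sym B1.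
have : B * B <= K * A * B by rewrite -expr2 (le_trans hAB)// mulrCA mulrA.
rewrite ler_pM2r// => /le_trans; apply; by rewrite mulrDl mul1r lerDl.
Qed.

(** For [f = |z|^(-alpha) z^n] the product [g f = z^n] lies in the Bargmann
    space and is its own projection; the norm of [z^n] is not bounded by that of
    [f] as [n] grows. *)
Lemma U_unbounded_pos (alpha : R) : 0 < alpha -> ~ U_bounded (power_symbol alpha).
Proof.
move=> a0 [c c0 hc].
have [N hN] := power_moment_growth (mulr_gt0 (ltr0Sn R 1) a0) (exprn_gt0 2 c0).
pose n := (Num.bound (N%:R + 2 * alpha)).+1.
have Nn : N%:R + 2 * alpha < n%:R :> R.
  have N0 : (0 : R) <= N%:R + 2 * alpha by rewrite addr_ge0// mulr_ge0// ltW.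
  by apply: lt_le_trans (archi_boundP N0) _; rewrite ler_nat leqnSn.
have N0 : (0 : R) <= N%:R := ler0n _ _.
pose psi : C -> C := fun z => z ^+ n.
have Fpsi : F2 psi by exact: F2_exp.
pose f : C -> C := fun z => (power_symbol (- alpha) z)%:C * psi z.
have na : 0 < n%:R - alpha by lra.
have mf : Defs.measurableC f by apply: measurableC_symbol; case: Fpsi => _ [].
have fE p : modC (f (toC p)) ^+ 2 = modC (toC p) `^ (2 * (n%:R - alpha)).
  rewrite -sqr_powR addrC powRD; last by rewrite addrC gt_eqF.
  rewrite /f modCM modC_real ger0_norm ?power_symbol_ge0// modCX.
  by rewrite powR_mulrn ?modC_ge0.
have Lf : L2 f.
  split => //; under eq_integral do rewrite fE.
  by apply: power_moment_finite; rewrite mulr_ge0// ltW.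
have gf : (fun z => (power_symbol alpha z)%:C * f z) = psi.
  apply/funext => z; rewrite /f mulrA -rmorphM/=.
  have [->|z0] := eqVneq z 0; first by rewrite /psi expr0n/= mulr0.
  rewrite /power_symbol -powRD; last by rewrite modC_eq0 z0 implybT.
  by rewrite subrr powRr0 mul1r.
have Df : mult_dom (power_symbol alpha) f by split => //; rewrite gf; case: Fpsi.
have [_ Lpsi] := Fpsi.
(* An element of the Bargmann space satisfies the characterization of its own
   projection. *)
have := hc _ Df; rewrite /U_op gf.
have [|[_ Lh] ho] := @bargmann_projP psi psi Fpsi.
  move=> k _; rewrite /innerL2 /integralC.
  rewrite /Rintegral; under eq_integral do rewrite subrr mul0r/=.
  under [X in _ +i* fine X]eq_integral do rewrite subrr mul0r/=.
  by rewrite !integral0.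
set h := bargmann_proj psi in Lh ho *; move=> hle.
have P1 : normL2 psi ^+ 2 <= normL2 h * normL2 psi.
  by rewrite -pairing_diag// (pairing_orthogonal Lpsi Lh Lpsi (ho _ Fpsi)) pairing_le.
have := hN (2 * (n%:R - alpha)).
have -> : 2 * (n%:R - alpha) + 2 * alpha = (2 * n)%:R by rewrite natrM; ring.
have -> : (\int[mu]_p (modC (toC p) `^ ((2 * n)%:R))%:E = (normL2 psi ^+ 2)%:E)%E.
  rewrite sqr_normL2//.
  by apply: eq_integral => p _; rewrite powR_mulrn ?modC_ge0// modCX -exprM mulnC.
have -> : (\int[mu]_p (modC (toC p) `^ (2 * (n%:R - alpha)))%:E = (normL2 f ^+ 2)%:E)%E.
  by rewrite sqr_normL2//; apply: eq_integral => p _; rewrite fE.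
have nN : N%:R <= 2 * (n%:R - alpha) by lra.
move=> /(_ nN); rewrite -EFinM lte_fin -exprMn ltNge => /negP; apply.
rewrite lerXn2r ?nnegrE ?normL2_ge0 ?mulr_ge0 ?normL2_ge0 ?(ltW c0)//.
apply: le_trans hle.
have [->|q0] := eqVneq (normL2 psi) 0; first exact: normL2_ge0.
have q1 : 0 < normL2 psi by rewrite lt_neqAle eq_sym q0 normL2_ge0.
by rewrite expr2 ler_pM2r in P1.
Qed.

End projection.

(** * The natural-domain operator for exponents at most -1 *)

Section singular_symbol.
Context {R : realType}.
Notation mu := (@gaussian R).
Notation C := R[i].
Notation dA := (@dA R).
Notation origin := ((0, 0) : R * R).
Local Notation cap_mass := (\int[dA]_p (cap 1 origin p ^+ 2)).

Lemma cap_sum_le_size M (p : R * R) : cap_sum 1 M p <= M%:R.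
Proof.
rewrite /cap_sum -[leRHS]mulr1 -[M in leRHS]card_ord mulr_natl -sumr_const.
by apply: ler_sum => k _; rewrite exprn_ile1 ?cap_ge0 ?cap_le1.
Qed.

Lemma cap_sum_integrable M (u v : R * R -> R) : cauchy_riemann u v ->
  dA.-integrable setT (EFin \o (fun p => cap_sum 1 M p * u p)).
Proof.
move=> uv; have cu := cauchy_riemann_continuous uv.
have -> : EFin \o (fun p => cap_sum 1 M p * u p) =
    (fun p => \sum_(k < M) (cap 1 origin p ^+ k.+2 * u p)%:E)%E.
  by apply/funext => p; rewrite sumEFin /cap_sum /= mulr_suml.
by apply: integrable_sum => // k _; exact: cap_integrable.
Qed.

Lemma pair_toC (p : R * R) : (Re (toC p), Im (toC p)) = p.
Proof. by case: p. Qed.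

(** The function [|z|^(-alpha) e^(|z|^2) S(z)], where [S] is the [cap_sum] of
    parameter 1. *)
Definition test_fun (alpha : R) M (z : C) : R :=
  modC z `^ (- alpha) * (expR (modC z ^+ 2) * cap_sum 1 M (Re z, Im z)).

(** The product of the symbol and [test_fun]: [e^(|p|^2) S(p)] except at the
    origin, where it vanishes as the symbol does.  The exponential compensates
    the Gaussian density, which leaves [S] as a weight for [dA]. *)
Definition bump (alpha : R) M p : R :=
  power_symbol alpha (toC p) * test_fun alpha M (toC p).

(** The Gaussian mean of [bump]. *)
Definition bump_mean M : R := pi^-1 * (3 * cap_mass * shifted_harmonic M).

Lemma test_fun_ge0 alpha M z : 0 <= test_fun alpha M z.
Proof. by rewrite !mulr_ge0 ?powR_ge0 ?expR_ge0 ?cap_sum_ge0. Qed.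

Lemma test_funE alpha M p : test_fun alpha M (toC p) =
  modC (toC p) `^ (- alpha) * (expR (sqnorm p) * cap_sum 1 M p).
Proof. by rewrite /test_fun pair_toC sqnormE. Qed.

Lemma test_fun_measurable alpha M :
  measurable_fun [set: R * R] (fun p => test_fun alpha M (toC p)).
Proof.
under eq_fun do rewrite test_funE.
apply: measurable_funM; first exact: power_measurable.
apply: measurable_funM; last exact: cap_sum_measurable.
apply: measurableT_comp => //.
by apply: measurable_funD; apply: measurable_funX.
Qed.

Lemma bump_ge0 alpha M p : 0 <= bump alpha M p.
Proof. by rewrite mulr_ge0 ?power_symbol_ge0 ?test_fun_ge0. Qed.

Lemma bump_measurable alpha M : measurable_fun [set: R * R] (bump alpha M).
Proof. by apply: measurable_funM; [exact: power_measurable|exact: test_fun_measurable]. Qed.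

Lemma bump_off_origin alpha M p : p != origin ->
  bump alpha M p = expR (sqnorm p) * cap_sum 1 M p.
Proof.
move=> p0; rewrite /bump test_funE mulrA /power_symbol -powRD.
  by rewrite subrr powRr0 mul1r.
rewrite modC_eq0; apply/implyP => _; apply: contra p0.
by case: p => x y; rewrite eq_complex /= => /andP[/eqP -> /eqP ->].
Qed.

Lemma bump_le alpha M p : alpha != 0 -> bump alpha M p <= expR 1 * M%:R.
Proof.
move=> a0; have [->|p0] := eqVneq p origin.
  have -> : bump alpha M origin = 0.
    rewrite /bump /power_symbol (_ : toC origin = 0) // modC0 powR0// mul0r//.
  by rewrite mulr_ge0 ?expR_ge0.
rewrite bump_off_origin//.
have [s1|/ltW s1] := leP (sqnorm p) 1.
  by rewrite ler_pM ?expR_ge0 ?cap_sum_ge0 ?ler_expR// cap_sum_le_size.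
by rewrite cap_sum_support ?mul1r// mulr0 mulr_ge0 ?expR_ge0.
Qed.

Lemma bump_mul_integrable alpha M (u : R * R -> R) : alpha != 0 ->
  mu.-integrable setT (EFin \o u) ->
  mu.-integrable setT (EFin \o (fun p => bump alpha M p * u p)).
Proof.
move=> a0 iu; have mu_ : measurable_fun setT u.
  by case/integrableP: iu => h _; exact/measurable_EFinP.
have iu2 := integrableZl measurableT (expR 1 * M%:R) iu.
apply: le_integrable iu2 => //.
  by apply/measurable_EFinP; apply: measurable_funM => //; exact: bump_measurable.
move=> p _ /=; rewrite lee_fin [leLHS]normrM [leRHS]normrM ler_wpM2r//.
by rewrite ger0_norm ?bump_ge0// ger0_norm ?bump_le.
Qed.

Lemma bump_integral alpha M (u v : R * R -> R) : cauchy_riemann u v ->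
  measurable_fun setT u ->
  (\int[mu]_p (bump alpha M p * u p)%:E = (bump_mean M * u origin)%:E)%E.
Proof.
move=> uv mu_.
have mbu : measurable_fun [set: R * R] (fun p => bump alpha M p * u p).
  by apply: measurable_funM => //; exact: bump_measurable.
rewrite gaussian_integral_real//.
have -> : (bump_mean M * u origin)%:E = ((pi^-1)%:E * \int[dA]_p (cap_sum 1 M p * u p)%:E)%E.
  by rewrite (cap_sum_integral M ltr01 uv) -EFinM; congr EFin; rewrite /bump_mean; ring.
rewrite -integralZl//; last exact: cap_sum_integrable uv.
apply: ae_eq_integral => //.
- apply/measurable_EFinP; apply: measurable_funM => //; exact: measurable_gauss_density.
- apply: emeasurable_funM => //; apply/measurable_EFinP.
  by apply: measurable_funM => //; exact: cap_sum_measurable.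
have [N [mN N0 hN]] := @origin_null R.
exists N; split => // p hp; apply: hN => p0; apply: hp => _.
rewrite bump_off_origin// densityE -EFinM; congr EFin.
have e1 : expR (sqnorm p) * expR (- sqnorm p) = 1 by rewrite -expRD subrr expR0.
transitivity (pi^-1 * (cap_sum 1 M p * u p) * (expR (sqnorm p) * expR (- sqnorm p))).
  ring.
by rewrite e1 mulr1.
Qed.

Lemma bump_orthogonal alpha M (u v : R * R -> R) : alpha != 0 -> cauchy_riemann u v ->
  mu.-integrable setT (EFin \o u) ->
  \int[mu]_p ((bump alpha M p - bump_mean M) * u p) = 0.
Proof.
move=> a0 uv iu; have mu_ : measurable_fun setT u.
  by case/integrableP: iu => h _; exact/measurable_EFinP.
have i1 := @bump_mul_integrable alpha M u a0 iu.
have i2 : mu.-integrable setT (EFin \o (fun p => bump_mean M * u p)).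
  by have := integrableZl measurableT (bump_mean M) iu; apply: eq_integrable.
have -> : (\int[mu]_p ((bump alpha M p - bump_mean M) * u p) =
    \int[mu]_p (bump alpha M p * u p - bump_mean M * u p))%R.
  by apply: eq_Rintegral => p _; rewrite mulrBl.
rewrite RintegralB// RintegralZl//.
rewrite /Rintegral (bump_integral alpha M uv mu_) (gaussian_mean_value uv mu_ iu) /=.
by rewrite subrr.
Qed.

Lemma F2_component_integrable (k : C -> C) (u : R * R -> R) : L2 k ->
  measurable_fun setT u -> (forall p, `|u p| <= modC (k (toC p))) ->
  mu.-integrable setT (EFin \o u).
Proof.
move=> Lk mu_ hu; have [mk _] := Lk; apply/integrableP; split.
  exact/measurable_EFinP.
apply: le_lt_trans (ltry (normL2 k)); apply: le_trans (integral_modC_le Lk).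
apply: ge0_le_integral => //.
- by apply/measurable_EFinP; exact: measurableT_comp.
- by apply/measurable_EFinP; exact: (measurable_modC mk).
by move=> p _; rewrite lee_fin.
Qed.

(** The Bargmann projection of [bump] is the constant [bump_mean]: both the bump
    and the constant have, against an entire function [k], an inner product
    proportional to the conjugate of [k 0], with the same factor. *)
Lemma bump_sub_mean_orthogonal alpha M (k : C -> C) : alpha != 0 -> F2 k ->
  innerL2 (fun z => (power_symbol alpha z)%:C * (test_fun alpha M z)%:C -
    (bump_mean M)%:C) k = 0.
Proof.
move=> a0 [ek Lk]; have [[mr mi] _] := Lk.
have CR := entire_cauchy_riemann ek.
have CR2 := cauchy_riemann_rot CR.
have ir := F2_component_integrable Lk mr (fun p => normr_Re_le _).
have ii := F2_component_integrable Lk mi (fun p => normr_Im_le _).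
have o1 := bump_orthogonal M a0 CR ir.
have o2 := bump_orthogonal M a0 CR2 ii.
rewrite /innerL2 /integralC.
have -> : \int[mu]_p Re (((power_symbol alpha (toC p))%:C * (test_fun alpha M (toC p))%:C
    - (bump_mean M)%:C) * conjc (k (toC p))) = 0.
  rewrite -[RHS]o1; apply: eq_Rintegral => p _; rewrite -rmorphM -rmorphB /bump.
  by case: (k _) => x y /=; ring.
have -> : \int[mu]_p Im (((power_symbol alpha (toC p))%:C * (test_fun alpha M (toC p))%:C
    - (bump_mean M)%:C) * conjc (k (toC p))) = 0.
  transitivity (-1 * \int[mu]_p ((bump alpha M p - bump_mean M) * Im (k (toC p))));
    last by rewrite o2 mulr0.
  rewrite -RintegralZl//; last first.
    have i2 := integrableZl measurableT (bump_mean M) ii.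
    have := integrableB measurableT (bump_mul_integrable M a0 ii) i2.
    by apply: eq_integrable => // p _ /=; rewrite mulrBl EFinB.
  apply: eq_Rintegral => p _; rewrite -rmorphM -rmorphB /bump.
  by case: (k _) => x y /=; ring.
by [].
Qed.

(** For [alpha <= -1] one has [|p|^(-2 alpha) <= |p|^2] on the unit disc, and
    [|p|^2 S(p) <= 1]; the squared norm is thus controlled by the mass of [S],
    that is by [bump_mean] itself. *)
Lemma test_fun_norm alpha M : alpha <= -1 ->
  (\int[mu]_p (test_fun alpha M (toC p) ^+ 2)%:E <= (expR 1 * bump_mean M)%:E)%E.
Proof.
move=> a1; have pi0 : (0 : R) < pi := pi_gt0 R.
have k0 : (0 : R) <= expR 1 * pi^-1 by rewrite mulr_ge0 ?expR_ge0// invr_ge0 ltW.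
have mt : measurable_fun [set: R * R] (fun p => (test_fun alpha M (toC p) ^+ 2)%:E).
  by apply/measurable_EFinP; apply: measurable_funX; exact: test_fun_measurable.
rewrite (gaussian_integral _ mt); last by move=> p; rewrite lee_fin sqr_ge0.
have -> : (expR 1 * bump_mean M)%:E = ((expR 1 * pi^-1)%:E * \int[dA]_p (cap_sum 1 M p)%:E)%E.
  have := cap_sum_integral M ltr01 (cauchy_riemann_const (1 : R)).
  under eq_integral do rewrite mulr1.
  by move=> ->; rewrite -EFinM mul1r mulrA.
have mS : measurable_fun [set: R * R] (fun p => (cap_sum 1 M p)%:E).
  by apply/measurable_EFinP; exact: cap_sum_measurable.
rewrite -ge0_integralZl//; last by move=> p _; rewrite lee_fin cap_sum_ge0.
apply: ge0_le_integral => //.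
- by move=> p _; rewrite -EFinM lee_fin mulr_ge0 ?sqr_ge0 ?gauss_density_ge0.
- by apply: emeasurable_funM => //; exact: density_measurable.
- exact: emeasurable_funM.
move=> p _; rewrite -!EFinM lee_fin test_funE densityE.
have S0 := cap_sum_ge0 1 M p; have s0 := sqnorm_ge0 p.
have [s1|/ltW s1] := leP (sqnorm p) 1; last first.
  by rewrite cap_sum_support ?mul1r// !mulr0 expr0n/= mul0r.
have x1 : modC (toC p) <= 1 by rewrite -(@expr_le1 _ 2) ?modC_ge0// -sqnormE.
have hp : (modC (toC p) `^ (- alpha)) ^+ 2 <= sqnorm p.
  rewrite sqr_powR sqnormE -powR_mulrn ?modC_ge0//.
  have [->|x0] := eqVneq (modC (toC p)) 0.
    by rewrite !powR0//; lra.
  apply: ger_powR; last by lra.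
  by rewrite lt_neqAle eq_sym x0 modC_ge0.
have SS := cap_sum_le M p ltr01; rewrite mul1r in SS.
set S := cap_sum 1 M p in S0 SS *; set s := sqnorm p in hp SS s0 s1 *.
set w := _ `^ _ in hp *.
have e1 : expR s * expR (- s) = 1 by rewrite -expRD subrr expR0.
have -> : (w * (expR s * S)) ^+ 2 * (pi^-1 * expR (- s)) =
    (expR s * pi^-1) * (w ^+ 2 * S * S) * (expR s * expR (- s)) by ring.
rewrite e1 mulr1; apply: ler_pM.
- by rewrite mulr_ge0 ?expR_ge0// invr_ge0 ltW.
- by apply: mulr_ge0 => //; apply: mulr_ge0 => //; exact: sqr_ge0.
- by rewrite ler_wpM2r ?invr_ge0 ?(ltW pi0)// ler_expR.
rewrite -[leRHS]mul1r ler_wpM2r//; apply: le_trans SS; exact: ler_wpM2r.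
Qed.

(** The projection of [g f], with [f] the test function, is the constant [m],
    of norm [m], whereas the norm of [f] is at most a constant times the square
    root of [m]; and [m] is arbitrarily large. *)
Lemma U_unbounded_singular (alpha : R) : alpha <= -1 -> ~ U_bounded (power_symbol alpha).
Proof.
move=> a1 [c c0 hc]; have pi0 : (0 : R) < pi := pi_gt0 R.
have a0 : alpha != 0 by apply/eqP => a0; move: a1; rewrite a0; lra.
have J0 : 0 < cap_mass by exact: cap_mass_gt0.
have [M hM] := @shifted_harmonic_unbounded R ((c ^+ 2 * expR 1 + 1) * pi / (3 * cap_mass)).
set m := bump_mean M.
have mlow : c ^+ 2 * expR 1 + 1 <= m.
  rewrite /m /bump_mean ler_pdivlMl// [leLHS]mulrC [leRHS]mulrC.
  by rewrite -ler_pdivrMr// mulr_gt0.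
have m0 : 0 < m.
  by apply: lt_le_trans mlow; rewrite ltr_wpDl// mulr_ge0 ?expR_ge0 ?sqr_ge0.
pose f : C -> C := fun z => (test_fun alpha M z)%:C.
have mf : Defs.measurableC f by apply: measurableC_real; exact: test_fun_measurable.
have fE p : modC (f (toC p)) ^+ 2 = test_fun alpha M (toC p) ^+ 2.
  by rewrite /f modC_real ger0_norm ?test_fun_ge0.
have Lf : L2 f.
  split => //; under eq_integral do rewrite fE.
  by apply: le_lt_trans (test_fun_norm M a1) (ltry _).
pose phi : C -> C := fun z => (power_symbol alpha z)%:C * f z.
have phiE p : phi (toC p) = (bump alpha M p)%:C by rewrite /phi /f -rmorphM.
have Lphi : L2 phi.
  split; first exact: measurableC_symbol.
  apply: (@le_lt_trans _ _ (\int[mu]_p ((expR 1 * M%:R) ^+ 2)%:E)%E); last first.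
    by rewrite (integral_cst mu measurableT)/= [X in (_ * X)%E]gaussian_setT mule1 ltry.
  apply: ge0_le_integral => //.
  - by move=> p _; rewrite lee_fin sqr_ge0.
  - apply/measurable_EFinP; apply: measurable_funX.
    exact: (measurable_modC (measurableC_symbol alpha mf)).
  move=> p _; rewrite lee_fin phiE modC_real ger0_norm ?bump_ge0//.
  by rewrite lerXn2r ?nnegrE ?bump_ge0 ?bump_le// mulr_ge0 ?expR_ge0.
have [[_ Lh] ho] := bargmann_projP (F2_cst m) (fun k Fk => bump_sub_mean_orthogonal M a0 Fk).
have hle := hc f (conj Lf Lphi); rewrite /U_op in hle.
set h := bargmann_proj _ in Lh ho hle.
have [_ L1] := F2_cst (1 : R).
have mh : m <= normL2 h.
  (* The norm of the projection is bounded below by pairing with 1. *)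
  have -> : m = pairing phi (fun=> 1%:C).
    rewrite /pairing /Rintegral.
    have -> : (\int[mu]_p (Re (phi (toC p) * conjc 1%:C))%:E =
        \int[mu]_p (bump alpha M p * 1)%:E)%E.
      by apply: eq_integral => p _; rewrite phiE /=; congr EFin; ring.
    by rewrite (bump_integral alpha M (cauchy_riemann_const (1 : R)))//= mulr1.
  rewrite (pairing_orthogonal Lphi Lh L1 (ho _ (F2_cst 1))).
  apply: le_trans (pairing_le Lh L1) _.
  rewrite -[leRHS]mulr1 ler_wpM2l ?normL2_ge0//; apply: normL2_le => //.
  rewrite expr1n; under eq_integral do rewrite modC_real normr1 expr1n.
  by rewrite (integral_cst mu measurableT)/= [X in (_ * X)%E]gaussian_setT mule1.
have f2 : normL2 f ^+ 2 <= expR 1 * m.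
  rewrite -lee_fin sqr_normL2//; under eq_integral do rewrite fE.
  exact: test_fun_norm.
have mc : m ^+ 2 <= c ^+ 2 * (expR 1 * m).
  apply: (@le_trans _ _ ((c * normL2 f) ^+ 2)).
    rewrite lerXn2r ?nnegrE ?(ltW m0) ?mulr_ge0 ?normL2_ge0 ?(ltW c0)//.
    exact: le_trans mh hle.
  by rewrite exprMn ler_wpM2l ?sqr_ge0.
rewrite expr2 mulrA ler_pM2r// in mc.
by have := le_trans mlow mc; rewrite gerDl ler10.
Qed.

Theorem U_bounded_power (alpha : R) : U_bounded (power_symbol alpha) <-> -1 < alpha <= 0.
Proof.
split=> [T|]; last exact: U_bounded_small.
apply/andP; split.
  by rewrite ltNge; apply/negP => /U_unbounded_singular; exact.
by rewrite leNgt; apply/negP => /U_unbounded_pos; exact.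
Qed.

End singular_symbol.

Theorem proposition1p6 (R : realType) (alpha : R) :
  [/\ forall t : R, 0 < t ->
        (Linfty (heat_transform (power_symbol alpha) t) <-> -2 < alpha <= 0),
      T_bounded (power_symbol alpha) <-> -2 < alpha <= 0,
      U_bounded (power_symbol alpha) <-> -1 < alpha <= 0
    & -2 < alpha <= -1 ->
        T_bounded (power_symbol alpha) /\ ~ U_bounded (power_symbol alpha)].
Proof.
split.
- by move=> t; exact: heat_transform_Linfty.
- exact: T_bounded_power.
- exact: U_bounded_power.
- move=> /andP[a2 a1]; split.
    by apply/T_bounded_power; rewrite a2; lra.
  by move=> /U_bounded_power /andP[]; rewrite ltNge a1.
Qed.
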